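(* Let $x\in\mathbb{R}^d$ be fixed and let $\delta=\delta_m>0$ be arbitrary temporal mesh sizes. Then the second-order temporal variation $\mathbf{V}_{\mathrm{te}}$ satisfies $$\sqrt{m}\left(\frac{\delta^{\beta-3}}{m^2}\mathbf{V}_{\mathrm{te}}-\frac{C_{\mathrm{te},\mathbb{E}}}{\vartheta^{\beta/2}}\right)\xrightarrow{d}N\left(0,\frac{C_{\mathrm{te},\mathbb{V}}}{\vartheta^\beta}\right),\qquad m\to\infty.$$
   Context: Let $d\in\mathbb{N}$, $\beta\in(0,\min(2,d))$ and $\vartheta>0$. $u=(u(t,x))_{t\ge0,x\in\mathbb{R}^d}$ denotes the solution of the stochastic wave equation $\partial_{tt}^2u=\vartheta\Delta u+\dot W_\beta$ on $\mathbb{R}^d$ with $u(0,\cdot)=\partial_tu(0,\cdot)\equiv0$, driven by centred Gaussian noise that is white in time and has Riesz-kernel spatial covariance (proportional to $|x-y|^{-\beta}$) with spectral density $|\xi|^{\beta-d}$. That is, $u$ is the centred Gaussian process with covariance $$\mathbb{E}[u(t,x)u(s,y)]=\frac{1}{(2\pi)^d}\int_0^{t\wedge s}\int_{\mathbb{R}^d}e^{\mathrm{i}(x-y)\cdot\xi}\,\frac{\sin((t-r)\sqrt\vartheta|\xi|)}{\sqrt\vartheta|\xi|}\,\frac{\sin((s-r)\sqrt\vartheta|\xi|)}{\sqrt\vartheta|\xi|}\,|\xi|^{\beta-d}\,d\xi\,dr.$$ Observation times: $t_i=\delta i$, $i=0,\dots,m+1$. Define $\mathbf{I}_{\mathrm{te},i}=u(t_{i+1},x)+u(t_{i-1},x)-2u(t_i,x)$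 for $i=1,\dots,m$ and $\mathbf{V}_{\mathrm{te}}=\sum_{i=1}^m\mathbf{I}_{\mathrm{te},i}^2$. Constants: with $g_{\mathrm{te}}(\omega)=\sin^4(|\omega|/2)|\omega|^{\beta-d-2}$ and $\mathcal{F}_c^+(f)(\xi)=\int_{\mathbb{R}^d}f(\omega)\cos(|\omega|\xi)\,d\omega$ for $\xi\in\mathbb{R}$, $$C_{\mathrm{te},\mathbb{E}}=\frac{4}{(2\pi)^d}\|g_{\mathrm{te}}\|_{L^1(\mathbb{R}^d)},\qquad C_{\mathrm{te},\mathbb{V}}=\frac{128}{3(2\pi)^{2d}}\sum_{j\in\mathbb{Z}}\big(\mathcal{F}_c^+(g_{\mathrm{te}})(j)\big)^2.$$ *)

(* Defs.v *)
From HB Require Import structures.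
From mathcomp Require Import all_boot all_order all_algebra.
From mathcomp Require Import complex.
From mathcomp Require Import all_classical all_reals all_analysis.

Set Implicit Arguments.
Unset Strict Implicit.
Unset Printing Implicit Defensive.

Import Order.TTheory GRing.Theory Num.Theory.
Import numFieldNormedType.Exports.

Local Open Scope classical_set_scope.
Local Open Scope ring_scope.

Notation euclid R d := (d.-tuple (measurableTypeR R)).

Section lebesgue_euclid.
Context {R : realType}.

Definition cons_pair n (z : measurableTypeR R * euclid R n) : euclid R n.+1 :=
  [tuple of z.1 :: z.2].

Lemma measurable_cons_pair n : measurable_fun [set: _] (@cons_pair n).
Proof. exact: measurable_cons. Qed.

Section cons_measure.
Variables (n : nat) (mu : {sigma_finite_measure set (euclid R n) -> \bar R}).

Definition cons_measure : set (euclid R n.+1) -> \bar R :=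
  pushforward (@lebesgue_measure R \x mu)%E (@cons_pair n).

Let cons_measure0 : cons_measure set0 = 0%E.
Proof. by rewrite /cons_measure /pushforward preimage_set0 measure0. Qed.

Let cons_measure_ge0 A : (0 <= cons_measure A)%E.
Proof. by rewrite /cons_measure /pushforward measure_ge0. Qed.

Let cons_measure_sigma_additive : semi_sigma_additive cons_measure.
Proof.
have mf := @measurable_cons_pair n.
exact: (@measure_semi_sigma_additive _ _ _
  (measure_function_pushforward__canonical__measure_function_Measure
     (@lebesgue_measure R \x mu)%E mf)).
Qed.

HB.instance Definition _ := isMeasure.Build _ _ _ cons_measure
  cons_measure0 cons_measure_ge0 cons_measure_sigma_additive.

Lemma cons_measureX (A : set (measurableTypeR R)) (B : set (euclid R n)) :
  measurable A -> measurable B ->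
  cons_measure [set t | A (thead t) /\ B [tuple of behead t]] =
  (@lebesgue_measure R A * mu B)%E.
Proof.
move=> mA mB; rewrite /cons_measure /pushforward -product_measure1E//.
congr product_measure1; apply/seteqP; split => -[a x] /=;
  by rewrite theadE (_ : [tuple of _] = x)//; apply/val_inj.
Qed.

Let cons_measure_sigma_finite : sigma_finite [set: _] cons_measure.
Proof.
have /sigma_finiteP[F [FT ndF Foo]] := sigma_finiteT (@lebesgue_measure R).
have /sigma_finiteP[G [GT ndG Goo]] := sigma_finiteT mu.
exists (fun k => [set t | F k (thead t) /\ G k [tuple of behead t]]).
  apply/esym/seteqP; split => // t _.
  have [k _ Fk] : (\bigcup_k F k) (thead t) by rewrite -FT.
  have [l _ Gl] : (\bigcup_l G l) [tuple of behead t] by rewrite -GT.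
  exists (maxn k l) => //; split.
    by move: Fk; exact/subsetPset/ndF/leq_maxl.
  by move: Gl; exact/subsetPset/ndG/leq_maxr.
move=> k; have [mF Fk] := Foo k; have [mG Gk] := Goo k; split.
  apply: measurableI.
    by rewrite -[X in measurable X]setTI; apply: measurable_tnth.
  by rewrite -[X in measurable X]setTI; apply: measurable_behead.
by rewrite cons_measureX// lte_mul_pinfty// ge0_fin_numE.
Qed.

HB.instance Definition _ := Measure_isSigmaFinite.Build _ _ _ cons_measure
  cons_measure_sigma_finite.

End cons_measure.

Fixpoint lebesgue_euclid d : {sigma_finite_measure set (euclid R d) -> \bar R} :=
  if d is n.+1 then cons_measure (lebesgue_euclid n) else dirac [tuple].

Lemma lebesgue_euclid_box d (A : 'I_d -> set (measurableTypeR R)) :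
  (forall i, measurable (A i)) ->
  lebesgue_euclid d [set x | forall i, A i (tnth x i)] =
  (\prod_(i < d) @lebesgue_measure R (A i))%E.
Proof.
elim: d A => [|n IH] A mA.
  by rewrite big_ord0 /= diracE mem_set//= => -[].
rewrite big_ord_recl /= /cons_measure /pushforward.
rewrite (_ : _ @^-1` _ = A ord0 `*` [set x | forall i, A (lift ord0 i) (tnth x i)]).
  have mB : measurable [set x : euclid R n | forall i, A (lift ord0 i) (tnth x i)].
    rewrite (_ : [set x | _] =
      \bigcap_(i in [set: 'I_n]) (fun x => tnth x i) @^-1` (A (lift ord0 i))).
      apply: fin_bigcap_measurable; [exact: finite_finset|move=> i _].
      by rewrite -[X in measurable X]setTI; apply: measurable_tnth.
    by apply/seteqP; split => x /= H i; [move=> _; exact: H|exact: (H i I)].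
  rewrite product_measure1E//; congr mule.
  exact: (IH (fun i => A (lift ord0 i))).
apply/seteqP; split => -[a x] /=.
  move=> H; split; first exact: (H ord0).
  by move=> i; have := H (lift ord0 i); rewrite tnthS.
move=> [Ha Hx] i; case: (unliftP ord0 i) => [j|] ->; last by [].
by rewrite tnthS.
Qed.

End lebesgue_euclid.

Section euclidean_structure.
Context {R : realType} {d : nat}.
Implicit Types x y : euclid R d.

Definition dotp x y : R := \sum_(i < d) tnth x i * tnth y i.

Definition enorm x : R := Num.sqrt (dotp x x).

Definition subt x y : euclid R d := [tuple tnth x i - tnth y i | i < d].

End euclidean_structure.

Local Open Scope complex_scope.

Definition expi {R : realType} (a : R) : R[i] := cos a +i* sin a.

Definition cRintegral {disp} {T : measurableType disp} {R : realType}
    (mu : {measure set T -> \bar R}) (D : set T) (f : T -> R[i]) : R[i] :=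
  (\int[mu]_(x in D) complex.Re (f x)) +i* (\int[mu]_(x in D) complex.Im (f x)).

(* The variance, not the standard deviation, is the second parameter.  The
   degenerate case is separate because normal_prob m 0 is not a Dirac mass: it
   is uniform on [0, 1]. *)
Definition gaussian_law {R : realType} (m v : R) :
    set (measurableTypeR R) -> \bar R :=
  if Num.sqrt v == 0 then \d_m else normal_prob m (Num.sqrt v).

Section probability_notions.
Context {disp} {Omega : measurableType disp} {R : realType}.
Variable P : probability Omega R.

Definition has_law (X : Omega -> R) (Q : set (measurableTypeR R) -> \bar R) :=
  forall A : set (measurableTypeR R), measurable A -> P (X @^-1` A) = Q A.

Definition gaussian_process (I : Type) (D : set I) (X : I -> {RV P >-> R}) :=
  forall (n : nat) (i : 'I_n -> I) (a : 'I_n -> R), (forall k, D (i k)) ->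
    exists m v : R, 0 <= v /\
      has_law (fun w => \sum_(k < n) a k * X (i k) w) (gaussian_law m v).

Definition cvg_in_law (X : nat -> Omega -> R)
    (Q : set (measurableTypeR R) -> \bar R) :=
  (forall n, measurable_fun [set: Omega] (X n)) /\
  forall r : R, {for r, continuous (fun z : R => Q `]-oo, z]%classic)} ->
    P (X n @^-1` `]-oo, r]%classic) @[n --> \oo] --> Q `]-oo, r]%classic.

End probability_notions.

Section wave_equation.
Context {R : realType} {d : nat}.
Variables (theta beta : R).

(* Fourier transform at |xi| = a of the fundamental solution of the operator
   \partial_tt^2 - theta * \Delta; for a = 0 (a null set) its value is 0. *)
Definition wave_symbol (t a : R) : R :=
  sin (t * Num.sqrt theta * a) / (Num.sqrt theta * a).

Definition wave_covariance (t : R) (x : euclid R d) (s : R) (y : euclid R d) :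
    R[i] :=
  (((2 * pi) ^+ d)^-1)%:C *
  cRintegral (@lebesgue_measure R) `[0, Num.min t s]%classic (fun r =>
    cRintegral (lebesgue_euclid d) [set: _] (fun xi =>
      expi (dotp (subt x y) xi) *
      (wave_symbol (t - r) (enorm xi) * wave_symbol (s - r) (enorm xi) *
       enorm xi `^ (beta - d%:R))%:C)).

(* fine loses nothing here: the first clause makes every u t x Gaussian, hence
   square-integrable.  Values of u at negative times are unconstrained. *)
Definition wave_solution {disp} {Omega : measurableType disp}
    (P : probability Omega R) (u : R -> euclid R d -> {RV P >-> R}) : Prop :=
  [/\ gaussian_process [set p : R * euclid R d | 0 <= p.1]
        (fun p => u p.1 p.2),
      forall t x, 0 <= t -> ('E_P[u t x] = 0)%E &
      forall t x s y, 0 <= t -> 0 <= s ->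
        (fine ('E_P[fun w => (u t x w * u s y w)%R])%E)%:C =
        wave_covariance t x s y].

End wave_equation.

Section temporal_variation.
Context {R : realType} {T Omega : Type}.
Variables (u : R -> T -> Omega -> R) (delta : R) (x : T).

Definition increment_te (i : nat) (w : Omega) : R :=
  u (delta * i.+1%:R) x w + u (delta * i.-1%:R) x w - 2 * u (delta * i%:R) x w.

Definition V_te (m : nat) (w : Omega) : R :=
  \sum_(1 <= i < m.+1) increment_te i w ^+ 2.

End temporal_variation.

Section constants.
Context {R : realType}.
Variables (d : nat) (beta : R).

Definition g_te (omega : euclid R d) : R :=
  sin (enorm omega / 2) ^+ 4 * enorm omega `^ (beta - d%:R - 2).

Definition cosine_transform (f : euclid R d -> R) (xi : R) : R :=
  \int[lebesgue_euclid d]_omega (f omega * cos (enorm omega * xi)).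

Definition C_teE : R :=
  4 / (2 * pi) ^+ d * fine (Lnorm (lebesgue_euclid d) 1 (EFin \o g_te)).

Definition C_teV : R :=
  128 / (3 * (2 * pi) ^+ (2 * d)) *
  fine (\esum_(j in [set: int]) ((cosine_transform g_te j%:~R) ^+ 2)%:E).

End constants.

(* Main.v *)
Require Import Defs.
From HB Require Import structures.
From mathcomp Require Import all_boot all_order all_algebra.
From mathcomp Require Import ring lra complex.
From mathcomp Require Import all_classical all_reals all_analysis measurable_realfun.

Set Implicit Arguments.
Unset Strict Implicit.
Unset Printing Implicit Defensive.

Import Order.TTheory GRing.Theory Num.Theory.
Import numFieldNormedType.Exports.

Local Open Scope classical_set_scope.
Local Open Scope ring_scope.

(** The rescaled variation is an affine function of the squared norm of a
Gaussian vector, the vector of the m second-order increments. The theorem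
therefore follows from a central limit theorem for Gaussian quadratic forms
once the covariance matrix S of the increments is known to sufficient accuracy.

Covariance of the increments. In the covariance of u the integral over the
frequencies depends on a single function of one real variable, the radial
integral Phi(y) of (1 - cos(|x| y)) |x|^(beta-d-2) over R^d (cos_defect). The
change of variables x -> y x gives Phi(y) = |y|^g Phi(1) with g = 2 - beta
(cos_defect_homogeneous), so that the product-to-sum formula and an integration
in time express E[u(t,x) u(s,x)] through (t+s)^(g+1), |t-s|^(g+1) and
(t+s) |t-s|^g (wave_covarianceE). Taking second differences in both times turns
these powers into centred fourth differences D. With W a constant and delta the
mesh,

  S_ij = W delta^(3-beta) (min(i,j) rho(|i-j|) + r_ij),   rho = - D |.|^g,

where r_ij is bounded and rho(n) = O(n^-2) (increment_cos,
increment_covarianceE, fourth_difference_decay). The factor min(i,j) is there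
because the energy of the undamped wave equation grows linearly in time; it
accounts for the normalisation m^2 and for the factor 1/3 in the limiting
variance. Since sin^4(y/2) is a combination of cos(y) and cos(2y), the cosine
transform of g_te at n is Phi(1) rho(n) / 16 (cosine_transform_g_teE), which
identifies the two constants of the theorem (C_teE_decay, C_teV_decay).

Central limit theorem for quadratic forms. Let G be a standard Gaussian vector
and Q = <G, S G>. For a bounded continuous h let f be the bounded solution of
Stein's equation h(x) - E h(N) = f'(x) - x f(x) / s^2, with N centred normal of
variance s^2 (stein_equation). Gaussian integration by parts, coordinate by
coordinate, gives

  E[(Q - tr S) f(c (Q - tr S))] = 2 c E[f'(c (Q - tr S)) |S G|^2],

and hence, replacing |S G|^2 by its mean tr S^2, the distance from
E h(c (Q - tr S)) to E h(N) is at most a constant times the sum of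
|1 - 2 c^2 tr(S^2) / s^2| and c^2 sqrt(tr S^4) (stein_bound). It remains to
check that 2 c^2 tr S^2 converges to s^2 and c^4 tr S^4 to 0, and that the
centring is right (quadratic_clt).

From the increments to Q. What is known about the increments X is the law of
their linear combinations, that is E cos<z,X> = exp(-<z,S z>/2). Integrating
over z against a Gaussian law linearises the square and yields
E exp(-k |X|^2) = E exp(-k Q) without a square root of S (laplace_duality).
Laplace transforms at the integers determine a law on the half-line, by
Bernstein polynomials in exp(-v) (laplace_determinacy), so |X|^2 and Q have the
same law (sqnorm_law).

Asymptotics. Summability of rho bounds the row sums of |S| by O(m), up to the
mesh factor, so tr S^4 = O(m^5) (sum_sqr_mul_le). Up to the same factor, tr S^2
is (m^3 / 3) times the sum over Z of rho(|n|)^2, up to O(m^2)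
(toeplitz_sqr_asymptotics), and tr S is rho(0) m^2 / 2 up to O(m)
(toeplitz_trace_asymptotics). With c of order m^(-3/2) these are the three
conditions. *)

(** * Real-valued integrals *)

Section real_integral.
Context {disp : measure_display} {T : measurableType disp} {R : realType}.
Implicit Types (mu : {measure set T -> \bar R}) (f g : T -> R).

Lemma integrable_le mu (D : set T) f g : measurable D -> measurable_fun D f ->
  mu.-integrable D (EFin \o g) -> (forall x, D x -> `|f x| <= g x) ->
  mu.-integrable D (EFin \o f).
Proof.
move=> mD mf ig fg; apply: (le_integrable mD _ _ ig).
  exact/measurable_EFinP.
move=> x Dx /=; rewrite lee_fin; apply: (le_trans (fg x Dx)).
exact: ler_norm.
Qed.

Lemma integrable_measurable mu (D : set T) f : mu.-integrable D (EFin \o f) ->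
  measurable_fun D f.
Proof. by move=> /integrableP[/measurable_EFinP]. Qed.

Lemma integrable_bounded (P : probability T R) f (C : R) :
  measurable_fun setT f -> (forall x, `|f x| <= C) ->
  P.-integrable setT (EFin \o f).
Proof.
move=> mf fC; apply: (@integrable_le P setT f (cst C)) => //.
exact: (finite_measure_integrable_cst P).
Qed.

Lemma Rintegral_prob_cst (P : probability T R) (c : R) : \int[P]_x c = c.
Proof.
transitivity (c * fine (P setT)); first exact: Rintegral_cst.
by rewrite (@probability_setT _ _ _ P) /= mulr1. Qed.

Lemma integrable_Rsum mu (D : set T) (I : Type) (r : seq I) (f : I -> T -> R) :
  measurable D -> (forall i, mu.-integrable D (EFin \o f i)) ->
  mu.-integrable D (EFin \o (fun x => \sum_(i <- r) f i x)).
Proof.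
move=> mD fi; elim: r => [|i r IH].
  by under [X in integrable _ _ (_ \o X)]eq_fun do rewrite big_nil; exact: integrable0.
under [X in integrable _ _ (_ \o X)]eq_fun do rewrite big_cons.
exact: (integrableD mD (fi i) IH).
Qed.

Lemma Rintegral_sum mu (D : set T) (I : Type) (r : seq I) (f : I -> T -> R) :
  measurable D -> (forall i, mu.-integrable D (EFin \o f i)) ->
  \int[mu]_(x in D) (\sum_(i <- r) f i x) = \sum_(i <- r) \int[mu]_(x in D) f i x.
Proof.
move=> mD fi; elim: r => [|i r IH].
  under eq_Rintegral do rewrite big_nil.
  by rewrite big_nil /Rintegral/= integral0.
under eq_Rintegral do rewrite big_cons.
rewrite RintegralD// ?big_cons ?IH//.
exact: integrable_Rsum.
Qed.

Lemma integrableRD mu (D : set T) f g : measurable D ->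
  mu.-integrable D (EFin \o f) -> mu.-integrable D (EFin \o g) ->
  mu.-integrable D (EFin \o (fun x => f x + g x)).
Proof. by move=> mD fi gi; exact: (integrableD mD fi gi). Qed.

Lemma integrableRB mu (D : set T) f g : measurable D ->
  mu.-integrable D (EFin \o f) -> mu.-integrable D (EFin \o g) ->
  mu.-integrable D (EFin \o (fun x => f x - g x)).
Proof. by move=> mD fi gi; exact: (integrableB mD fi gi). Qed.

Lemma integrableRZ mu (D : set T) (c : R) f : measurable D ->
  mu.-integrable D (EFin \o f) ->
  mu.-integrable D (EFin \o (fun x => c * f x)).
Proof. by move=> mD fi; exact: (integrableZl mD c fi). Qed.

(** Dominated convergence for real-valued integrals, with pointwise
    convergence everywhere, so that measurability of the limit comes for
    free. *)
Lemma Rdominated_cvg mu (D : set T) (f_ : nat -> T -> R) f g :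
  measurable D -> (forall n, measurable_fun D (f_ n)) ->
  (forall x, D x -> f_ n x @[n --> \oo] --> f x) ->
  mu.-integrable D (EFin \o g) ->
  (forall n x, D x -> `|f_ n x| <= g x) ->
  mu.-integrable D (EFin \o f) /\
  (\int[mu]_(x in D) f_ n x @[n --> \oo] --> \int[mu]_(x in D) f x).
Proof.
move=> mD mf cf ig fg.
have mfl : measurable_fun D f.
  exact: ((measurable_fun_cvg (h := f_))).
have int_f : mu.-integrable D (EFin \o f).
  apply: (integrable_le (g := g)) => // x Dx.
  have cn : `|f_ n x| @[n --> \oo] --> `|f x| by apply: cvg_norm; exact: cf.
  rewrite -(cvg_lim (@Rhausdorff R) cn); apply: limr_le.
    by apply/cvg_ex; exists `|f x|.
  by apply: nearW => n; exact: fg.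
split => //; apply: fine_cvg; rewrite fineK; last exact: integrable_fin_num.
apply: (@dominated_cvg _ _ _ mu D mD (fun n x => (f_ n x)%:E) _ (EFin \o g)) => //.
- by move=> n; exact: measurableT_comp.
- by move=> x Dx; apply: cvg_EFin; [exact: nearW|exact: cf].
Qed.

End real_integral.

(** * Calculus in one variable *)

Section one_variable.
Context {R : realType}.

Lemma continuous_of_is_derive (f df : R -> R) :
  (forall x : R, is_derive x 1 f (df x)) -> continuous f.
Proof.
by move=> d y; apply: differentiable_continuous; apply/derivable1_diffP; case: (d y).
Qed.

(** The order of a and b is left open, so that the lemma can be applied to
    increments of either sign. *)
Lemma MVT_dist (f df : R -> R) (a b : R) :
  (forall x : R, is_derive x 1 f (df x)) ->
  exists2 c, `|c - a| <= `|b - a| & f b - f a = df c * (b - a).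
Proof.
move=> fdf.
have cf := continuous_of_is_derive fdf.
have [ab|/ltW ba] := leP a b.
  have [//|c ] := @MVT_segment _ f df a b ab (fun x _ => fdf x).
    exact: continuous_subspaceT.
  rewrite in_itv/= => /andP[ac cb] e; exists c => //.
  by rewrite !ger0_norm ?subr_ge0// lerD2r.
have [//|c ] := @MVT_segment _ f df b a ba (fun x _ => fdf x).
  exact: continuous_subspaceT.
rewrite in_itv/= => /andP[ac cb] e; exists c => //.
  by rewrite !ler0_norm ?subr_le0// !opprB lerD2l lerN2.
by rewrite -opprB e -mulrN opprB.
Qed.

Lemma sin_lipschitz (u v : R) : `|sin u - sin v| <= `|u - v|.
Proof.
have [c _ ->] := @MVT_dist sin cos v u (fun x => is_derive_sin x).
by rewrite normrM ler_piMl// cos_max.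
Qed.

Lemma cos_taylor1 (a x : R) : `|cos (a + x) - cos a + x * sin a| <= x ^+ 2.
Proof.
have d (z : R) : is_derive z 1 (fun z => cos (a + z) + z * sin a) (sin a - sin (a + z)).
  apply: is_derive_eq; rewrite /GRing.scale/=; ring.
have [c cx] := @MVT_dist _ _ 0 x d.
rewrite addr0 mul0r addr0 !subr0 in cx * => e.
rewrite [X in `|X|](_ : _ = (sin a - sin (a + c)) * x); last by rewrite -e; ring.
rewrite normrM -(real_normK (num_real x)) expr2 ler_wpM2r//.
apply: (le_trans (sin_lipschitz _ _)).
by rewrite opprD addNKr normrN.
Qed.

(** For a function defined by an integral, an error bound of second order is
    easier to obtain than a limit of difference quotients. *)
Lemma is_derive_of_quadratic_error (f : R -> R) (x l K : R) :
  (forall h : R, `|f (x + h) - f x - h * l| <= K * h ^+ 2) -> is_derive x 1 f l.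
Proof.
move=> fK.
have cv : h^-1 *: (f (h *: (1 : R) + x) - f x) @[h --> (0 : R)^'] --> l.
  apply/cvgrPdist_le => e e0; near=> h.
  have h0 : h != 0 by near: h; exact: nbhs_dnbhs_neq.
  rewrite /GRing.scale/= mulr1 (addrC h x).
  rewrite [X in `|X|](_ : _ = - (h^-1 * (f (x + h) - f x - h * l))); last by field.
  rewrite normrN normrM normfV ler_pdivrMl ?normr_gt0//.
  apply: (le_trans (fK h)).
  rewrite -(real_normK (num_real h)) expr2 mulrCA ler_wpM2l//.
  apply: (@le_trans _ _ ((`|K| + 1) * `|h|)).
    by rewrite ler_wpM2r// (le_trans (ler_norm _))// lerDl.
  rewrite mulrC -ler_pdivlMr//.
  near: h; apply: dnbhs0_le; by rewrite divr_gt0// ltr_wpDl.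
split; first by apply/cvg_ex; exists l.
exact/cvg_lim.
Unshelve. all: end_near. Qed.

End one_variable.

(** * The normal law on the line *)

Section normal.
Context {R : realType}.
Implicit Types (m s : R).
Local Notation mu := (@lebesgue_measure R).

Lemma integral_normal_prob m s (f : R -> \bar R) :
  measurable_fun setT f -> (\int[normal_prob m s]_x `|f x| < +oo)%E ->
  (\int[normal_prob m s]_x f x = \int[mu]_x (f x * (normal_pdf m s x)%:E))%E.
Proof.
move=> mf finf.
rewrite -(Radon_Nikodym_change_of_variables (normal_prob_dominates m s))//=; last first.
  by apply/integrableP; split.
apply: ae_eq_integral => //.
- apply: emeasurable_funM => //; apply: (measurable_int mu).
  by apply: Radon_Nikodym_integrable; exact: normal_prob_dominates.
- apply: emeasurable_funM => //=; apply/measurableT_comp => //=.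
  exact: measurable_normal_pdf.
- apply: ae_eqe_mul2l => /=.
  rewrite Radon_NikodymE//=; first exact: normal_prob_dominates.
  move=> abmu.
  case: cid => /= h [h1 h2 h3].
  apply: integral_ae_eq => //=.
  + by apply/measurableT_comp =>//; exact: measurable_normal_pdf.
  + by move=> E E01 mE; rewrite -h3.
Qed.

(** Truncation at n and monotone convergence remove the finiteness assumption
    of the change of density. *)
Lemma ge0_integral_normal_prob m s (f : R -> R) :
  measurable_fun setT f -> (forall x, 0 <= f x) ->
  (\int[normal_prob m s]_x (f x)%:E = \int[mu]_x (f x * normal_pdf m s x)%:E)%E.
Proof.
move=> mf f0.
pose g n (x : R) := Num.min (f x) n%:R.
have mg n : measurable_fun setT (g n) by exact: measurable_minr.
have g0 n x : 0 <= g n x by rewrite le_min f0 ler0n.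
have gm x : {homo (g ^~ x) : i j / (i <= j)%N >-> i <= j}.
  move=> i j ij; rewrite /g le_min !ge_min lexx/=.
  by rewrite ler_nat ij orbT.
have gcv x : g ^~ x @ \oo --> f x.
  apply: cvg_near_cst; near=> n; rewrite /g; apply/min_idPl.
  near: n; exact: nbhs_infty_ger.
have eq1 n : (\int[normal_prob m s]_x (g n x)%:E =
    \int[mu]_x (g n x * normal_pdf m s x)%:E)%E.
  rewrite integral_normal_prob//.
    exact: measurableT_comp.
  have : (normal_prob m s).-integrable setT (EFin \o g n).
    apply: (@integrable_bounded _ _ _ (normal_prob m s) (g n) n%:R (mg n)).
    by move=> x; rewrite ger0_norm// ge_min lexx orbT.
  by move=> /integrableP[].
have c1 := @cvg_monotone_convergence _ _ _ (normal_prob m s) setT measurableT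
  (fun n x => (g n x)%:E).
have c2 := @cvg_monotone_convergence _ _ _ mu setT measurableT
  (fun n x => (g n x * normal_pdf m s x)%:E).
have l1 : (\int[normal_prob m s]_x (g n x)%:E @[n --> \oo] --> \int[normal_prob m s]_x (f x)%:E)%E.
  rewrite (_ : (\int[normal_prob m s]_x (f x)%:E)%E = (\int[normal_prob m s]_x (fun x => limn ((fun n => (g n x)%:E))) x)%E).
    apply: c1 => //.
    - by move=> n; apply/measurable_EFinP; exact: mg.
    - by move=> n x _; rewrite lee_fin.
    - by move=> x _ i j ij; rewrite lee_fin gm.
  apply: eq_integral => x _; apply/esym/cvg_lim => //.
  by apply: cvg_EFin; [exact: nearW|exact: gcv].
have l2 : (\int[mu]_x (g n x * normal_pdf m s x)%:E @[n --> \oo] --> \int[mu]_x (f x * normal_pdf m s x)%:E)%E.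
  rewrite (_ : (\int[mu]_x (f x * normal_pdf m s x)%:E)%E = (\int[mu]_x (fun x => limn ((fun n => (g n x * normal_pdf m s x)%:E))) x)%E).
    apply: c2 => //.
    - move=> n; apply/measurable_EFinP; apply: measurable_funM.
        exact: mg.
      exact: measurable_normal_pdf.
    - by move=> n x _; rewrite lee_fin mulr_ge0 ?normal_pdf_ge0.
    - by move=> x _ i j ij; rewrite lee_fin ler_wpM2r ?normal_pdf_ge0 ?gm.
  apply: eq_integral => x _; apply/esym/cvg_lim => //.
  apply: cvg_EFin; [exact: nearW|apply: cvgM; [exact: gcv|exact: cvg_cst]].
move: l1; rewrite (_ : (fun n => _) =
  fun n => (\int[mu]_x (g n x * normal_pdf m s x)%:E)%E).
  by move=> l1; exact: cvg_unique l1 l2.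
by apply/funext => n; exact: eq1.
Unshelve. all: end_near. Qed.

Lemma integrable_normal_probP m s (f : R -> R) : measurable_fun setT f ->
  mu.-integrable setT (EFin \o (fun x => f x * normal_pdf m s x)) <->
  (normal_prob m s).-integrable setT (EFin \o f).
Proof.
move=> mf.
have e : (\int[normal_prob m s]_x `|(f x)%:E| = \int[mu]_x `|(f x * normal_pdf m s x)%:E|)%E.
  under eq_integral do rewrite abse_EFin.
  rewrite (@ge0_integral_normal_prob _ _ (fun x => `|f x|))//; last exact: measurableT_comp.
  by apply: eq_integral => x _; rewrite abse_EFin normrM (ger0_norm (normal_pdf_ge0 m s x)).
split=> /integrableP[_ h]; apply/integrableP; split.
- exact: measurableT_comp.
- by rewrite /= e.
- apply: measurableT_comp => //; apply: measurable_funM => //.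
  exact: measurable_normal_pdf.
- by rewrite /= -e.
Qed.

Lemma Rintegral_normal_prob m s (f : R -> R) :
  (normal_prob m s).-integrable setT (EFin \o f) ->
  \int[normal_prob m s]_x f x = \int[mu]_x (f x * normal_pdf m s x).
Proof.
move=> /integrableP[mf fi]; rewrite /Rintegral; congr fine.
by rewrite integral_normal_prob//.
Qed.

(** Exponential weights are absorbed by doubling the variance, since k |x - m|
    is at most (x - m)^2 / (4 s^2) plus a constant. Integrability of unbounded
    functions under the normal law reduces to this bound. *)
Lemma normal_pdf_expR_abs m s k : s != 0 -> 0 <= k -> exists2 C, 0 <= C &
  forall x, expR (k * `|x|) * normal_pdf m s x <= C * normal_pdf m (Num.sqrt 2 * s) x.
Proof.
move=> s0 k0.
have s20 : Num.sqrt 2 * s != 0 by rewrite mulf_neq0// sqrtr_eq0 -ltNge.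
set A := expR (k * `|m| + k ^+ 2 * s ^+ 2).
exists (normal_peak s * A / normal_peak (Num.sqrt 2 * s)).
  by rewrite !mulr_ge0 ?invr_ge0 ?normal_peak_ge0 ?expR_ge0.
move=> x; rewrite !normal_pdfE// [leRHS]mulrA divfK; last first.
  by rewrite gt_eqF// normal_peak_gt0.
rewrite mulrCA -[leRHS]mulrA ler_wpM2l ?normal_peak_ge0//.
rewrite /normal_fun /A -!expRD ler_expR.
rewrite exprMn sqr_sqrtr//.
have xm : `|x| <= `|m| + `|x - m| by rewrite -{1}(subrK m x) addrC ler_normD.
have -> : (x - m) ^+ 2 = `|x - m| ^+ 2 by rewrite real_normK// num_real.
set y := `|x - m| in xm *.
have s2 : 0 < s ^+ 2 by rewrite exprn_even_gt0.
have e : k ^+ 2 * s ^+ 2 + - y ^+ 2 / ((2 * s ^+ 2) *+ 2) - (- y ^+ 2 / (s ^+ 2 *+ 2)) - k * y = (k * s - y / (2 * s)) ^+ 2.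
  by field.
have := sqr_ge0 (k * s - y / (2 * s)); rewrite -e.
have := ler_wpM2l k0 xm; lra.
Qed.

Lemma integrable_expR_abs m s k : s != 0 -> 0 <= k ->
  (normal_prob m s).-integrable setT (EFin \o (fun x => expR (k * `|x|))).
Proof.
move=> s0 k0; have [C C0 hC] := normal_pdf_expR_abs m s0 k0.
have me : measurable_fun setT (fun x : R => expR (k * `|x|)).
  apply: measurableT_comp => //; apply: measurable_funM => //.
apply/integrable_normal_probP => //.
apply: (@integrable_le _ _ _ mu setT _ (fun x => C * normal_pdf m (Num.sqrt 2 * s) x)) => //.
- apply: measurable_funM => //; exact: measurable_normal_pdf.
- by apply: integrableRZ => //; exact: integrable_normal_pdf.
- move=> x _; rewrite ger0_norm//.
  by rewrite mulr_ge0 ?expR_ge0 ?normal_pdf_ge0.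
Qed.

Lemma is_derive_normal_pdf m s (x : R) : s != 0 ->
  is_derive x 1 (normal_pdf m s) (- ((x - m) / s ^+ 2) * normal_pdf m s x).
Proof.
move=> s0; rewrite normal_pdfE//.
have d : is_derive x 1 (fun x : R => - (x - m) ^+ 2 / (s ^+ 2 *+ 2)) (- ((x - m) / s ^+ 2)).
  apply: is_derive_eq.
  rewrite /GRing.scale/=; field; by rewrite s0.
rewrite /normal_fun.
apply: is_derive_eq.
by rewrite /GRing.scale/=; ring.
Qed.

Lemma normal_pdf_cvg0 m s (e : R) : s != 0 -> `|e| = 1 ->
  normal_pdf m s (e * n%:R) @[n --> \oo] --> 0.
Proof.
move=> s0 e1; set K := expR (`|m| + s ^+ 2 / 2) * normal_peak s.
have s2 : 0 < s ^+ 2 by rewrite exprn_even_gt0.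
(* Young: |x - m| <= (x - m)^2 / (2 s^2) + s^2 / 2 *)
apply: (@squeeze_cvgr _ _ _ _ (cst 0) (fun n => K * expR (- n%:R))).
- near=> n; rewrite normal_pdf_ge0/= normal_pdfE// /normal_fun /K mulrC mulrAC.
  rewrite -expRD ler_wpM2r ?normal_peak_ge0// ler_expR.
  set y := _ - m.
  have yn : n%:R <= `|m| + `|y|.
    have -> : n%:R = `|e * n%:R| :> R by rewrite normrM e1 mul1r normr_nat.
    by rewrite -{1}(subrK m (e * _)) addrC ler_normD.
  have -> : y ^+ 2 = `|y| ^+ 2 by rewrite real_normK// num_real.
  have := sqr_ge0 (`|y| / s - s).
  have -> : (`|y| / s - s) ^+ 2 = `|y| ^+ 2 / s ^+ 2 - 2 * `|y| + s ^+ 2 by field.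
  have -> : - `|y| ^+ 2 / (s ^+ 2 *+ 2) = - (`|y| ^+ 2 / s ^+ 2) / 2 by field.
  lra.
- exact: cvg_cst.
- rewrite -[X in _ --> X](mulr0 K); apply: cvgM; first exact: cvg_cst.
  exact: cvgn_expR.
Unshelve. all: end_near. Qed.

(** The function dh(x) - (x - m) h(x) / s^2, multiplied by the density, is the
    derivative of h times the density. Integrate it over [-n-1, n+1] and let n
    tend to infinity: the boundary terms vanish because h grows at most
    exponentially. *)
Lemma normal_ibp m s (h dh : R -> R) (C k : R) : s != 0 -> 0 <= k -> 
  (forall x : R, is_derive x 1 h (dh x)) -> continuous dh ->
  (forall x, `|h x| <= C * expR (k * `|x|)) ->
  (forall x, `|dh x| <= C * expR (k * `|x|)) ->
  \int[normal_prob m s]_x ((x - m) * h x) = s ^+ 2 * \int[normal_prob m s]_x dh x.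
Proof.
move=> s0 k0 dhh cdh hC dhC.
have s2 : s ^+ 2 != 0 by rewrite expf_neq0.
have ch := continuous_of_is_derive dhh.
have mh : measurable_fun setT h by exact: continuous_measurable_fun.
have mdh : measurable_fun setT dh by exact: continuous_measurable_fun.
have C0 : 0 <= C.
  have := le_trans (normr_ge0 _) (hC 0); by rewrite normr0 mulr0 expR0 mulr1.
have ih1 : (normal_prob m s).-integrable setT (EFin \o dh).
  apply: (@integrable_le _ _ _ (normal_prob m s) setT _ (fun x => C * expR (k * `|x|))) => //.
  by apply: integrableRZ => //; exact: integrable_expR_abs.
have ih2 : (normal_prob m s).-integrable setT (EFin \o (fun x => (x - m) * h x)).
  apply: (@integrable_le _ _ _ (normal_prob m s) setT _ (fun x => (expR `|m| * C) * expR ((k + 1) * `|x|))) => //.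
  - by apply: measurable_funM => //; exact: measurable_funB.
  - by apply: integrableRZ => //; apply: integrable_expR_abs => //; rewrite addr_ge0.
  - move=> x _; rewrite normrM.
    have -> : expR `|m| * C * expR ((k + 1) * `|x|) = (expR (`|m| + `|x|)) * (C * expR (k * `|x|)).
      by rewrite mulrDl mul1r !expRD; ring.
    apply: ler_pM => //; apply: (@le_trans _ _ (`|m| + `|x|)).
      by rewrite [leRHS]addrC; exact: ler_normB.
    by apply: le_trans (expR_ge1Dx _); rewrite lerDr.
pose w x := dh x - (x - m) / s ^+ 2 * h x.
have iw : (normal_prob m s).-integrable setT (EFin \o w).
  apply: integrableRB => //.
  rewrite (_ : (fun x => _) = (fun x => (s ^+ 2)^-1 * ((x - m) * h x))); last first.
    by apply/funext => x; ring.
  exact: integrableRZ.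
have wmu : mu.-integrable setT (EFin \o (fun x => w x * normal_pdf m s x)).
  apply/integrable_normal_probP => //; exact: integrable_measurable iw.
suff W0 : \int[normal_prob m s]_x w x = 0.
  move: W0; rewrite /w RintegralB//; last first.
    rewrite (_ : (fun x => _) = (fun x => (s ^+ 2)^-1 * ((x - m) * h x))); last first.
      by apply/funext => x; ring.
    exact: integrableRZ.
  under [X in _ - X = _ -> _]eq_Rintegral do rewrite mulrAC mulrC.
  by rewrite RintegralZl// => /eqP; rewrite subr_eq0 => /eqP ->; rewrite mulrA divff// mul1r.
rewrite Rintegral_normal_prob//.
pose g x := w x * normal_pdf m s x.
pose H x := h x * normal_pdf m s x.
have dH (x : R) : is_derive x 1 H (g x).
  have d2 := is_derive_normal_pdf m x s0.
  rewrite /H; apply: is_derive_eq.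
  by rewrite /GRing.scale/= /g /w; ring.
have cg : continuous g.
  move=> x; apply: cvgM; last exact: continuous_normal_pdf.
  apply: cvgB; first exact: cdh.
  apply: cvgM; last exact: ch.
  apply: cvgM; last exact: cvg_cst.
  by apply: cvgB; [exact: cvg_id|exact: cvg_cst].
have cH := continuous_of_is_derive dH.
have mg : measurable_fun setT g by exact: continuous_measurable_fun.
have c1 : \int[mu]_(x in `[- n.+1%:R, n.+1%:R]) g x @[n --> \oo] --> \int[mu]_x g x.
  under eq_fun do rewrite Rintegral_mkcond.
  apply: (@Rdominated_cvg _ _ _ mu setT _ g (fun x => `|g x|) _ _ _ _ _).2 => //.
  - move=> n; apply/(measurable_restrictT _ _).1 => //.
    exact: measurable_funTS.
  - move=> x _; apply: cvg_near_cst; near=> n.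
    rewrite patchE mem_set//= in_itv/= -ler_norml.
    apply: (@le_trans _ _ n%:R); last by rewrite ler_nat.
    near: n; exact: nbhs_infty_ger.
  - rewrite (_ : _ \o _ = (fun x => `|(g x)%:E|)%E)//.
    exact: integrable_abse.
  - by move=> n x _; rewrite patchE; case: ifP => //; rewrite normr0.
have c2 : \int[mu]_(x in `[- n.+1%:R, n.+1%:R]) g x @[n --> \oo] --> 0.
  have -> : (fun n => \int[mu]_(x in `[- n.+1%:R, n.+1%:R]) g x) =
    (fun n => H n.+1%:R - H (- n.+1%:R)).
    apply/funext => n; rewrite /Rintegral (@continuous_FTC2 _ g H)//.
    - by rewrite gtrN.
    - exact: continuous_subspaceT.
    - split.
      + by move=> x _; case: (dH x).
      + exact/cvg_at_right_filter/cH.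
      + exact/cvg_at_left_filter/cH.
    - by move=> x _; rewrite derive1E; exact: derive_val.
  have [D D0 hD] := normal_pdf_expR_abs m s0 k0.
  have H0 e : `|e| = 1 -> H (e * n.+1%:R) @[n --> \oo] --> 0.
    move=> e1; apply/norm_cvg0P.
    apply: (@squeeze_cvgr _ _ _ _ (cst 0)
      (fun n => C * D * normal_pdf m (Num.sqrt 2 * s) (e * n.+1%:R))).
    - near=> n; rewrite normr_ge0/= /H normrM (ger0_norm (normal_pdf_ge0 m s _)).
      apply: (le_trans (ler_wpM2r (normal_pdf_ge0 m s _) (hC _))).
      by rewrite -!mulrA ler_wpM2l.
    - exact: cvg_cst.
    - rewrite -[X in _ --> X](mulr0 (C * D)); apply: cvgM; first exact: cvg_cst.
      rewrite (cvg_shiftS (fun n => normal_pdf m (Num.sqrt 2 * s) (e * n%:R))).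
      apply: normal_pdf_cvg0 => //.
      by rewrite mulf_neq0// sqrtr_eq0 -ltNge.
  rewrite -[X in _ --> X](subr0 0); apply: cvgB.
  - by under eq_fun do rewrite -[X in H X]mul1r; apply: H0; rewrite normr1.
  - by under eq_fun do rewrite -[X in H (- X)]mul1r -mulNr; apply: H0; rewrite normrN1.
exact: cvg_unique c1 c2.
Unshelve. all: end_near. Qed.

Lemma integrable_expR_abs_le m s (h : R -> R) (C k : R) : s != 0 -> 0 <= k ->
  measurable_fun setT h -> (forall x, `|h x| <= C * expR (k * `|x|)) ->
  (normal_prob m s).-integrable setT (EFin \o h).
Proof.
move=> s0 k0 mh hC.
apply: (@integrable_le _ _ _ (normal_prob m s) setT _ (fun x => C * expR (k * `|x|))) => //.
by apply: integrableRZ => //; exact: integrable_expR_abs.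
Qed.

Lemma ler_norm_expR (x : R) : `|x| <= expR `|x|.
Proof. by apply: le_trans (expR_ge1Dx _); rewrite lerDr. Qed.

(** Integration by parts with h = 1. *)
Lemma normal_mean m s : s != 0 ->
  (normal_prob m s).-integrable setT (EFin \o (fun x : R => x)) /\
  \int[normal_prob m s]_x x = m.
Proof.
move=> s0.
have i1 : (normal_prob m s).-integrable setT (EFin \o (fun x : R => x)).
  apply: (@integrable_expR_abs_le m s _ 1 1) => // x; rewrite !mul1r.
  exact: ler_norm_expR.
split => //.
have := @normal_ibp m s (cst 1) (cst 0) 1 0 s0 (lexx _) _ _ _ _.
rewrite Rintegral_prob_cst mulr0.
under eq_Rintegral do rewrite mulr1.
rewrite RintegralB//; last exact: (finite_measure_integrable_cst (normal_prob m s)).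
rewrite Rintegral_prob_cst => h.
apply/eqP; rewrite -subr_eq0; apply/eqP; apply: h.
- exact: cst_continuous.
- by move=> x; rewrite normr1 mul0r expR0 mulr1.
- by move=> x; rewrite normr0 mul0r expR0 mulr1.
Qed.

(** Integration by parts with h(x) = x - m. *)
Lemma normal_variance m s : s != 0 ->
  (normal_prob m s).-integrable setT (EFin \o (fun x : R => (x - m) ^+ 2)) /\
  \int[normal_prob m s]_x (x - m) ^+ 2 = s ^+ 2.
Proof.
move=> s0.
have b x : `|x - m| <= expR `|m| * expR (1 * `|x|).
  rewrite mul1r -expRD; apply: (@le_trans _ _ (`|m| + `|x|)).
    by rewrite [leRHS]addrC; exact: ler_normB.
  by apply: le_trans (expR_ge1Dx _); rewrite lerDr.
have i1 : (normal_prob m s).-integrable setT (EFin \o (fun x : R => (x - m) ^+ 2)).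
  apply: (@integrable_expR_abs_le m s _ (expR `|m| ^+ 2) 2) => //.
    by apply: measurable_funX => //; exact: measurable_funB.
  move=> x; rewrite normrX.
  have -> : expR `|m| ^+ 2 * expR (2 * `|x|) = (expR `|m| * expR (1 * `|x|)) ^+ 2.
    by rewrite exprMn mul1r; congr (_ * _); rewrite mulr_natl mulr2n expRD expr2.
  by rewrite lerXn2r// ?nnegrE ?mulr_ge0 ?expR_ge0.
split => //.
have := @normal_ibp m s (fun x => x - m) (cst 1) (expR `|m|) 1 s0 ler01 _ _ _ _.
rewrite Rintegral_prob_cst mulr1.
under eq_Rintegral do rewrite -expr2.
apply => //.
- by move=> x; apply: is_derive_eq; rewrite subr0.
- exact: cst_continuous.
- move=> x; rewrite normr1 -expRD -[leLHS]expR0 ler_expR.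
  by rewrite addr_ge0// mul1r.
Qed.

(** As a function of y the integral c solves c'(y) = - s^2 y c(y):
    differentiate under the integral sign and integrate by parts. The phase a
    makes the statement stable under the induction on the dimension in
    stdgauss_cos. *)
Lemma normal_cos s (a y : R) : s != 0 ->
  \int[normal_prob 0 s]_x cos (a + y * x) = cos a * expR (- (y ^+ 2 * s ^+ 2 / 2)).
Proof.
move=> s0.
pose c y := \int[normal_prob 0 s]_x cos (a + y * x).
have mcos (y' : R) : measurable_fun setT (fun x : R => cos (a + y' * x)).
  apply: measurableT_comp; first exact: (continuous_measurable_fun (@continuous_cos R)).
  by apply: measurable_funD => //; exact: measurable_funM.
have msin (y' : R) : measurable_fun setT (fun x : R => sin (a + y' * x)).
  apply: measurableT_comp; first exact: (continuous_measurable_fun (@continuous_sin R)).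
  by apply: measurable_funD => //; exact: measurable_funM.
have icos (y' : R) : (normal_prob 0 s).-integrable setT (EFin \o (fun x : R => cos (a + y' * x))).
  apply: (@integrable_bounded _ _ _ (normal_prob 0 s) (fun x => cos (a + y' * x)) 1).
    exact: mcos.
  by move=> x; exact: cos_max.
have ixsin (y' : R) : (normal_prob 0 s).-integrable setT (EFin \o (fun x : R => x * sin (a + y' * x))).
  apply: (@integrable_expR_abs_le 0 s _ 1 1) => //; first exact: measurable_funM.
  move=> x; rewrite !mul1r normrM; apply: le_trans (ler_norm_expR x).
  by rewrite ler_piMr// sin_max.
have dc (y' : R) : is_derive y' 1 c (- (s ^+ 2 * y') * c y').
  have ibp : \int[normal_prob 0 s]_x (x * sin (a + y' * x)) = s ^+ 2 * (y' * c y').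
    have := @normal_ibp 0 s (fun x => sin (a + y' * x)) (fun x => y' * cos (a + y' * x))
      (1 + `|y'|) 0 s0 (lexx _) _ _ _ _.
    under eq_Rintegral do rewrite subr0.
    rewrite RintegralZl//; apply.
    - by move=> x; apply: is_derive_eq; rewrite /GRing.scale/=; ring.
    - move=> x; apply: cvgM; first exact: cvg_cst.
      apply: (continuous_comp (f := fun x => a + y' * x) (g := cos)); last exact: continuous_cos.
      by apply: cvgD; [exact: cvg_cst|apply: cvgM; [exact: cvg_cst|exact: cvg_id]].
    - move=> x; rewrite mul0r expR0 mulr1; apply: (le_trans (sin_max _)).
      by rewrite lerDl.
    - move=> x; rewrite mul0r expR0 mulr1 normrM; apply: (@le_trans _ _ `|y'|).
        by rewrite ler_piMr// cos_max.
      by rewrite lerDr.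
  apply: (@is_derive_of_quadratic_error _ _ _ _ (s ^+ 2)) => h.
  have [i2 v2] := normal_variance 0 s0.
  have -> : c (y' + h) - c y' - h * (- (s ^+ 2 * y') * c y') =
    \int[normal_prob 0 s]_x (cos (a + (y' + h) * x) - cos (a + y' * x) + h * (x * sin (a + y' * x))).
    rewrite RintegralD//; first last.
    - exact: integrableRZ.
    - exact: integrableRB.
    rewrite RintegralB// RintegralZl// ibp /c; ring.
  have ii : (normal_prob 0 s).-integrable setT (EFin \o
     (fun x => cos (a + (y' + h) * x) - cos (a + y' * x) + h * (x * sin (a + y' * x)))).
    apply: integrableRD => //; first exact: integrableRB.
    exact: integrableRZ.
  apply: (le_trans (le_normr_Rintegral measurableT ii)).
  rewrite -v2 mulrC -RintegralZl//; apply: le_Rintegral => //.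
  - by rewrite (_ : EFin \o _ = abse \o (EFin \o
     (fun x => cos (a + (y' + h) * x) - cos (a + y' * x) + h * (x * sin (a + y' * x)))));
      [exact: integrable_abse|].
  - exact: integrableRZ.
  - move=> x _; rewrite subr0 -exprMn.
    have := cos_taylor1 (a + y' * x) (h * x).
    by rewrite mulrA (_ : a + (y' + h) * x = a + y' * x + h * x)//; ring.
pose e (y : R) := c y * expR (y ^+ 2 * s ^+ 2 / 2).
have de (y' : R) : is_derive y' 1 e 0.
  rewrite /e.
  have d2 : is_derive y' 1 (fun y : R => y ^+ 2 * s ^+ 2 / 2) (y' * s ^+ 2).
    by apply: is_derive_eq; rewrite /GRing.scale/=; field.
  apply: is_derive_eq; rewrite /GRing.scale/=; ring.
have : e y = e 0 by exact: is_derive_0_is_cst.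
rewrite /e expr0n/= !mul0r expR0 mulr1 => ey.
have -> : cos a = c 0.
  rewrite /c; under eq_Rintegral do rewrite mul0r addr0.
  by rewrite Rintegral_prob_cst.
by rewrite -ey -[RHS]mulrA -expRD subrr expR0 mulr1.
Qed.

End normal.

(** * The standard Gaussian law in dimension n *)

Section gauss.
Context {R : realType}.
Local Notation N01 := (normal_prob (0 : R) 1).

HB.instance Definition _ n := @isMeasurableFun.Build _ _ _ _ (@cons_pair R n)
  (@measurable_cons_pair R n).

Definition gauss_cons n (P : probability (euclid R n) R) :
  probability (euclid R n.+1) R := distribution (N01 \x P)%E (@cons_pair R n).

(** Built by adding one coordinate at a time, like lebesgue_euclid, so that
    Fubini reduces every statement to dimension one. *)
Fixpoint stdgauss n : probability (euclid R n) R :=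
  if n is n'.+1 then gauss_cons (stdgauss n') else dirac [tuple].

Definition norm1 n (x : euclid R n) : R := \sum_(i < n) `|tnth x i|.

(** A class of integrands that contains polynomials and bounded functions, is
    closed under sums and products, and survives freezing a coordinate; it
    discharges the integrability conditions for stdgauss. *)
Definition expgrowth n (h : euclid R n -> R) := measurable_fun setT h /\
  exists C k : R, [/\ 0 <= C, 0 <= k & forall x, `|h x| <= C * expR (k * norm1 x)].

Lemma norm1_ge0 n (x : euclid R n) : 0 <= norm1 x.
Proof. by apply: sumr_ge0 => i _. Qed.

Lemma tnth_cons_pair0 n (z : measurableTypeR R * euclid R n) :
  tnth (cons_pair z) ord0 = z.1.
Proof. by rewrite /cons_pair tnth0. Qed.

Lemma tnth_cons_pairS n (z : measurableTypeR R * euclid R n) i :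
  tnth (cons_pair z) (lift ord0 i) = tnth z.2 i.
Proof. by rewrite /cons_pair tnthS. Qed.

Lemma norm1_cons n (z : measurableTypeR R * euclid R n) :
  norm1 (cons_pair z) = `|z.1| + norm1 z.2.
Proof.
rewrite /norm1 big_ord_recl tnth_cons_pair0; congr (_ + _).
by apply: eq_bigr => i _; rewrite tnth_cons_pairS.
Qed.

Lemma measurable_coord n (i : 'I_n) :
  measurable_fun setT (fun x : euclid R n => tnth x i : R).
Proof. exact: measurable_tnth. Qed.

Lemma measurable_norm1 n : measurable_fun setT (@norm1 n).
Proof.
apply: measurable_sum => i; apply: measurableT_comp => //.
exact: measurable_coord.
Qed.

Lemma measurable_consl n (x : euclid R n) :
  measurable_fun setT (fun a : measurableTypeR R => cons_pair (a, x)).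
Proof. by apply: measurableT_comp => //; exact: measurable_cons_pair. Qed.

Lemma measurable_consr n (a : measurableTypeR R) :
  measurable_fun setT (fun x : euclid R n => cons_pair (a, x)).
Proof. by apply: measurableT_comp => //; exact: measurable_cons_pair. Qed.

Section closure.
Variable n : nat.
Implicit Types h : euclid R n -> R.

Lemma expgrowth_cst (c : R) : expgrowth (fun _ : euclid R n => c).
Proof.
split => //; exists `|c|, 0; split => // x.
by rewrite mul0r expR0 mulr1.
Qed.

Lemma expgrowth_coord (i : 'I_n) : expgrowth (fun x : euclid R n => tnth x i).
Proof.
split; first exact: measurable_coord.
exists 1, 1; split => // x; rewrite !mul1r.
apply: (@le_trans _ _ (norm1 x)).
  by rewrite /norm1 (bigD1 i)//= lerDl; apply: sumr_ge0.
by apply: le_trans (expR_ge1Dx _); rewrite lerDr.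
Qed.

Lemma expgrowth_bounded h (C : R) : measurable_fun setT h ->
  (forall x, `|h x| <= C) -> expgrowth h.
Proof.
move=> mh hC; split => //; exists C, 0; split => //; last first.
  by move=> x; rewrite mul0r expR0 mulr1.
by apply: le_trans (hC [tuple 0 | i < n]).
Qed.

Lemma expgrowthD h1 h2 : expgrowth h1 -> expgrowth h2 ->
  expgrowth (fun x => h1 x + h2 x).
Proof.
move=> [m1 [C1 [k1 [C10 k10 b1]]]] [m2 [C2 [k2 [C20 k20 b2]]]].
split; first exact: measurable_funD.
exists (C1 + C2), (k1 + k2); split; rewrite ?addr_ge0// => x.
apply: (le_trans (ler_normD _ _)); rewrite mulrDl; apply: lerD.
  apply: (le_trans (b1 x)); rewrite ler_wpM2l// ler_expR ler_wpM2r ?norm1_ge0//.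
  by rewrite lerDl.
apply: (le_trans (b2 x)); rewrite ler_wpM2l// ler_expR ler_wpM2r ?norm1_ge0//.
by rewrite lerDr.
Qed.

Lemma expgrowthM h1 h2 : expgrowth h1 -> expgrowth h2 ->
  expgrowth (fun x => h1 x * h2 x).
Proof.
move=> [m1 [C1 [k1 [C10 k10 b1]]]] [m2 [C2 [k2 [C20 k20 b2]]]].
split; first exact: measurable_funM.
exists (C1 * C2), (k1 + k2); split; rewrite ?mulr_ge0 ?addr_ge0// => x.
by rewrite normrM mulrDl expRD mulrACA ler_pM.
Qed.

Lemma expgrowth_sum (I : Type) (r : seq I) (h : I -> euclid R n -> R) :
  (forall i, expgrowth (h i)) -> expgrowth (fun x => \sum_(i <- r) h i x).
Proof.
move=> eh; elim: r => [|i r IH].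
  under [X in expgrowth X]eq_fun do rewrite big_nil; exact: expgrowth_cst.
under [X in expgrowth X]eq_fun do rewrite big_cons; exact: expgrowthD.
Qed.

End closure.

Lemma expgrowth_consr n (h : euclid R n.+1 -> R) (a : R) : expgrowth h ->
  expgrowth (fun x => h (cons_pair (a, x))).
Proof.
move=> [mh [C [k [C0 k0 hC]]]]; split.
  by apply: measurableT_comp => //; exact: measurable_consr.
exists (C * expR (k * `|a|)), k; split => //; first by rewrite mulr_ge0 ?expR_ge0.
by move=> x; apply: (le_trans (hC _)); rewrite norm1_cons mulrDr expRD mulrA.
Qed.

Lemma integrable_exp_norm1_pair n (k : R) : 0 <= k ->
  (stdgauss n).-integrable setT (EFin \o (fun x => expR (k * norm1 x))) ->
  (N01 \x stdgauss n)%E.-integrable setT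
    (EFin \o (fun z => expR (k * norm1 (cons_pair z)))).
Proof.
move=> k0 IH; apply/integrable12ltyP.
  apply/measurable_EFinP; apply: measurableT_comp => //; apply: measurable_funM => //.
  by apply: measurableT_comp (@measurable_cons_pair R n); exact: measurable_norm1.
rewrite /=.
under eq_integral => a _.
  under eq_integral => x _ do rewrite norm1_cons/= mulrDr expRD ger0_norm ?mulr_ge0 ?expR_ge0// EFinM.
  rewrite integralZl//.
  over.
rewrite /=.
have /fineK <- := integrable_fin_num measurableT IH.
rewrite integralZr//=; last exact: integrable_expR_abs.
rewrite lte_mul_pinfty//.
- by apply: integral_ge0 => x _; rewrite lee_fin expR_ge0.
- by apply: (integrable_fin_num measurableT); exact: integrable_expR_abs.
- by rewrite ltry.
Qed.

Lemma integrable_exp_norm1 n (k : R) : 0 <= k ->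
  (stdgauss n).-integrable setT (EFin \o (fun x => expR (k * norm1 x))).
Proof.
move=> k0; elim: n => [|n IH].
  apply: (@integrable_bounded _ _ _ (stdgauss 0) _ 1).
    by apply: measurableT_comp => //; apply: measurable_funM => //; exact: measurable_norm1.
  by move=> x; rewrite /norm1 big_ord0 mulr0 expR0 normr1.
apply: (@integrable_pushforward _ _ _ _ _ _ (@measurable_cons_pair R n)) => //.
  apply/measurable_EFinP; apply: measurableT_comp => //; apply: measurable_funM => //.
  exact: measurable_norm1.
exact: integrable_exp_norm1_pair.
Qed.

Lemma expgrowth_integrable n (h : euclid R n -> R) : expgrowth h ->
  (stdgauss n).-integrable setT (EFin \o h).
Proof.
move=> [mh [C [k [C0 k0 hC]]]].
apply: (@integrable_le _ _ _ (stdgauss n) setT _ (fun x => C * expR (k * norm1 x))) => //.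
by apply: integrableRZ => //; exact: integrable_exp_norm1.
Qed.

Lemma expgrowth_integrable_pair n (h : euclid R n.+1 -> R) : expgrowth h ->
  (N01 \x stdgauss n)%E.-integrable setT (EFin \o (fun z => h (cons_pair z))).
Proof.
move=> [mh [C [k [C0 k0 hC]]]].
apply: (@integrable_le _ _ _ (N01 \x stdgauss n)%E setT _
  (fun z => C * expR (k * norm1 (cons_pair z)))) => //.
  by apply: measurableT_comp (@measurable_cons_pair R n).
apply: integrableRZ => //; apply: integrable_exp_norm1_pair => //.
exact: integrable_exp_norm1.
Qed.

Lemma expgrowth_consl n (h : euclid R n.+1 -> R) (x : euclid R n) : expgrowth h ->
  exists C k : R, [/\ 0 <= C, 0 <= k & forall a, `|h (cons_pair (a, x))| <= C * expR (k * `|a|)].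
Proof.
move=> [mh [C [k [C0 k0 hC]]]].
exists (C * expR (k * norm1 x)), k; split => //; first by rewrite mulr_ge0 ?expR_ge0.
move=> a; apply: (le_trans (hC _)).
by rewrite norm1_cons mulrDr expRD [X in _ * X <= _]mulrC mulrA.
Qed.

Lemma integrable_consl n (h : euclid R n.+1 -> R) (x : euclid R n) : expgrowth h ->
  N01.-integrable setT (EFin \o (fun a => h (cons_pair (a, x)))).
Proof.
move=> eh; have [C [k [C0 k0 hC]]] := expgrowth_consl x eh.
apply: (@integrable_expR_abs_le _ 0 1 _ C k) => //.
by apply: measurableT_comp (@measurable_consl n x); exact: eh.1.
Qed.

Lemma stdgaussS_pair n (h : euclid R n.+1 -> R) : expgrowth h ->
  (\int[stdgauss n.+1]_x (h x)%:E = \int[N01 \x stdgauss n]_z (h (cons_pair z))%:E)%E.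
Proof.
move=> eh.
rewrite (@integral_pushforward _ _ _ _ _ _ (@measurable_cons_pair R n)) ?preimage_setT//.
  by apply/measurable_EFinP; exact: eh.1.
exact: expgrowth_integrable_pair.
Qed.

(** The new coordinate is integrated last. *)
Lemma stdgaussS n (h : euclid R n.+1 -> R) : expgrowth h ->
  \int[stdgauss n.+1]_x h x = \int[N01]_a \int[stdgauss n]_x h (cons_pair (a, x)).
Proof.
move=> eh; rewrite {1 2}/Rintegral stdgaussS_pair//; congr fine.
have := @integral12_prod_meas1 _ _ _ _ _ N01 (stdgauss n) _ (expgrowth_integrable_pair eh).
move=> <-; apply: eq_integral => a _; rewrite fineK//.
apply: (integrable_fin_num measurableT).
exact/expgrowth_integrable/expgrowth_consr.
Qed.

(** The new coordinate is integrated first: the order needed to integrate by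
    parts in it. *)
Lemma stdgaussS_swap n (h : euclid R n.+1 -> R) : expgrowth h ->
  \int[stdgauss n.+1]_x h x = \int[stdgauss n]_x \int[N01]_a h (cons_pair (a, x)).
Proof.
move=> eh; rewrite {1 2}/Rintegral stdgaussS_pair//; congr fine.
have := @integral21_prod_meas1 _ _ _ _ _ N01 (stdgauss n) _ (expgrowth_integrable_pair eh).
move=> <-; apply: eq_integral => x _; rewrite fineK//.
by apply: (integrable_fin_num measurableT); exact: integrable_consl.
Qed.

Definition upd n (x : euclid R n) (i : 'I_n) (a : R) : euclid R n :=
  [tuple if j == i then a else tnth x j | j < n].

Lemma upd_cons0 n (a b : R) (x : euclid R n) :
  upd (cons_pair (b, x)) ord0 a = cons_pair (a, x).
Proof.
apply: eq_from_tnth => j; rewrite tnth_mktuple.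
case: (unliftP ord0 j) => [k|] ->; last by rewrite eqxx tnth_cons_pair0.
by rewrite -[lift _ _ == _]negbK eq_sym neq_lift/= !tnth_cons_pairS.
Qed.

Lemma upd_consS n (a b : R) (x : euclid R n) (i : 'I_n) :
  upd (cons_pair (b, x)) (lift ord0 i) a = cons_pair (b, upd x i a).
Proof.
apply: eq_from_tnth => j; rewrite tnth_mktuple.
case: (unliftP ord0 j) => [k|] ->.
  by rewrite (inj_eq (@lift_inj _ _)) !tnth_cons_pairS tnth_mktuple.
by rewrite (negbTE (neq_lift _ _)) !tnth_cons_pair0.
Qed.

(** The partial derivative in direction i is the derivative of a -> h (upd x i
    a), which avoids multivariate differentiation. For the first coordinate
    this is normal_ibp on every line; for the others freeze the first
    coordinate and use induction. *)
Lemma stdgauss_ibp n (i : 'I_n) (h dh : euclid R n -> R) :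
  expgrowth h -> expgrowth dh ->
  (forall x, continuous (fun a : R => dh (upd x i a))) ->
  (forall x (a : R), is_derive a 1 (fun b : R => h (upd x i b)) (dh (upd x i a))) ->
  \int[stdgauss n]_x (tnth x i * h x) = \int[stdgauss n]_x dh x.
Proof.
elim: n i h dh => [[]//|n IH] i h dh eh edh cdh dhh.
have e1 : expgrowth (fun x : euclid R n.+1 => tnth x i * h x).
  by apply: expgrowthM => //; exact: expgrowth_coord.
case: (unliftP ord0 i) => [j|] ij; last first.
  rewrite (stdgaussS_swap e1) (stdgaussS_swap edh); apply: eq_Rintegral => x _.
  transitivity (\int[N01]_a (a * h (cons_pair (a, x)))).
    by apply: eq_Rintegral => a _; rewrite ij tnth_cons_pair0.
  have [C1 [k1 [C10 k10 b1]]] := expgrowth_consl x eh.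
  have [C2 [k2 [C20 k20 b2]]] := expgrowth_consl x edh.
  have := @normal_ibp _ 0 1 (fun a => h (cons_pair (a, x))) (fun a => dh (cons_pair (a, x)))
    (C1 + C2) (k1 + k2) (oner_neq0 _) (addr_ge0 k10 k20).
  rewrite expr1n mul1r; under eq_Rintegral do rewrite subr0.
  apply.
  - move=> a.
    have -> : (fun b => h (cons_pair (b, x))) = (fun b : R => h (upd (cons_pair (a, x)) i b)).
      by apply/funext => b; rewrite ij upd_cons0.
    have -> : dh (cons_pair (a, x)) = dh (upd (cons_pair (a, x)) i a).
      by rewrite ij upd_cons0.
    exact: dhh.
  - have -> : (fun b => dh (cons_pair (b, x))) =
        (fun b : R => dh (upd (cons_pair (0 : R, x)) i b)).
      by apply/funext => b; rewrite ij upd_cons0.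
    exact: cdh.
  - move=> a; apply: (le_trans (b1 a)); apply: ler_pM => //.
      by rewrite lerDl.
    by rewrite ler_expR ler_wpM2r// lerDl.
  - move=> a; apply: (le_trans (b2 a)); apply: ler_pM => //.
      by rewrite lerDr.
    by rewrite ler_expR ler_wpM2r// lerDr.
rewrite (stdgaussS e1) (stdgaussS edh); apply: eq_Rintegral => a _.
transitivity (\int[stdgauss n]_x (tnth x j * h (cons_pair (a, x)))).
  by apply: eq_Rintegral => x _; rewrite ij tnth_cons_pairS.
apply: (IH j (fun x => h (cons_pair (a, x))) (fun x => dh (cons_pair (a, x)))).
- exact: expgrowth_consr.
- exact: expgrowth_consr.
- move=> x.
  have -> : (fun b : R => dh (cons_pair (a, upd x j b))) =
      (fun b : R => dh (upd (cons_pair (a, x)) i b)).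
    by apply/funext => b; rewrite ij upd_consS.
  exact: cdh.
- move=> x b.
  have -> : (fun b : R => h (cons_pair (a, upd x j b))) =
      (fun b : R => h (upd (cons_pair (a, x)) i b)).
    by apply/funext => b'; rewrite ij upd_consS.
  have -> : dh (cons_pair (a, upd x j b)) = dh (upd (cons_pair (a, x)) i b).
    by rewrite ij upd_consS.
  exact: dhh.
Qed.

Lemma stdgauss_cos n (a : R) (y : 'I_n -> R) :
  \int[stdgauss n]_x cos (a + \sum_(i < n) y i * tnth x i) =
  cos a * expR (- (\sum_(i < n) y i ^+ 2) / 2).
Proof.
have ec m (b : R) (z : 'I_m -> R) : expgrowth (fun x : euclid R m => cos (b + \sum_(i < m) z i * tnth x i)).
  apply: (@expgrowth_bounded _ _ 1); last by move=> x; exact: cos_max.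
  apply: measurableT_comp; first exact: (continuous_measurable_fun (@continuous_cos R)).
  apply: measurable_funD => //; apply: measurable_sum => i; apply: measurable_funM => //.
  exact: measurable_coord.
elim: n a y => [|n IH] a y.
  under eq_Rintegral do rewrite big_ord0 addr0.
  by rewrite Rintegral_prob_cst big_ord0 oppr0 mul0r expR0 mulr1.
rewrite stdgaussS//.
under eq_Rintegral => b _.
  under eq_Rintegral do rewrite big_ord_recl tnth_cons_pair0/= addrA.
  under eq_Rintegral do under eq_bigr do rewrite tnth_cons_pairS/=.
  rewrite IH.
  over.
rewrite RintegralZr//; last first.
  apply: (@integrable_bounded _ _ _ N01 _ 1); last by move=> x; exact: cos_max.
  apply: measurableT_comp; first exact: (continuous_measurable_fun (@continuous_cos R)).
  by apply: measurable_funD => //; apply: measurable_funM.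
rewrite normal_cos// expr1n mulr1 -mulrA -expRD big_ord_recl; congr (_ * expR _).
by rewrite !mulNr -opprD mulrDl.
Qed.

End gauss.

(** * The Stein equation of a centred normal law *)

Section stein_equation.
Context {R : realType}.
Variable s : R.
Hypothesis s0 : s != 0.
Local Notation mu := (@lebesgue_measure R).
Local Notation N := (normal_prob 0 s).
Local Notation p := (normal_pdf 0 s).

Let s2 : 0 < s ^+ 2. Proof. by rewrite exprn_even_gt0. Qed.

Let p0 x : 0 < p x.
Proof. by rewrite normal_pdfE// mulr_gt0 ?normal_peak_gt0 ?expR_gt0. Qed.

(** Up to division by the density, the candidate solution of the Stein
    equation. For g = 1 it is the distribution function. *)
Definition partial_mean (g : R -> R) (x : R) : R :=
  \int[N]_t (g t * \1_(`]-oo, x] : set R) t).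

Lemma measurable_indic_ray (x : R) :
  measurable_fun setT (\1_(`]-oo, x] : set R) : R -> R).
Proof. exact: measurable_indic. Qed.

Lemma integrable_partial_mean (g : R -> R) (x C : R) : measurable_fun setT g ->
  (forall t, `|g t| <= C) ->
  N.-integrable setT (EFin \o (fun t => g t * \1_(`]-oo, x] : set R) t)).
Proof.
move=> mg gC; apply: (@integrable_bounded _ _ _ N _ C).
  by apply: measurable_funM => //; exact: measurable_indic_ray.
move=> t; rewrite normrM; apply: le_trans (gC t).
by rewrite ler_piMr// indicE; case: (_ \in _); rewrite ?normr1 ?normr0.
Qed.

Lemma is_derive_partial_mean (g : R -> R) (x C : R) : continuous g ->
  (forall t, `|g t| <= C) ->
  is_derive x 1 (partial_mean g) (g x * p x).
Proof.
move=> cg gC.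
have mg : measurable_fun setT g by exact: continuous_measurable_fun.
pose w (t : R) := g t * p t.
have iw : mu.-integrable setT (EFin \o w).
  by apply/integrable_normal_probP => //; exact: (@integrable_bounded _ _ _ N _ C).
have E : partial_mean g = fun y => \int[mu]_(t in [set` `]-oo, y]]) w t.
  apply/funext => y; rewrite /partial_mean Rintegral_normal_prob.
    rewrite [RHS]Rintegral_mkcond; apply: eq_Rintegral => t _.
    rewrite patchE indicE; case: (t \in _); rewrite ?mulr1 ?mulr0 ?mul0r//.
  exact: integrable_partial_mean gC.
have cw : {for x, continuous w}.
  by apply: cvgM; [exact: cg|exact: continuous_normal_pdf].
have xx1 : x < x + 1 by rewrite ltrDl.
have iwx : mu.-integrable [set` `]-oo, x + 1]] (EFin \o w) by exact: integrableS iw.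
have := @continuous_FTC1 R w -oo%O x (x + 1) xx1 iwx.
move=> /= /(_ (ltNyr _) cw) [d1 d2].
rewrite E; split; first exact: d1.
by rewrite -derive1E d2.
Qed.

Lemma partial_mean_ge0 (g : R -> R) (x : R) : (forall t, 0 <= g t) -> 0 <= partial_mean g x.
Proof. by move=> g0; apply: Rintegral_ge0 => t _; rewrite mulr_ge0. Qed.

Local Notation T := (partial_mean (cst 1)).

(** Applied to both tails of the distribution function. The function D(y) =
    s^2 p(y) + y U(y) has derivative U(y) >= 0, because p' = - y p / s^2. If D
    were negative at x it would stay below D(x) on the left, so that - y U(y)
    would be bounded below there; but y^2 U(y) <= s^2 forces y U(y) to 0 at
    minus infinity. *)
Lemma mills_ratio (U : R -> R) : (forall x, 0 <= U x) ->
  (forall x : R, is_derive x 1 U (p x)) -> (forall x, x < 0 -> x ^+ 2 * U x <= s ^+ 2) ->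
  forall x, - x * U x <= s ^+ 2 * p x.
Proof.
move=> U0 dU cheb x; rewrite leNgt; apply/negP => hx.
pose D (y : R) := s ^+ 2 * p y + y * U y.
have dD (y : R) : is_derive y 1 D (U y).
  have d2 := is_derive_normal_pdf 0 y s0.
  rewrite /D; apply: is_derive_eq; rewrite /GRing.scale/= subr0.
  by field.
have Dle a b : a <= b -> D a <= D b.
  move=> ab; have [//|c _ e] := @MVT_segment _ D U a b ab (fun y _ => dD y).
    by apply: continuous_subspaceT; exact: continuous_of_is_derive dD.
  by rewrite -subr_ge0 e mulr_ge0// subr_ge0.
have c0 : 0 < - D x by rewrite /D; lra.
set c := - D x in c0.
(* y is chosen so far to the left that y^2 U y >= - y c exceeds s^2 *)
pose y := Num.min x (- (s ^+ 2 / c + 1)).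
have yx : y <= x by rewrite ge_min lexx.
have yK : y <= - (s ^+ 2 / c + 1) by rewrite ge_min lexx orbT.
have sc : 0 < s ^+ 2 / c by rewrite divr_gt0.
have y0 : y < 0 by lra.
have Dy : c <= - (y * U y).
  have := Dle _ _ yx; rewrite /D -/(D x) (_ : D x = - c); last by rewrite /c opprK.
  have := mulr_gt0 s2 (p0 y); lra.
have := cheb y y0; rewrite expr2 -mulrA => h.
have : - y * c <= s ^+ 2.
  apply: le_trans h; rewrite -[leRHS]mulrNN ler_wpM2l//; lra.
rewrite -ler_pdivlMr//; lra.
Qed.

Lemma partial_mean1_le1 x : T x <= 1.
Proof.
rewrite -[leRHS](@Rintegral_prob_cst _ _ _ N 1); apply: le_Rintegral => //.
- by apply: (@integrable_partial_mean _ _ 1) => // t; rewrite normr1.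
- exact: (finite_measure_integrable_cst N).
- by move=> t _; rewrite mul1r indicE; case: (_ \in _).
Qed.

Let iray y : N.-integrable setT (EFin \o (fun t => cst 1 t * \1_(`]-oo, y] : set R) t)).
Proof. by apply: (@integrable_partial_mean _ _ 1) => // t; rewrite normr1. Qed.

Let dT (x : R) : is_derive x 1 T (p x).
Proof.
rewrite -[p x]mul1r.
apply: (@is_derive_partial_mean (cst 1) x 1); first exact: cst_continuous.
by move=> t; rewrite normr1.
Qed.

Lemma tail_left x : - x * T x <= s ^+ 2 * p x.
Proof.
apply: mills_ratio => //.
- by move=> y; exact: partial_mean_ge0.
- move=> y y0; have [i2 v2] := normal_variance 0 s0.
  rewrite -v2 -RintegralZl//; apply: le_Rintegral => //; first exact: integrableRZ.
  move=> t _; rewrite subr0 mul1r indicE; case: (boolP (t \in _)) => [|_]; last first.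
    by rewrite mulr0 sqr_ge0.
  rewrite inE/= in_itv/= mulr1 => ty.
  rewrite -(real_normK (num_real y)) -(real_normK (num_real t)) lerXn2r ?nnegrE//.
  by rewrite ltr0_norm// ler0_norm ?lerN2// (le_trans ty)// ltW.
Qed.

Lemma tail_right x : x * (1 - T x) <= s ^+ 2 * p x.
Proof.
have pN y : p (- y) = p y.
  by rewrite !normal_pdfE// /normal_fun !subr0 sqrrN.
suff : - (- x) * (1 - T (- - x)) <= s ^+ 2 * p (- x) by rewrite opprK pN.
apply: (@mills_ratio (fun y => 1 - T (- y))).
- by move=> y; rewrite subr_ge0 partial_mean1_le1.
- move=> y; have d := dT (- y).
  have d2 : is_derive y 1 (T \o -%R) (- p y).
    have d3 : is_derive y 1 -%R (-1 : R) by exact: is_derive_eq.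
    have := is_derive1_comp d d3; rewrite mulrN1 pN; exact.
  have d4 : is_derive y 1 (cst 1 - (T \o -%R)) (0 - - p y).
    exact: is_deriveB.
  by rewrite sub0r opprK in d4.
- move=> y y0; have [i2 v2] := normal_variance 0 s0.
  rewrite mulrBr mulr1 lerBlDr -v2 -RintegralZl// -RintegralD//; last exact: integrableRZ.
  rewrite -[leLHS](@Rintegral_prob_cst _ _ _ N); apply: le_Rintegral => //.
  + exact: (finite_measure_integrable_cst N).
  + by apply: integrableRD => //; exact: integrableRZ.
  move=> t _; rewrite subr0 mul1r indicE; case: (boolP (t \in _)) => [_|].
    by rewrite mulr1 lerDr sqr_ge0.
  rewrite notin_setE/= in_itv/= => /negP; rewrite -ltNge => ty.
  rewrite mulr0 addr0.
  rewrite -(real_normK (num_real y)) -(real_normK (num_real t)) lerXn2r ?nnegrE//.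
  rewrite ltr0_norm// gtr0_norm ?ltW//; by apply: lt_trans ty; rewrite oppr_gt0.
Qed.

Variables (h : R -> R) (B : R).
Hypotheses (ch : continuous h) (hB : forall x, `|h x| <= B).

Let Nh := \int[N]_t h t.
Let hb t := h t - Nh.

Let mh : measurable_fun setT h. Proof. exact: continuous_measurable_fun. Qed.
Let ih : N.-integrable setT (EFin \o h).
Proof. exact: (@integrable_bounded _ _ _ N _ B). Qed.

(** The solution f of f' - x f / s^2 = hb that does not blow up at
    infinity. *)
Definition stein_sol (x : R) := partial_mean hb x / p x.

Lemma stein_centered_bound t : `|hb t| <= 2 * B.
Proof.
apply: (le_trans (ler_normB _ _)).
have : `|Nh| <= B.
  apply: (le_trans (le_normr_Rintegral measurableT ih)).
  rewrite -[leRHS](@Rintegral_prob_cst _ _ _ N B); apply: le_Rintegral => //.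
    by rewrite (_ : EFin \o _ = abse \o (EFin \o h)); [exact: integrable_abse|].
  exact: (finite_measure_integrable_cst N).
by have := hB t; lra.
Qed.

Lemma continuous_stein_centered : continuous hb.
Proof. by move=> x; apply: cvgB; [exact: ch|exact: cvg_cst]. Qed.

Let B0 : 0 <= B. Proof. exact: le_trans (normr_ge0 _) (hB 0). Qed.

(** As hb has mean zero, its integral over ]-oo, x] is minus its integral over
    ]x, +oo[; hence both tails bound it. *)
Lemma stein_partial_bound x :
  `|partial_mean hb x| <= 2 * B * T x /\ `|partial_mean hb x| <= 2 * B * (1 - T x).
Proof.
have mhb : measurable_fun setT hb.
  by apply: continuous_measurable_fun; exact: continuous_stein_centered.
have ihb : N.-integrable setT (EFin \o hb).
  by apply: (@integrable_bounded _ _ _ N _ (2 * B)) => // t; exact: stein_centered_bound.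
have ihx := integrable_partial_mean x mhb stein_centered_bound.
have hb0 : \int[N]_t hb t = 0.
  rewrite /hb RintegralB//; last exact: (finite_measure_integrable_cst N).
  by rewrite Rintegral_prob_cst subrr.
have icst (c : R) : N.-integrable setT (EFin \o (fun _ : R => c)).
  exact: (finite_measure_integrable_cst N).
have le1 (t : R) : 0 <= (\1_(`]-oo, x] : set R) t : R) <= 1.
  by rewrite indicE; case: (_ \in _); rewrite ?lexx ler01.
have hbt t : - (2 * B) <= hb t <= 2 * B by rewrite -ler_norml stein_centered_bound.
split.
  rewrite -RintegralZl//; apply: (le_trans (le_normr_Rintegral measurableT ihx)).
  apply: le_Rintegral => //.
  - by rewrite (_ : EFin \o _ = abse \o (EFin \o (fun t => hb t * \1_(`]-oo, x] : set R) t)));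
      [exact: integrable_abse|].
  - exact: integrableRZ.
  - move=> t _; rewrite mul1r normrM [X in _ * X <= _]ger0_norm; last by have /andP[] := le1 t.
    by rewrite ler_wpM2r ?stein_centered_bound//; have /andP[] := le1 t.
have e1 : 2 * B * T x = \int[N]_t (2 * B * (cst 1 t * \1_(`]-oo, x] : set R) t)).
  by rewrite RintegralZl.
rewrite ler_norml mulrBr mulr1 opprB; apply/andP; split.
  rewrite lerBlDr addrC -lerBlDr e1 /partial_mean -RintegralB//; last exact: integrableRZ.
  rewrite [leRHS](_ : _ = \int[N]_t (2 * B - hb t)); last first.
    by rewrite RintegralB// hb0 subr0 Rintegral_prob_cst.
  apply: le_Rintegral => //.
  - by apply: integrableRB => //; exact: integrableRZ.
  - exact: integrableRB.
  move=> t _; rewrite mul1r -mulrBl ler_piMr//.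
    by have /andP[] := hbt t; lra.
rewrite lerBrDr e1 /partial_mean -RintegralD//; last exact: integrableRZ.
rewrite [leRHS](_ : _ = \int[N]_t (hb t + 2 * B)); last first.
  by rewrite RintegralD// hb0 add0r Rintegral_prob_cst.
apply: le_Rintegral => //.
- by apply: integrableRD => //; exact: integrableRZ.
- exact: integrableRD.
move=> t _; rewrite mul1r -mulrDl ler_piMr//.
  by have /andP[] := hbt t; lra.
Qed.

(** The two bounds on the partial mean against the two Mills inequalities, one
    for each sign of x. *)
Lemma stein_sol_bound_mul x : `|x * stein_sol x| <= 2 * B * s ^+ 2.
Proof.
have [b1 b2] := stein_partial_bound x.
rewrite /stein_sol mulrA normrM normfV (ger0_norm (ltW (p0 x))) ler_pdivrMr//.
rewrite normrM; have B20 : 0 <= 2 * B by rewrite mulr_ge0.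
rewrite -[leRHS]mulrA.
have [x0|x0] := leP 0 x.
  rewrite ger0_norm//; apply: (le_trans (ler_wpM2l x0 b2)).
  by rewrite mulrCA ler_wpM2l// tail_right.
rewrite ltr0_norm//; apply: (@le_trans _ _ (- x * (2 * B * T x))).
  by rewrite ler_wpM2l// oppr_ge0 ltW.
by rewrite mulrCA ler_wpM2l// tail_left.
Qed.

Lemma stein_sol_bound : exists K, forall x, `|stein_sol x| <= K.
Proof.
(* for |x| >= 1 the bound on x f(x) suffices; elsewhere p is at least p 1 *)
exists (2 * B * s ^+ 2 + 2 * B / p 1) => x.
have [x1|x1] := leP 1 `|x|.
  apply: (@le_trans _ _ (2 * B * s ^+ 2)); last first.
    by rewrite lerDl !mulr_ge0// invr_ge0 ltW.
  apply: le_trans (stein_sol_bound_mul x); rewrite [leRHS]normrM.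
  by rewrite ler_peMl.
apply: (@le_trans _ _ (2 * B / p 1)); last first.
  by rewrite lerDr; apply: mulr_ge0; [exact: mulr_ge0|exact: ltW].
rewrite /stein_sol normrM normfV (ger0_norm (ltW (p0 x))).
apply: ler_pM => //; first by rewrite invr_ge0 ltW.
  apply: (le_trans (stein_partial_bound x).1).
  by rewrite ler_piMr ?mulr_ge0// partial_mean1_le1.
rewrite lef_pV2 ?posrE ?p0// !normal_pdfE// ler_wpM2l ?normal_peak_ge0//.
rewrite /normal_fun ler_expR; apply: ler_wpM2r.
  by rewrite invr_ge0 mulrn_wge0// ltW.
rewrite lerN2 !subr0.
by rewrite expr1n -(real_normK (num_real x)) exprn_ile1// ltW.
Qed.

Lemma is_derive_stein_sol (x : R) :
  is_derive x 1 stein_sol (hb x + x / s ^+ 2 * stein_sol x).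
Proof.
have d1 := is_derive_partial_mean x continuous_stein_centered stein_centered_bound.
have d2 := is_derive_normal_pdf 0 x s0.
have px : p x != 0 by rewrite gt_eqF.
rewrite /stein_sol; apply: is_derive_eq; rewrite /GRing.scale/= subr0.
by field; rewrite px.
Qed.

Lemma stein_sol_derive_bound x :
  `|hb x + x / s ^+ 2 * stein_sol x| <= 4 * B.
Proof.
apply: (le_trans (ler_normD _ _)).
have := stein_centered_bound x.
have -> : x / s ^+ 2 * stein_sol x = x * stein_sol x / s ^+ 2 by ring.
rewrite [X in _ + X]normrM normfV (ger0_norm (ltW s2)).
have := stein_sol_bound_mul x; rewrite -ler_pdivrMr//; lra.
Qed.

Lemma continuous_stein_sol : continuous stein_sol.
Proof. exact: continuous_of_is_derive is_derive_stein_sol. Qed.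

End stein_equation.

(** The derivative is controlled by B alone since x f(x) is
    (stein_sol_bound_mul), whereas f itself only needs some bound. *)
Lemma stein_equation {R : realType} (s B : R) (h : R -> R) : s != 0 ->
  continuous h -> (forall x, `|h x| <= B) ->
  exists f df : R -> R, [/\ forall x : R, is_derive x 1 f (df x),
    continuous df, exists K, forall x, `|f x| <= K,
    forall x, `|df x| <= 4 * B &
    forall x, h x - \int[normal_prob 0 s]_t h t = df x - x / s ^+ 2 * f x].
Proof.
move=> s0 ch hB; exists (stein_sol s h).
exists (fun x => h x - \int[normal_prob 0 s]_t h t + x / s ^+ 2 * stein_sol s h x).
split.
- by move=> x; exact: (is_derive_stein_sol s0 ch hB).
- move=> x; apply: cvgD; first by apply: cvgB; [exact: ch|exact: cvg_cst].
  apply: cvgM; last by apply: (continuous_stein_sol s0 ch hB).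
  by apply: cvgM; [exact: cvg_id|exact: cvg_cst].
- exact: (stein_sol_bound s0 ch hB).
- by move=> x; exact: (stein_sol_derive_bound s0 ch hB).
- by move=> x; rewrite addrK.
Qed.

(** * Quadratic forms in Gaussian variables *)

Section quadratic_form.
Context {R : realType} {n : nat}.
Implicit Types (S : 'I_n -> 'I_n -> R) (x : euclid R n).

Definition mulv S x (i : 'I_n) : R := \sum_j S i j * tnth x j.
Definition quadf S x : R := \sum_i tnth x i * mulv S x i.
(** The square of S when S is symmetric; then its quadratic form is |S
    x|^2. *)
Definition sqmx S (i j : 'I_n) : R := \sum_k S k i * S k j.

Local Notation E f := (\int[stdgauss n]_x f x).

Lemma expgrowth_mulv S i : expgrowth (fun x => mulv S x i).
Proof.
apply: expgrowth_sum => j; apply: expgrowthM; first exact: expgrowth_cst.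
exact: expgrowth_coord.
Qed.

Lemma expgrowth_quadf S : expgrowth (quadf S).
Proof.
apply: expgrowth_sum => i; apply: expgrowthM; first exact: expgrowth_coord.
exact: expgrowth_mulv.
Qed.

Lemma is_derive_upd_coord x (i j : 'I_n) (a : R) :
  is_derive a 1 (fun b : R => tnth (upd x i b) j : R) (j == i)%:R.
Proof.
under eq_fun do rewrite tnth_mktuple.
by case: (j == i); [exact: is_derive_id|exact: is_derive_cst].
Qed.

Lemma is_derive_upd_mulv S x (i k : 'I_n) (a : R) :
  is_derive a 1 (fun b : R => mulv S (upd x i b) k) (S k i).
Proof.
have d j : is_derive a 1 (fun b : R => S k j * (tnth (upd x i b) j : R)) (S k j * (j == i)%:R).
  have dj := is_derive_upd_coord x i j a.
  exact: is_deriveZ.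
rewrite /mulv (_ : (fun b => _) = \sum_j (fun b : R => S k j * (tnth (upd x i b) j : R))).
  apply: is_derive_eq.
  rewrite (bigD1 i)//= eqxx mulr1 big1 ?addr0// => j /negbTE ->; by rewrite mulr0.
by apply/funext => b; rewrite fct_sumE.
Qed.

Lemma is_derive_upd_quadf S x (i : 'I_n) (a : R) : (forall i j, S i j = S j i) ->
  is_derive a 1 (fun b : R => quadf S (upd x i b)) (2 * mulv S (upd x i a) i).
Proof.
move=> symS; set y := upd x i a.
have d j : is_derive a 1 (fun b : R => (tnth (upd x i b) j : R) * mulv S (upd x i b) j)
    ((tnth y j : R) * S j i + mulv S y j * (j == i)%:R).
  have dj := is_derive_upd_coord x i j a.
  have dm := is_derive_upd_mulv S x i j a.
  exact: is_deriveM.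
rewrite /quadf (_ : (fun b => _) = \sum_j (fun b : R => (tnth (upd x i b) j : R) * mulv S (upd x i b) j)).
  apply: is_derive_eq.
  rewrite big_split/= mulrDl mul1r; congr (_ + _).
    by rewrite /mulv; apply: eq_bigr => j _; rewrite mulrC symS.
  rewrite (bigD1 i)//= eqxx mulr1 big1 ?addr0// => j /negbTE ->; by rewrite mulr0.
by apply/funext => b; rewrite fct_sumE.
Qed.

(** Integrate by parts x_i against (S x)_i f(c (Q - tr S)) and sum over i: the
    derivative of (S x)_i produces tr S, and that of f produces |S x|^2,
    because the gradient of the quadratic form is 2 S x. *)
Lemma stein_identity S (c : R) (f df : R -> R) : (forall i j, S i j = S j i) ->
  (forall y : R, is_derive y 1 f (df y)) -> continuous df ->
  expgrowth (fun x => f (c * (quadf S x - \sum_i S i i))) ->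
  expgrowth (fun x => df (c * (quadf S x - \sum_i S i i))) ->
  E (fun x => (quadf S x - \sum_i S i i) * f (c * (quadf S x - \sum_i S i i))) =
  2 * c * E (fun x => df (c * (quadf S x - \sum_i S i i)) * quadf (sqmx S) x).
Proof.
move=> symS dff cdf ef edf.
set t := \sum_i S i i; pose F x := c * (quadf S x - t).
rewrite -/t in ef edf *.
have dF x i (a : R) : is_derive a 1 (fun b : R => F (upd x i b)) (c * (2 * mulv S (upd x i a) i)).
  have dq := is_derive_upd_quadf x i a symS.
  rewrite /F; apply: is_derive_eq.
  by rewrite /GRing.scale/= subr0.
pose g i x := mulv S x i * f (F x).
pose dg i x := S i i * f (F x) + mulv S x i * (df (F x) * (c * (2 * mulv S x i))).
have eg i : expgrowth (g i) by apply: expgrowthM => //; exact: expgrowth_mulv.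
have edg i : expgrowth (dg i).
  apply: expgrowthD; first by apply: expgrowthM => //; exact: expgrowth_cst.
  apply: expgrowthM; first exact: expgrowth_mulv.
  apply: expgrowthM => //; apply: expgrowthM; first exact: expgrowth_cst.
  by apply: expgrowthM; [exact: expgrowth_cst|exact: expgrowth_mulv].
have ibp i : E (fun x => tnth x i * g i x) = E (dg i).
  apply: stdgauss_ibp => //.
    move=> x; have cm := continuous_of_is_derive (fun a => is_derive_upd_mulv S x i i a).
    have cF := continuous_of_is_derive (fun a => dF x i a).
    have cf := continuous_of_is_derive dff.
    move=> a; apply: cvgD.
      apply: cvgM; first exact: cvg_cst.
      by apply: (continuous_comp (f := fun a : R => F (upd x i a)) (g := f)); [exact: cF|exact: cf].
    apply: cvgM; first exact: cm.
    apply: cvgM.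
      by apply: (continuous_comp (f := fun a : R => F (upd x i a)) (g := df)); [exact: cF|exact: cdf].
    apply: cvgM; first exact: cvg_cst.
    by apply: cvgM; [exact: cvg_cst|exact: cm].
  move=> x a.
  have d1 := is_derive_upd_mulv S x i i a.
  have d2 : is_derive a 1 (f \o (fun b : R => F (upd x i b)))
     (df (F (upd x i a)) * (c * (2 * mulv S (upd x i a) i))).
    exact: is_derive1_comp.
  have d3 := is_deriveM d1 d2.
  rewrite /g /dg; apply: (is_derive_eq d3).
  by rewrite /GRing.scale/= addrC [X in X + _]mulrC.
have ext i : expgrowth (fun x : euclid R n => tnth x i * g i x).
  by apply: expgrowthM => //; exact: expgrowth_coord.
have split1 x : (quadf S x - t) * f (F x) = \sum_i (tnth x i * g i x) - t * f (F x).
  by rewrite mulrBl /quadf mulr_suml; congr (_ - _); apply: eq_bigr => i _; rewrite mulrA.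
under eq_Rintegral do rewrite split1.
have etf : expgrowth (fun x => t * f (F x)) by apply: expgrowthM => //; exact: expgrowth_cst.
rewrite RintegralB//; first last.
- exact: expgrowth_integrable.
- by apply: expgrowth_integrable; exact: expgrowth_sum.
rewrite Rintegral_sum//; last by move=> i; exact: expgrowth_integrable.
under eq_bigr do rewrite ibp.
rewrite -Rintegral_sum//; last by move=> i; exact: expgrowth_integrable.
rewrite -RintegralB//; first last.
- exact: expgrowth_integrable.
- by apply: expgrowth_integrable; exact: expgrowth_sum.
have eq2 : expgrowth (fun x => df (F x) * quadf (sqmx S) x).
  by apply: expgrowthM => //; exact: expgrowth_quadf.
rewrite -RintegralZl//; last exact: expgrowth_integrable.
apply: eq_Rintegral => x _.
rewrite /dg big_split/= -mulr_suml -/t addrAC subrr add0r.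
have -> : quadf (sqmx S) x = \sum_i mulv S x i ^+ 2.
  rewrite /quadf /mulv /sqmx.
  under eq_bigr do rewrite mulr_sumr.
  under [RHS]eq_bigr do rewrite expr2 mulr_suml.
  rewrite [RHS]exchange_big/=; apply: eq_bigr => i _.
  transitivity (\sum_j \sum_k tnth x i * (S k i * S k j * tnth x j)).
    by apply: eq_bigr => j _; rewrite mulr_suml mulr_sumr.
  rewrite exchange_big/=; apply: eq_bigr => k _.
  rewrite mulr_sumr; apply: eq_bigr => j _; ring.
rewrite !mulr_sumr; apply: eq_bigr => i _; ring.
Qed.

Lemma sqmx_sym S i j : sqmx S i j = sqmx S j i.
Proof. by apply: eq_bigr => k _; rewrite mulrC. Qed.

(** The Stein identity for the constant function 1. *)
Lemma quadf_mean S : (forall i j, S i j = S j i) ->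
  E (fun x => quadf S x - \sum_i S i i) = 0.
Proof.
move=> symS.
transitivity (E (fun x => (quadf S x - \sum_i S i i) *
    cst 1 (1 * (quadf S x - \sum_i S i i)))).
  by apply: eq_Rintegral => x _; rewrite mulr1.
rewrite (@stein_identity S 1 (cst 1) (cst 0))//.
- under eq_Rintegral do rewrite mul0r.
  by rewrite Rintegral_prob_cst mulr0.
- exact: cst_continuous.
- exact: expgrowth_cst.
- exact: expgrowth_cst.
Qed.

(** The Stein identity for f(y) = y, together with the mean of the quadratic
    form of S^2. *)
Lemma quadf_variance S : (forall i j, S i j = S j i) ->
  E (fun x => (quadf S x - \sum_i S i i) ^+ 2) = 2 * \sum_i \sum_j S i j ^+ 2.
Proof.
move=> symS.
have eq1 : expgrowth (fun x => quadf S x - \sum_i S i i).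
  by apply: expgrowthD; [exact: expgrowth_quadf|exact: expgrowth_cst].
transitivity (E (fun x => (quadf S x - \sum_i S i i) *
    id (1 * (quadf S x - \sum_i S i i)))).
  by apply: eq_Rintegral => x _; rewrite mul1r expr2.
rewrite (@stein_identity S 1 id (cst 1))//; last 3 first.
- exact: cst_continuous.
- by under [X in expgrowth X]eq_fun do rewrite mul1r.
- exact: expgrowth_cst.
rewrite mulr1; congr (_ * _).
have := quadf_mean (sqmx_sym S).
rewrite RintegralB//; first last.
- exact: (finite_measure_integrable_cst (stdgauss n)).
- by apply: expgrowth_integrable; exact: expgrowth_quadf.
rewrite Rintegral_prob_cst => /eqP; rewrite subr_eq0 => /eqP.
move=> hq; transitivity (E (fun x => quadf (sqmx S) x)).
  by apply: eq_Rintegral => x _; rewrite [LHS]mul1r.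
rewrite hq /sqmx exchange_big/=.
by apply: eq_bigr => i _; apply: eq_bigr => j _; rewrite expr2.
Qed.

(** The variance of |f| is nonnegative. *)
Lemma expectation_norm_le (f : euclid R n -> R) : expgrowth f ->
  E (fun x => `|f x|) <= Num.sqrt (E (fun x => f x ^+ 2)).
Proof.
move=> ef; set m := E (fun x => `|f x|).
have en : expgrowth (fun x => `|f x|).
  split; first by apply: measurableT_comp => //; exact: ef.1.
  have [_ [C [k [C0 k0 fk]]]] := ef; exists C, k; split => // x.
  by rewrite normr_id.
have m0 : 0 <= m by apply: Rintegral_ge0.
have e2 : expgrowth (fun x => f x ^+ 2).
  by under [X in expgrowth X]eq_fun do rewrite expr2; exact: expgrowthM.
have : 0 <= E (fun x => (`|f x| - m) ^+ 2).
  by apply: Rintegral_ge0 => x _; exact: sqr_ge0.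
have -> : E (fun x => (`|f x| - m) ^+ 2) = E (fun x => f x ^+ 2) - m ^+ 2.
  transitivity (E (fun x => (f x ^+ 2 - 2 * m * `|f x|) + m ^+ 2)).
    by apply: eq_Rintegral => x _; rewrite -[in RHS](real_normK (num_real (f x))); ring.
  have em : expgrowth (fun x => 2 * m * `|f x|) by apply: expgrowthM => //; exact: expgrowth_cst.
  rewrite RintegralD//; last exact: (finite_measure_integrable_cst (stdgauss n)); last first.
    by apply: integrableRB => //; exact: expgrowth_integrable.
  rewrite RintegralB//; [|exact: expgrowth_integrable|exact: expgrowth_integrable].
  rewrite RintegralZl//; last exact: expgrowth_integrable.
  by rewrite Rintegral_prob_cst -/m; ring.
rewrite subr_ge0 => h; rewrite -(ger0_norm m0) -sqrtr_sqr ler_sqrt//.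
exact: le_trans (sqr_ge0 _) h.
Qed.

(** By the Stein equation and the Stein identity the left-hand side is the
    mean of f'(F) (1 - 2 c^2 |S x|^2 / s^2) with f' bounded by 4 B. Replace |S
    x|^2 by its mean tr S^2; the fluctuation is controlled by its variance 2
    tr S^4. *)
Theorem stein_bound S (c s B : R) (h : R -> R) : (forall i j, S i j = S j i) ->
  s != 0 -> continuous h -> (forall y, `|h y| <= B) ->
  `|E (fun x => h (c * (quadf S x - \sum_i S i i))) - \int[normal_prob 0 s]_t h t| <=
  4 * B * (`|1 - 2 * c ^+ 2 / s ^+ 2 * \sum_i \sum_j S i j ^+ 2| +
    2 * c ^+ 2 / s ^+ 2 * Num.sqrt (2 * \sum_i \sum_j sqmx S i j ^+ 2)).
Proof.
move=> symS s0 ch hB.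
have [f [df [dff cdf [K fK] dfB hf]]] := stein_equation s0 ch hB.
set t := \sum_i S i i; pose F x := c * (quadf S x - t).
rewrite -/t; set Nh := \int[normal_prob 0 s]_t h t.
set q2 := \sum_i \sum_j S i j ^+ 2.
have mF : measurable_fun setT F.
  apply: measurable_funM => //; apply: measurable_funB => //.
  exact: (expgrowth_quadf S).1.
have cf := continuous_of_is_derive dff.
have ef : expgrowth (fun x => f (F x)).
  apply: (@expgrowth_bounded _ _ _ K) => //.
  by apply: measurableT_comp => //; exact: continuous_measurable_fun.
have edf : expgrowth (fun x => df (F x)).
  apply: (@expgrowth_bounded _ _ _ (4 * B)) => //.
  by apply: measurableT_comp => //; exact: continuous_measurable_fun.
have eh : expgrowth (fun x => h (F x)).
  apply: (@expgrowth_bounded _ _ _ B) => //.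
  by apply: measurableT_comp => //; exact: continuous_measurable_fun.
have st := @stein_identity S c f df symS dff cdf ef edf.
rewrite -/t in st.
have eF : expgrowth F.
  apply: expgrowthM; first exact: expgrowth_cst.
  by apply: expgrowthD; [exact: expgrowth_quadf|exact: expgrowth_cst].
have eQ : expgrowth (quadf (sqmx S)) by exact: expgrowth_quadf.
pose w x := 1 - 2 * c ^+ 2 / s ^+ 2 * quadf (sqmx S) x.
have ew : expgrowth w.
  apply: expgrowthD; first exact: expgrowth_cst.
  under [X in expgrowth X]eq_fun do rewrite -mulNr.
  by apply: expgrowthM => //; exact: expgrowth_cst.
have key : E (fun x => h (F x)) - Nh = E (fun x => df (F x) * w x).
  transitivity (E (fun x => df (F x) - c / s ^+ 2 * ((quadf S x - t) * f (F x)))).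
    rewrite -[X in _ - X](@Rintegral_prob_cst _ _ _ (stdgauss n)).
    rewrite -RintegralB//; [|exact: expgrowth_integrable|exact: (finite_measure_integrable_cst (stdgauss n))].
    by apply: eq_Rintegral => x _; rewrite hf /F; ring.
  have e3 : expgrowth (fun x => (quadf S x - t) * f (F x)).
    by apply: expgrowthM => //; apply: expgrowthD; [exact: expgrowth_quadf|exact: expgrowth_cst].
  rewrite RintegralB//; [|exact: expgrowth_integrable|]; last first.
    by apply: integrableRZ => //; exact: expgrowth_integrable.
  rewrite RintegralZl//; last exact: expgrowth_integrable.
  rewrite st mulrA -RintegralZl//; last by apply: expgrowth_integrable; exact: expgrowthM.
  rewrite -RintegralB//; [|exact: expgrowth_integrable|]; last first.
    by apply: integrableRZ => //; apply: expgrowth_integrable; exact: expgrowthM.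
  by apply: eq_Rintegral => x _; rewrite /w /F; ring.
rewrite key.
have edw : expgrowth (fun x => df (F x) * w x) by exact: expgrowthM.
apply: (le_trans (le_normr_Rintegral measurableT (expgrowth_integrable edw))).
have B0 : 0 <= 4 * B.
  by apply: le_trans (dfB 0).
set tB := \sum_i \sum_j sqmx S i j ^+ 2.
pose v x := quadf (sqmx S) x - \sum_i sqmx S i i.
have tq : \sum_i sqmx S i i = q2.
  by rewrite /sqmx exchange_big/=; apply: eq_bigr => i _; apply: eq_bigr => j _; rewrite expr2.
have ev : expgrowth v by apply: expgrowthD => //; exact: expgrowth_cst.
have en (g : euclid R n -> R) : expgrowth g -> expgrowth (fun x => `|g x|).
  move=> eg; split; first by apply: measurableT_comp => //; exact: eg.1.
  have [_ [C [k [C0 k0 gk]]]] := eg; exists C, k; split => // x.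
  by rewrite normr_id.
have k0 : 0 <= 2 * c ^+ 2 / s ^+ 2.
  by rewrite divr_ge0 ?sqr_ge0// mulr_ge0 ?sqr_ge0.
apply: (@le_trans _ _ (E (fun x => 4 * B * (`|1 - 2 * c ^+ 2 / s ^+ 2 * q2| +
    2 * c ^+ 2 / s ^+ 2 * `|v x|)))).
  apply: le_Rintegral => //.
  - by apply: expgrowth_integrable; exact: en.
  - apply: expgrowth_integrable; apply: expgrowthM; first exact: expgrowth_cst.
    apply: expgrowthD; first exact: expgrowth_cst.
    by apply: expgrowthM; [exact: expgrowth_cst|exact: en].
  - move=> x _; rewrite normrM; apply: ler_pM => //.
    have -> : w x = (1 - 2 * c ^+ 2 / s ^+ 2 * q2) - 2 * c ^+ 2 / s ^+ 2 * v x.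
      by rewrite /w /v tq; ring.
    apply: (le_trans (ler_normB _ _)).
    by rewrite [X in _ + X]normrM (ger0_norm k0).
rewrite RintegralZl//; last first.
  apply: expgrowth_integrable; apply: expgrowthD; first exact: expgrowth_cst.
  by apply: expgrowthM; [exact: expgrowth_cst|exact: en].
rewrite ler_wpM2l// RintegralD//; first last.
- by apply: integrableRZ => //; apply: expgrowth_integrable; exact: en.
- exact: (finite_measure_integrable_cst (stdgauss n)).
rewrite Rintegral_prob_cst lerD2l RintegralZl//; last by apply: expgrowth_integrable; exact: en.
rewrite ler_wpM2l//; apply: (le_trans (expectation_norm_le ev)).
by rewrite (quadf_variance (sqmx_sym S)).
Qed.

End quadratic_form.

(** * Bernstein polynomials *)

Section bernstein.
Context {R : realType}.

(** A recursion on the number of trials, instead of a sum with binomial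
    coefficients: the moments of the binomial law then follow by induction. *)
Fixpoint binomial_mean (n : nat) (g : nat -> R) (y : R) : R :=
  if n is m.+1 then
    y * binomial_mean m (fun i => g i.+1) y + (1 - y) * binomial_mean m g y
  else g 0%N.

Lemma binomial_mean_poly n g : exists p : {poly R}, forall y, binomial_mean n g y = p.[y].
Proof.
elim: n g => [|n IH] g; first by exists (g 0%N)%:P => y; rewrite hornerC.
have [p hp] := IH (fun i => g i.+1); have [q hq] := IH g.
by exists ('X * p + (1 - 'X) * q) => y; rewrite /= hp hq !hornerE.
Qed.

Lemma le_binomial_mean n f g y : 0 <= y <= 1 -> (forall i, f i <= g i) ->
  binomial_mean n f y <= binomial_mean n g y.
Proof.
move=> /andP[y0 y1]; elim: n f g => [|n IH] f g fg //=.
by apply: lerD; apply: ler_wpM2l; rewrite ?subr_ge0//; exact: IH.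
Qed.

Lemma binomial_meanD n f g y :
  binomial_mean n (fun i => f i + g i) y = binomial_mean n f y + binomial_mean n g y.
Proof. by elim: n f g => [|n IH] f g //=; rewrite !IH; ring. Qed.

Lemma binomial_meanZ n c f y :
  binomial_mean n (fun i => c * f i) y = c * binomial_mean n f y.
Proof. by elim: n f => [|n IH] f //=; rewrite !IH; ring. Qed.

Lemma binomial_mean_cst n c y : binomial_mean n (fun=> c) y = c.
Proof. by elim: n => [|n IH] //=; rewrite !IH; ring. Qed.

Lemma binomial_mean_sqr n (a y : R) :
  binomial_mean n (fun i => (i%:R - a) ^+ 2) y = n%:R * y * (1 - y) + (n%:R * y - a) ^+ 2.
Proof.
elim: n a => [|n IH] a /=; first by ring.
have -> : (fun i => (i.+1%:R - a) ^+ 2) = (fun i : nat => (i%:R - (a - 1)) ^+ 2 : R).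
  by apply/funext => i; rewrite -natr1; ring.
by rewrite !IH -natr1; ring.
Qed.

(** Chebyshev: by continuity the difference k(y) - k(i/N) is at most e/2 near
    y, and elsewhere at most a multiple of (y - i/N)^2, whose binomial mean is
    y (1 - y) / N. *)
Lemma bernstein_cvg (k : R -> R) (B y : R) : 0 <= y <= 1 -> (forall x, `|k x| <= B) ->
  {for y, continuous k} ->
  binomial_mean n.+1 (fun i => k (i%:R / n.+1%:R)) y @[n --> \oo] --> k y.
Proof.
move=> y01 kB ck; apply/cvgrPdist_le => e e0.
have e20 : 0 < e / 2 by rewrite divr_gt0.
move/cvgrPdist_le/(_ _ e20)/nbhs_ballP : ck => [d /= d0 dk].
have B0 : 0 <= B by exact: le_trans (normr_ge0 _) (kB 0).
(* away from y, |k y - k z| <= 2 B <= K (y - z)^2 *)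
pose K := 2 * B / d ^+ 2.
have K0 : 0 <= K by rewrite divr_ge0 ?sqr_ge0// mulr_ge0.
near=> n.
pose N : R := n.+1%:R.
have N0 : 0 < N by rewrite ltr0n.
have pt i : `|k y - k (i%:R / N)| <= e / 2 + K / N ^+ 2 * (i%:R - N * y) ^+ 2.
  have [yd|yd] := ltP `|y - i%:R / N| d.
    apply: (@le_trans _ _ (e / 2)); first exact: dk.
    by rewrite lerDl mulr_ge0 ?sqr_ge0// divr_ge0 ?sqr_ge0.
  apply: (@le_trans _ _ (2 * B)).
    by apply: (le_trans (ler_normB _ _)); have := kB y; have := kB (i%:R / N); lra.
  apply: (@le_trans _ _ (K * (y - i%:R / N) ^+ 2)); last first.
    rewrite (_ : K * _ = K / N ^+ 2 * (i%:R - N * y) ^+ 2); last by field; rewrite gt_eqF.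
    by rewrite lerDr ltW.
  rewrite /K mulrAC -mulrA ler_peMr ?mulr_ge0// ler_pdivlMr ?exprn_gt0// mul1r.
  by rewrite -(real_normK (num_real (y - _))) lerXn2r ?nnegrE// ltW.
pose b := binomial_mean n.+1 (fun i => k (i%:R / n.+1%:R)) y.
rewrite -[X in `|k y - X|]/b.
have hl : k y - b <= e / 2 + K / N ^+ 2 * (N * y * (1 - y)).
  rewrite lerBlDr.
  have := @le_binomial_mean n.+1 (fun=> k y) (fun i => (k (i%:R / N) + e / 2) +
     K / N ^+ 2 * (i%:R - N * y) ^+ 2) y y01.
  rewrite binomial_meanD binomial_meanD !binomial_mean_cst binomial_meanZ binomial_mean_sqr.
  rewrite subrr expr0n addr0 -/N -/b => h.
  have := h _; rewrite [b + _]addrC -addrA [b + _]addrC addrA; apply.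
  move=> i; have := pt i; set r := K / _ * _; rewrite ler_norml => /andP[]; lra.
have hr : b - k y <= e / 2 + K / N ^+ 2 * (N * y * (1 - y)).
  rewrite lerBlDr.
  have := @le_binomial_mean n.+1 (fun i => k (i%:R / N)) (fun i => (k y + e / 2) +
     K / N ^+ 2 * (i%:R - N * y) ^+ 2) y y01.
  rewrite binomial_meanD !binomial_mean_cst binomial_meanZ binomial_mean_sqr.
  rewrite subrr expr0n addr0 -/N -/b => h.
  have := h _; rewrite [k y + _]addrC -addrA [k y + _]addrC addrA; apply.
  move=> i; have := pt i; set r := K / _ * _; rewrite ler_norml => /andP[]; lra.
have small : K / N ^+ 2 * (N * y * (1 - y)) <= e / 2.
  apply: (@le_trans _ _ (K / N)).
    rewrite (_ : _ * _ = K / N * (y * (1 - y))); last by field; rewrite gt_eqF.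
    move/andP: y01 => [? ?]; apply: ler_piMr.
      by apply: divr_ge0; [exact: K0|exact: ltW].
    by rewrite mulr_ile1 ?subr_ge0// lerBlDr lerDl.
  rewrite ler_pdivrMr// mulrC -ler_pdivrMr// ltW// /N.
  apply: (@lt_le_trans _ _ n%:R); last by rewrite ler_nat.
  near: n; exact: nbhs_infty_gtr.
move: (K / N ^+ 2 * (N * y * (1 - y))) hl hr small => r hl hr small.
rewrite ler_norml; apply/andP; split; move: hl hr small; lra.
Unshelve. all: end_near. Qed.

Lemma binomial_mean_bound n g y (B : R) : 0 <= y <= 1 -> (forall i, `|g i| <= B) ->
  `|binomial_mean n g y| <= B.
Proof.
move=> y01 gB; rewrite ler_norml -[X in _ && (_ <= X)](@binomial_mean_cst n B y).
rewrite -[X in X <= _](@binomial_mean_cst n (- B) y).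
by apply/andP; split; apply: le_binomial_mean => // i; have := gB i; rewrite ler_norml => /andP[].
Qed.

End bernstein.

(** * Determinacy by moments and by Laplace transforms *)

Section moment_determinacy.
Context {R : realType}.

Lemma integrable_horner d (T : measurableType d) (P : probability T R) (Y : T -> R) (p : {poly R}) :
  measurable_fun setT Y -> (forall t, 0 <= Y t <= 1) ->
  P.-integrable setT (EFin \o (fun t => p.[Y t])).
Proof.
move=> mY Y01.
under [X in integrable _ _ (_ \o X)]eq_fun do rewrite horner_coef.
apply: integrable_Rsum => // i; apply: integrableRZ => //.
apply: (@integrable_bounded _ _ _ P _ 1); first exact: measurable_funX.
by move=> t; have /andP[? ?] := Y01 t; rewrite normrX ger0_norm// exprn_ile1.
Qed.

Lemma Rintegral_horner d (T : measurableType d) (P : probability T R) (Y : T -> R) (p : {poly R}) :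
  measurable_fun setT Y -> (forall t, 0 <= Y t <= 1) ->
  \int[P]_t p.[Y t] = \sum_(i < size p) p`_i * \int[P]_t (Y t ^+ i).
Proof.
move=> mY Y01.
have iX i : P.-integrable setT (EFin \o (fun t => Y t ^+ i)).
  apply: (@integrable_bounded _ _ _ P _ 1); first exact: measurable_funX.
  by move=> t; have /andP[? ?] := Y01 t; rewrite normrX ger0_norm// exprn_ile1.
under eq_Rintegral do rewrite horner_coef.
rewrite Rintegral_sum//; last by move=> i; exact: integrableRZ.
by apply: eq_bigr => i _; rewrite RintegralZl.
Qed.

(** The Bernstein polynomials of k are bounded by B and converge pointwise to
    k, and their means only involve moments. *)
Lemma moment_determinacy d1 d2 (T1 : measurableType d1) (T2 : measurableType d2)
  (P1 : probability T1 R) (P2 : probability T2 R) (Y1 : T1 -> R) (Y2 : T2 -> R) :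
  measurable_fun setT Y1 -> measurable_fun setT Y2 ->
  (forall t, 0 <= Y1 t <= 1) -> (forall t, 0 <= Y2 t <= 1) ->
  (forall j : nat, \int[P1]_t (Y1 t ^+ j) = \int[P2]_t (Y2 t ^+ j)) ->
  forall (k : R -> R) (B : R), continuous k -> (forall x, `|k x| <= B) ->
  \int[P1]_t k (Y1 t) = \int[P2]_t k (Y2 t).
Proof.
move=> m1 m2 Y10 Y20 mom k B ck kB.
pose b n y := binomial_mean n.+1 (fun i => k (i%:R / n.+1%:R)) y.
have lim d (T : measurableType d) (P : probability T R) (Y : T -> R) :
    measurable_fun setT Y -> (forall t, 0 <= Y t <= 1) ->
    \int[P]_t b n (Y t) @[n --> \oo] --> \int[P]_t k (Y t).
  move=> mY Y01.
  apply: (@Rdominated_cvg _ _ _ P setT (fun n t => b n (Y t)) _ (cst B) _ _ _ _ _).2 => //.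
  - move=> n; have [p hp] := binomial_mean_poly n.+1 (fun i => k (i%:R / n.+1%:R)).
    rewrite /b; under eq_fun do rewrite hp.
    exact: integrable_measurable (integrable_horner P p mY Y01).
  - by move=> t _; apply: (@bernstein_cvg _ _ B) => //; exact: ck.
  - exact: (finite_measure_integrable_cst P).
  - by move=> n t _; apply: binomial_mean_bound.
apply: (cvg_unique _ (lim _ _ P1 Y1 m1 Y10)) => //.
rewrite (_ : (fun n => _) = (fun n => \int[P2]_t b n (Y2 t))); first exact: lim.
apply/funext => n; have [p hp] := binomial_mean_poly n.+1 (fun i => k (i%:R / n.+1%:R)).
rewrite /b; under eq_Rintegral do rewrite hp.
under [RHS]eq_Rintegral do rewrite hp.
by rewrite !Rintegral_horner//; apply: eq_bigr => i _; rewrite mom.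
Qed.

(** With y = exp(-v) the Laplace transform at j is the j-th moment of a
    variable with values in [0, 1]. A test function that vanishes for large v
    extends continuously to y = 0, and this class suffices for distribution
    functions. *)
Lemma laplace_determinacy d1 d2 (T1 : measurableType d1) (T2 : measurableType d2)
  (P1 : probability T1 R) (P2 : probability T2 R) (V1 : T1 -> R) (V2 : T2 -> R) :
  measurable_fun setT V1 -> measurable_fun setT V2 ->
  (forall t, 0 <= V1 t) -> (forall t, 0 <= V2 t) ->
  (forall j : nat, \int[P1]_t expR (- (j%:R * V1 t)) = \int[P2]_t expR (- (j%:R * V2 t))) ->
  forall (h : R -> R) (B M : R), continuous h -> (forall x, `|h x| <= B) ->
  (forall x, M <= x -> h x = 0) ->
  \int[P1]_t h (V1 t) = \int[P2]_t h (V2 t).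
Proof.
move=> m1 m2 V10 V20 lap h B M ch hB hM.
pose k (y : R) := if 0 < y then h (- ln y) else 0.
have B0 : 0 <= B by exact: le_trans (normr_ge0 _) (hB 0).
have kE x : k (expR (- x)) = h x by rewrite /k expR_gt0 expRK opprK.
have kB x : `|k x| <= B by rewrite /k; case: ifP; rewrite ?normr0.
have ck : continuous k.
  move=> y; have [y0|y0] := ltP 0 y.
    apply: (@cvg_trans _ (h (- ln z) @[z --> y])).
      apply: near_eq_cvg; near=> z; rewrite /k.
      have -> : 0 < z by near: z; exact: lt_nbhsr.
      by [].
    rewrite /k y0; apply: (continuous_comp (f := fun z => - ln z) (g := h)); last exact: ch.
    by apply: cvgN; exact: continuous_ln.
  have ky : k y = 0 by rewrite /k ltNge y0.
  rewrite /continuous_at ky; apply: cvg_near_cst; near=> z.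
  rewrite /k; case: ifP => // z0; apply: hM.
  rewrite lerNr -(expRK (- M)) ler_ln ?posrE ?expR_gt0// ltW//.
  near: z; apply: lt_nbhsl; exact: le_lt_trans y0 (expR_gt0 _).
have mY d (T : measurableType d) (V : T -> R) : measurable_fun setT V ->
    measurable_fun setT (fun t => expR (- V t)).
  by move=> mV; do 2 apply: measurableT_comp => //.
have Y01 d (T : measurableType d) (V : T -> R) : (forall t, 0 <= V t) ->
    forall t, 0 <= expR (- V t) <= 1.
  by move=> V0 t; rewrite expR_ge0 -[leRHS]expR0 ler_expR oppr_le0 V0.
have mom j : \int[P1]_t (expR (- V1 t) ^+ j) = \int[P2]_t (expR (- V2 t) ^+ j).
  under eq_Rintegral do rewrite -expRM_natl mulrN.
  by under [RHS]eq_Rintegral do rewrite -expRM_natl mulrN.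
have := @moment_determinacy _ _ _ _ P1 P2 _ _ (mY _ _ _ m1) (mY _ _ _ m2)
  (Y01 _ _ _ V10) (Y01 _ _ _ V20) mom k B ck kB.
under eq_Rintegral do rewrite kE.
by under [X in _ = X -> _]eq_Rintegral do rewrite kE.
Unshelve. all: end_near. Qed.

End moment_determinacy.

(** * The squared norm of a Gaussian vector *)

Section laplace_duality.
Context {R : realType}.

Lemma Rfubini_bounded d1 d2 (T1 : measurableType d1) (T2 : measurableType d2)
  (P1 : probability T1 R) (P2 : probability T2 R) (f : T1 * T2 -> R) (C : R) :
  measurable_fun setT f -> (forall z, `|f z| <= C) ->
  \int[P1]_x \int[P2]_y f (x, y) = \int[P2]_y \int[P1]_x f (x, y).
Proof.
move=> mf fC.
have i12 : (P1 \x P2)%E.-integrable setT (EFin \o f).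
  exact: (@integrable_bounded _ _ _ (P1 \x P2)%E _ C).
have F := Fubini i12.
have e1 x : (\int[P2]_y f (x, y))%:E = (\int[P2]_y (f (x, y))%:E)%E.
  rewrite fineK//; apply: (integrable_fin_num measurableT).
  apply: (@integrable_bounded _ _ _ P2 _ C) => //.
  by apply: measurableT_comp.
have e2 y : (\int[P1]_x f (x, y))%:E = (\int[P1]_x (f (x, y))%:E)%E.
  rewrite fineK//; apply: (integrable_fin_num measurableT).
  apply: (@integrable_bounded _ _ _ P1 _ C) => //.
  by apply: measurableT_comp.
rewrite {1 3}/Rintegral; congr fine.
under eq_integral do rewrite e1.
by under [RHS]eq_integral do rewrite e2.
Qed.

Variables (d : measure_display) (T : measurableType d) (P : probability T R).
Variables (n : nat) (X : 'I_n -> T -> R) (S : 'I_n -> 'I_n -> R).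
Hypothesis mX : forall i, measurable_fun setT (X i).
Hypothesis XS : forall a : 'I_n -> R,
  \int[P]_t cos (\sum_i a i * X i t) = expR (- (\sum_i \sum_j a i * S i j * a j) / 2).

Lemma quadfE (x : euclid R n) :
  quadf S x = \sum_i \sum_j (tnth x i : R) * S i j * tnth x j.
Proof.
apply: eq_bigr => i _; rewrite /mulv mulr_sumr.
by apply: eq_bigr => j _; rewrite mulrA.
Qed.

(** A characteristic function is at most 1, so the covariance matrix is
    positive semidefinite. *)
Lemma quadf_ge0 (x : euclid R n) : 0 <= quadf S x.
Proof.
have mc : measurable_fun setT (fun t => cos (\sum_i (tnth x i : R) * X i t)).
  apply: measurableT_comp; first exact: (continuous_measurable_fun (@continuous_cos R)).
  by apply: measurable_sum => i; exact: measurable_funM.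
have := XS (fun i => tnth x i); rewrite -quadfE => e.
have : expR (- quadf S x / 2) <= 1.
  rewrite -e -[leRHS](@Rintegral_prob_cst _ _ _ P); apply: le_Rintegral => //.
  - by apply: (@integrable_bounded _ _ _ P _ 1) => // t; exact: cos_max.
  - exact: (finite_measure_integrable_cst P).
by rewrite -[leRHS]expR0 ler_expR pmulr_lle0// oppr_le0.
Qed.

(** By the cosine formula for the standard Gaussian vector x, exp(- c^2 |X|^2
    / 2) is the mean over x of cos(c <X, x>). Exchange the two means and use
    the cosine formula for X. *)
Lemma laplace_duality (c : R) :
  \int[P]_t expR (- (c ^+ 2 * (\sum_i X i t ^+ 2) / 2)) =
  \int[stdgauss n]_x expR (- (c ^+ 2 * quadf S x / 2)).
Proof.
transitivity (\int[P]_t \int[stdgauss n]_x cos (\sum_i (c * X i t) * (tnth x i : R))).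
  apply: eq_Rintegral => t _.
  have := @stdgauss_cos R n 0 (fun i => c * X i t).
  rewrite cos0 mul1r; under eq_Rintegral do rewrite add0r.
  move=> ->; congr expR; rewrite mulNr; congr (- (_ / _)).
  by rewrite mulr_sumr; apply: eq_bigr => i _; rewrite exprMn.
rewrite (@Rfubini_bounded _ _ _ _ P (stdgauss n)
  (fun z => cos (\sum_i (c * X i z.1) * (tnth z.2 i : R))) 1); first last.
- by move=> z; exact: cos_max.
- apply: measurableT_comp; first exact: (continuous_measurable_fun (@continuous_cos R)).
  apply: measurable_sum => i; apply: measurable_funM.
    by apply: measurable_funM => //; apply: measurableT_comp.
  exact: (measurableT_comp (measurable_coord i) measurable_snd).
apply: eq_Rintegral => x _ /=.
have := XS (fun i => c * (tnth x i : R)).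
under eq_Rintegral => t _.
  under eq_bigr do rewrite (mulrC c) -mulrA mulrC. 
  over.
move=> ->; congr expR; rewrite mulNr; congr (- (_ / _)).
rewrite quadfE mulr_sumr; apply: eq_bigr => i _; rewrite mulr_sumr.
by apply: eq_bigr => j _; ring.
Qed.

Lemma sqnorm_law (h : R -> R) (B M : R) : continuous h -> (forall x, `|h x| <= B) ->
  (forall x, M <= x -> h x = 0) ->
  \int[P]_t h (\sum_i X i t ^+ 2) = \int[stdgauss n]_x h (quadf S x).
Proof.
move=> ch hB hM.
apply: (@laplace_determinacy _ _ _ _ _ _ _ _ _ _ _ _ _ _ _ B M) => //.
- by apply: measurable_sum => i; exact: measurable_funX.
- exact: (expgrowth_quadf S).1.
- by move=> t; apply: sumr_ge0 => i _; exact: sqr_ge0.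
- exact: quadf_ge0.
- move=> j; have := laplace_duality (Num.sqrt (2 * j%:R)).
  rewrite sqr_sqrtr ?mulr_ge0//.
  have e (x : R) : 2 * j%:R * x / 2 = j%:R * x by field.
  under eq_Rintegral do rewrite e.
  by under [X in _ = X -> _]eq_Rintegral do rewrite e.
Qed.

End laplace_duality.

(** * Moments of Gaussian laws *)

Section gaussian_law_facts.
Context {R : realType}.

(** Transfer of integrals to the law; the notion of law only speaks of
    measurable sets. *)
Lemma has_law_Rintegral d (T : measurableType d) (P : probability T R) (X : T -> R)
  (Q : probability (measurableTypeR R) R) (f : R -> R) :
  measurable_fun setT X -> has_law P X Q -> measurable_fun setT f ->
  Q.-integrable setT (EFin \o f) ->
  P.-integrable setT (EFin \o (fun t => f (X t))) /\ \int[P]_t f (X t) = \int[Q]_x f x.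
Proof.
move=> mX XQ mf iQ.
have E (g : R -> \bar R) : measurable_fun setT g -> (forall x, 0 <= g x)%E ->
    (\int[P]_t g (X t) = \int[Q]_x g x)%E.
  move=> mg g0.
  have := @ge0_integral_pushforward _ _ T (measurableTypeR R) R X mX P setT g measurableT mg (fun x _ => g0 x).
  rewrite preimage_setT => <-.
  apply: (eq_measure_integral Q) => A mA _.
  exact: XQ.
have iP : P.-integrable setT (EFin \o (fun t => f (X t))).
  apply/integrableP; split.
    by apply/measurable_EFinP; exact: measurableT_comp.
  move/integrableP : iQ => [_]; rewrite -(E (abse \o (EFin \o f)))//.
    by apply: measurableT_comp => //; exact/measurable_EFinP.
  by move=> x /=; rewrite lee_fin.
split => //; rewrite /Rintegral; congr fine.
rewrite integralE [RHS]integralE.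
rewrite -(E ((EFin \o f)^\+)%E)//; last exact/measurable_funepos/measurable_EFinP.
rewrite -(E ((EFin \o f)^\-)%E)//; last exact/measurable_funeneg/measurable_EFinP.
by congr (_ - _)%E; apply: eq_integral => t _; rewrite ?funeposE ?funenegE.
Qed.

Lemma dirac_Rintegral (m : R) (f : R -> R) : measurable_fun setT f ->
  (@dirac _ (measurableTypeR R) m R).-integrable setT (EFin \o f) /\
  \int[@dirac _ (measurableTypeR R) m R]_x f x = f m.
Proof.
move=> mf.
have e (g : R -> \bar R) : measurable_fun setT g -> (\int[@dirac _ (measurableTypeR R) m R]_x g x = g m)%E.
  by move=> mg; rewrite integral_dirac// diracT mul1e.
split; last by rewrite /Rintegral e//; exact/measurable_EFinP.
apply/integrableP; split; first exact/measurable_EFinP.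
rewrite (e (abse \o (EFin \o f)))/= ?ltry//.
by apply: measurableT_comp => //; exact/measurable_EFinP.
Qed.

(** Covers the degenerate law v = 0 and the normal law at once. The cosine
    formula requires a centred variable, for otherwise a phase appears. *)
Lemma gaussian_lawP d (T : measurableType d) (P : probability T R) (X : T -> R) (m v : R) :
  measurable_fun setT X -> 0 <= v -> has_law P X (gaussian_law m v) ->
  [/\ P.-integrable setT (EFin \o X), \int[P]_t X t = m,
      P.-integrable setT (EFin \o (fun t => X t ^+ 2)),
      \int[P]_t (X t ^+ 2) = m ^+ 2 + v &
      m = 0 -> \int[P]_t cos (X t) = expR (- v / 2)].
Proof.
move=> mX v0; rewrite /gaussian_law; have m2 : measurable_fun setT (fun x : R => x ^+ 2).
  exact: measurable_funX.
have mc : measurable_fun setT (@cos R) by exact: (continuous_measurable_fun (@continuous_cos R)).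
have [s0|s0] := eqVneq (Num.sqrt v) 0.
  have vv : v = 0 by rewrite -(sqr_sqrtr v0) s0 expr0n.
  move=> XQ.
  have law f := @has_law_Rintegral _ _ P X (@dirac _ (measurableTypeR R) m R) f mX XQ.
  have dl f mf := (@dirac_Rintegral m f mf).
  have [i1 e1] := law id (@measurable_id _ _ _) (dl id (@measurable_id _ _ _)).1.
  have [i2 e2] := law _ m2 (dl _ m2).1.
  have [i3 e3] := law _ mc (dl _ mc).1.
  split => //.
  - by rewrite e1 (dl id (@measurable_id _ _ _)).2.
  - by rewrite e2 (dl _ m2).2 vv addr0.
  - by move=> m0; rewrite e3 (dl _ mc).2 m0 cos0 vv oppr0 mul0r expR0.
set s := Num.sqrt v in s0 *.
have s2 : s ^+ 2 = v by rewrite sqr_sqrtr.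
move=> XQ.
have law f := @has_law_Rintegral _ _ P X (normal_prob m s) f mX XQ.
have [j1 k1] := normal_mean m s0.
have [j2 k2] := normal_variance m s0.
have jc (c : R) : (normal_prob m s).-integrable setT (EFin \o cst c).
  exact: (finite_measure_integrable_cst (normal_prob m s)).
have ex (x : R) : x ^+ 2 = ((x - m) ^+ 2 + (2 * m) * x) - m ^+ 2 by ring.
have jx : (normal_prob m s).-integrable setT (EFin \o (fun x => (2 * m) * x)).
  exact: integrableRZ.
have j3 : (normal_prob m s).-integrable setT (EFin \o (fun x => x ^+ 2)).
  under [X in integrable _ _ (_ \o X)]eq_fun do rewrite ex.
  apply: integrableRB => //; last exact: jc.
  exact: integrableRD.
have k3 : \int[normal_prob m s]_x (x ^+ 2) = m ^+ 2 + v.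
  under eq_Rintegral do rewrite ex.
  rewrite RintegralB//; [|exact: integrableRD|exact: jc].
  by rewrite RintegralD// RintegralZl// k1 k2 Rintegral_prob_cst s2; ring.
have j4 : (normal_prob m s).-integrable setT (EFin \o @cos R).
  by apply: (@integrable_bounded _ _ _ (normal_prob m s) _ 1) => // x; exact: cos_max.
have [i1 e1] := law id (@measurable_id _ _ _) j1.
have [i2 e2] := law _ m2 j3.
have [i4 e4] := law _ mc j4.
split => //.
- by rewrite e1.
- by rewrite e2.
- move=> m0; rewrite e4 m0.
  have := normal_cos 0 1 s0; rewrite cos0 mul1r expr1n mul1r s2 mulNr => <-.
  by apply: eq_Rintegral => x _; rewrite add0r mul1r.
Qed.

End gaussian_law_facts.

(** * A central limit theorem for squared norms *)

Section ramp.
Context {R : realType}.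
Variables (r e : R).
Hypothesis e0 : 0 < e.

(** A continuous function between the indicators of ]-oo, r] and ]-oo, r + e].
    It vanishes far to the right, as laplace_determinacy requires. *)
Definition ramp (x : R) : R := Num.max 0 (Num.min 1 ((r + e - x) / e)).

Lemma ramp_ge0 x : 0 <= ramp x. Proof. by rewrite /ramp le_max lexx. Qed.

Lemma ramp_le1 x : ramp x <= 1.
Proof. by rewrite /ramp ge_max ler01/= ge_min lexx. Qed.

Lemma ramp_norm_le1 x : `|ramp x| <= 1.
Proof. by rewrite ger0_norm ?ramp_ge0 ?ramp_le1. Qed.

Lemma ramp_eq1 x : x <= r -> ramp x = 1.
Proof.
move=> xr; rewrite /ramp; have h : 1 <= (r + e - x) / e.
  by rewrite ler_pdivlMr// mul1r; lra.
by rewrite min_l// max_r.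
Qed.

Lemma ramp_eq0 x : r + e <= x -> ramp x = 0.
Proof.
move=> xr; rewrite /ramp max_l// ge_min; apply/orP; right.
by rewrite pmulr_lle0 ?invr_gt0//; lra.
Qed.

Lemma ramp_lipschitz x y : `|ramp x - ramp y| <= `|x - y| / e.
Proof.
have key a b : Num.max 0 (Num.min 1 a) - Num.max 0 (Num.min 1 b) <= `|a - b| :> R.
  have := ler_norm (a - b); have := normr_ge0 (a - b).
  rewrite !minEle; case: (leP 1 a) => ?; case: (leP 1 b) => ?; rewrite !maxEle;
    do ![case: (leP 0 _) => ?]; lra.
have ab : (r + e - x) / e - (r + e - y) / e = (y - x) / e by field; rewrite gt_eqF.
have ab' : (r + e - y) / e - (r + e - x) / e = (x - y) / e by field; rewrite gt_eqF.
have n1 : `|(y - x) / e| = `|x - y| / e.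
  by rewrite normrM normfV (gtr0_norm e0) distrC.
have n2 : `|(x - y) / e| = `|x - y| / e by rewrite normrM normfV (gtr0_norm e0).
rewrite ler_norml lerNl opprB; apply/andP; split.
  by apply: (le_trans (key _ _)); rewrite ab' n2.
by apply: (le_trans (key _ _)); rewrite ab n1.
Qed.

Lemma continuous_ramp : continuous ramp.
Proof.
move=> x; apply/cvgrPdist_le => eps eps0; near=> y.
apply: (le_trans (ramp_lipschitz _ _)); rewrite ler_pdivrMr//.
near: y; apply: cvgr_dist_le; first exact: cvg_id.
by rewrite mulr_gt0.
Unshelve. all: end_near. Qed.

End ramp.

Section quadratic_clt.
Context {R : realType} {d : measure_display} {T : measurableType d} {P : probability T R}.
Variables (X : forall m : nat, 'I_m -> T -> R) (S : forall m : nat, 'I_m -> 'I_m -> R).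
Variables (c a : nat -> R) (s : R).
Hypothesis mX : forall m i, measurable_fun setT (X (m:=m) i).
Hypothesis symS : forall m (i j : 'I_m), S i j = S j i.
Hypothesis XS : forall m (z : 'I_m -> R),
  \int[P]_t cos (\sum_i z i * X i t) = expR (- (\sum_i \sum_j z i * S i j * z j) / 2).
Hypothesis s0 : 0 < s.
Hypothesis c0 : forall m, (0 < m)%N -> 0 < c m.
Hypothesis q2 : 2 * c m ^+ 2 * (\sum_(i < m) \sum_j S i j ^+ 2) @[m --> \oo] --> s ^+ 2.
Hypothesis q4 : c m ^+ 4 * (\sum_(i < m) \sum_j sqmx (S (m:=m)) i j ^+ 2) @[m --> \oo] --> 0.
Hypothesis tr : c m * (\sum_(i < m) S i i) - a m @[m --> \oo] --> 0.

Let W m t := c m * (\sum_(i < m) X i t ^+ 2) - a m.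

Lemma measurable_W m : measurable_fun setT (W m).
Proof.
apply: measurable_funB => //; apply: measurable_funM => //.
by apply: measurable_sum => i; exact: measurable_funX.
Qed.

(** The squared norm is replaced by the quadratic form, then the centring a m
    by c m times the trace (the ramp is Lipschitz), and the rest is
    stein_bound. *)
Lemma ramp_mean_cvg (r e : R) : 0 < e ->
  \int[P]_t ramp r e (W m t) @[m --> \oo] --> \int[normal_prob 0 s]_x ramp r e x.
Proof.
move=> e0; set Nh := \int[normal_prob 0 s]_x ramp r e x.
pose b m := c m * (\sum_(i < m) S i i) - a m.
(* the first term is the error of recentring, the second one is stein_bound *)
pose bound m := `|b m| / e + 4 * 1 * (`|1 - 2 * c m ^+ 2 / s ^+ 2 * \sum_(i < m) \sum_j S i j ^+ 2| +
    2 * c m ^+ 2 / s ^+ 2 * Num.sqrt (2 * \sum_(i < m) \sum_j sqmx (S (m:=m)) i j ^+ 2)).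
have sn0 : s != 0 by rewrite gt_eqF.
have bd m : (0 < m)%N -> `|\int[P]_t ramp r e (W m t) - Nh| <= bound m.
  move=> m0; have cm0 := c0 m0.
  have law : \int[P]_t ramp r e (W m t) =
      \int[stdgauss m]_x ramp r e (c m * quadf (S (m:=m)) x - a m).
    apply: (@sqnorm_law R _ _ P m (X (m:=m)) (S (m:=m)) (@mX m) (@XS m)
      (fun v => ramp r e (c m * v - a m)) 1 ((r + e + a m) / c m)).
    - move=> v; apply: (continuous_comp (f := fun v => c m * v - a m) (g := ramp r e)); last exact: continuous_ramp.
      by apply: cvgB; [apply: cvgM; [exact: cvg_cst|exact: cvg_id]|exact: cvg_cst].
    - by move=> v; exact: ramp_norm_le1.
    - move=> v; rewrite ler_pdivrMr// => h; apply: ramp_eq0 => //.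
      by rewrite mulrC in h; lra.
  pose F (x : euclid R m) := c m * (quadf (S (m:=m)) x - \sum_(i < m) S i i).
  have mF : measurable_fun setT F.
    by apply: measurable_funM => //; apply: measurable_funB => //; exact: (expgrowth_quadf _).1.
  have mr := continuous_measurable_fun (@continuous_ramp R r e e0).
  have i1 : (stdgauss m).-integrable setT (EFin \o (fun x => ramp r e (F x))).
    apply: (@integrable_bounded _ _ _ (stdgauss m) _ 1); first exact: measurableT_comp.
    by move=> x; exact: ramp_norm_le1.
  have i2 : (stdgauss m).-integrable setT (EFin \o (fun x => ramp r e (F x + b m))).
    apply: (@integrable_bounded _ _ _ (stdgauss m) _ 1).
      by apply: measurableT_comp => //; exact: measurable_funD.
    by move=> x; exact: ramp_norm_le1.
  have -> : \int[P]_t ramp r e (W m t) = \int[stdgauss m]_x ramp r e (F x + b m).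
    by rewrite law; apply: eq_Rintegral => x _; rewrite /F /b; congr ramp; ring.
  have -> : \int[stdgauss m]_x ramp r e (F x + b m) - Nh =
     (\int[stdgauss m]_x ramp r e (F x + b m) - \int[stdgauss m]_x ramp r e (F x)) +
     (\int[stdgauss m]_x ramp r e (F x) - Nh) by ring.
  apply: (le_trans (ler_normD _ _)); apply: lerD; last first.
    exact: (@stein_bound R m (S (m:=m)) (c m) s 1 (ramp r e) (@symS m) sn0
      (@continuous_ramp R r e e0) (@ramp_norm_le1 R r e)).
  rewrite -RintegralB//; apply: (le_trans (le_normr_Rintegral measurableT (integrableRB measurableT i2 i1))).
  rewrite -[leRHS](@Rintegral_prob_cst _ _ _ (stdgauss m)); apply: le_Rintegral => //.
  - rewrite (_ : EFin \o _ = abse \o (EFin \o (fun x => ramp r e (F x + b m) - ramp r e (F x))))//.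
    by apply: integrable_abse; exact: integrableRB.
  - exact: (finite_measure_integrable_cst (stdgauss m)).
  - by move=> x _; apply: (le_trans (@ramp_lipschitz R r e e0 _ _)); rewrite addrAC subrr add0r.
have bcv : bound m @[m --> \oo] --> 0.
  have e1 m : 2 * c m ^+ 2 / s ^+ 2 * \sum_(i < m) \sum_j S i j ^+ 2 =
     (2 * c m ^+ 2 * \sum_(i < m) \sum_j S i j ^+ 2) / s ^+ 2 by ring.
  have e2 m : 2 * c m ^+ 2 / s ^+ 2 * Num.sqrt (2 * \sum_(i < m) \sum_j sqmx (S (m:=m)) i j ^+ 2) =
     2 / s ^+ 2 * Num.sqrt (2 * (c m ^+ 4 * \sum_(i < m) \sum_j sqmx (S (m:=m)) i j ^+ 2)).
    set A := \sum_(i < m) _.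
    rewrite (_ : 2 * (c m ^+ 4 * A) = (c m ^+ 2) ^+ 2 * (2 * A)); last by ring.
    by rewrite [in RHS]sqrtrM ?sqr_ge0// sqrtr_sqr ger0_norm ?sqr_ge0//; ring.
  have lim0 : `|0 : R| / e + 4 * 1 *
      (`|1 - s ^+ 2 / s ^+ 2| + 2 / s ^+ 2 * Num.sqrt (2 * 0)) = 0.
    by rewrite normr0 mul0r add0r divff ?expf_neq0// subrr normr0 mulr0 sqrtr0 !mulr0 addr0 mulr0.
  have -> : bound = fun m => `|b m| / e + 4 * 1 *
      (`|1 - (2 * c m ^+ 2 * \sum_(i < m) \sum_j S i j ^+ 2) / s ^+ 2| +
      2 / s ^+ 2 * Num.sqrt (2 * (c m ^+ 4 * \sum_(i < m) \sum_j sqmx (S (m:=m)) i j ^+ 2))).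
    by apply/funext => m; rewrite /bound e1 e2.
  suff : (fun m => `|b m| / e + 4 * 1 *
      (`|1 - (2 * c m ^+ 2 * \sum_(i < m) \sum_j S i j ^+ 2) / s ^+ 2| +
      2 / s ^+ 2 * Num.sqrt (2 * (c m ^+ 4 * \sum_(i < m) \sum_j sqmx (S (m:=m)) i j ^+ 2)))) @ \oo -->
      `|0 : R| / e + 4 * 1 * (`|1 - s ^+ 2 / s ^+ 2| + 2 / s ^+ 2 * Num.sqrt (2 * 0)).
    by rewrite lim0.
  apply: cvgD.
    by apply: cvgM; [apply: cvg_norm; exact: tr|exact: cvg_cst].
  apply: cvgM; first exact: cvg_cst.
  apply: cvgD.
    apply: cvg_norm; apply: cvgB; first exact: cvg_cst.
    by apply: cvgM; [exact: q2|exact: cvg_cst].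
  apply: cvgM; first exact: cvg_cst.
  apply: (@cvg_comp _ _ _ _ Num.sqrt); last exact: sqrt_continuous.
  by apply: cvgM; [exact: cvg_cst|exact: q4].
apply/cvgrPdist_le => eps eps0.
move/cvgrPdist_le/(_ _ eps0) : bcv => bcv; near=> m.
have : `|0 - bound m| <= eps by near: m.
rewrite sub0r normrN => /(le_trans (ler_norm _)); apply: le_trans.
rewrite distrC; apply: bd.
by near: m; exists 1%N.
Unshelve. all: end_near. Qed.

Let T1 := partial_mean s (cst 1).

Lemma cdf_partial_mean (z : R) : normal_prob 0 s `]-oo, z] = (T1 z)%:E.
Proof.
rewrite /T1 /partial_mean.
under eq_Rintegral do rewrite mul1r.
rewrite /Rintegral integral_indic// setIT fineK//.
exact: fin_num_measure.
Qed.

Lemma continuous_T1 : continuous T1.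
Proof.
have sn0 : s != 0 by rewrite gt_eqF.
apply: (@continuous_of_is_derive _ _ (fun x => cst 1 x * normal_pdf 0 s x)) => x.
have cc : continuous (cst 1 : R -> R) by exact: cst_continuous.
apply: (@is_derive_partial_mean R s sn0 (cst 1) x 1 cc) => t.
by rewrite normr1.
Qed.

(** The ramps at r and at r - e enclose the indicator of ]-oo, r]; for a small
    width e the limits of their means are close to the limiting distribution
    function at r, which is continuous. *)
Theorem quadratic_clt (r : R) :
  P (W m @^-1` `]-oo, r]%classic) @[m --> \oo] --> normal_prob 0 s `]-oo, r]%classic.
Proof.
rewrite cdf_partial_mean.
have mA m : measurable (W m @^-1` `]-oo, r]%classic).
  by rewrite -[X in measurable X]setTI; apply: measurable_W.
have PE m : P (W m @^-1` `]-oo, r]%classic) = (\int[P]_t \1_(W m @^-1` `]-oo, r]) t)%:E.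
  rewrite /Rintegral integral_indic// setIT fineK//.
  exact: fin_num_measure.
under eq_fun do rewrite PE.
apply: cvg_EFin; first exact: nearW.
have sn0 : s != 0 by rewrite gt_eqF.
have iW (h : R -> R) : measurable_fun setT h -> (forall x, `|h x| <= 1) ->
    forall m, P.-integrable setT (EFin \o (fun t => h (W m t))).
  move=> mh h1 m; apply: (@integrable_bounded _ _ _ P _ 1) => //.
  by apply: measurableT_comp => //; exact: measurable_W.
have iind m : P.-integrable setT (EFin \o (\1_(W m @^-1` `]-oo, r]) : T -> R)).
  apply: (@integrable_bounded _ _ _ P _ 1); first exact: measurable_indic.
  by move=> t; rewrite indicE; case: (_ \in _); rewrite ?normr1 ?normr0.
have iN (h : R -> R) : measurable_fun setT h -> (forall x, `|h x| <= 1) ->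
    (normal_prob 0 s).-integrable setT (EFin \o h).
  by move=> mh h1; apply: (@integrable_bounded _ _ _ (normal_prob 0 s) _ 1).
have iNi x : (normal_prob 0 s).-integrable setT (EFin \o (fun t => cst 1 t * \1_(`]-oo, x] : set R) t)).
  by apply: (@integrable_partial_mean _ _ _ _ 1) => // t; rewrite normr1.
have mr q e (e0 : 0 < e) : measurable_fun setT (ramp q e) := continuous_measurable_fun (@continuous_ramp R q e e0).
apply/cvgrPdist_le => eps eps0.
have e20 : 0 < eps / 2 by rewrite divr_gt0.
have /cvgrPdist_le/(_ _ e20)/nbhs_ballP[dl /= dl0 hdl] : {for r, continuous T1} by exact: continuous_T1.
pose e := dl / 2; have e0 : 0 < e by rewrite divr_gt0.
have up : T1 (r + e) <= T1 r + eps / 2.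
  have /hdl : ball r dl (r + e) by rewrite /ball/= opprD addNKr normrN gtr0_norm// /e; lra.
  by rewrite ler_norml => /andP[]; lra.
have lo : T1 r - eps / 2 <= T1 (r - e).
  have /hdl : ball r dl (r - e) by rewrite /ball/= opprB addrC subrK gtr0_norm// /e; lra.
  by rewrite ler_norml => /andP[]; lra.
have Nup : \int[normal_prob 0 s]_x ramp r e x <= T1 (r + e).
  apply: le_Rintegral => //.
    by apply: iN; [exact: mr|move=> x; exact: ramp_norm_le1].
  move=> x _; rewrite mul1r indicE; case: (boolP (x \in _)) => [_|]; first exact: ramp_le1.
  rewrite notin_setE/= in_itv/= => /negP; rewrite -ltNge => h.
  by rewrite ramp_eq0// ltW.
have Nlo : T1 (r - e) <= \int[normal_prob 0 s]_x ramp (r - e) e x.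
  apply: le_Rintegral => //.
    by apply: iN; [exact: mr|move=> x; exact: ramp_norm_le1].
  move=> x _; rewrite mul1r indicE; case: (boolP (x \in _)) => [|_]; last exact: ramp_ge0.
  by rewrite inE/= in_itv/= => h; rewrite ramp_eq1.
(* t and p stand for the limiting and the actual distribution functions at r; u
   and l mark the upper and the lower ramp. *)
have arith (t tu tl nu nl p pu pl : R) : `|nu - pu| <= eps / 2 -> `|nl - pl| <= eps / 2 ->
    p <= pu -> pl <= p -> tu <= t + eps / 2 -> t - eps / 2 <= tl -> nu <= tu -> tl <= nl ->
    `|t - p| <= eps.
  rewrite !ler_norml => /andP[h1 h2] /andP[h3 h4] h5 h6 h7 h8 h9 h10.
  by apply/andP; split; lra.
have cu := @ramp_mean_cvg r e e0.
have cl := @ramp_mean_cvg (r - e) e e0.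
move/cvgrPdist_le/(_ _ e20) : cu => cu; move/cvgrPdist_le/(_ _ e20) : cl => cl.
near=> m.
have hu : `|\int[normal_prob 0 s]_x ramp r e x - \int[P]_t ramp r e (W m t)| <= eps / 2 by near: m.
have hl : `|\int[normal_prob 0 s]_x ramp (r - e) e x - \int[P]_t ramp (r - e) e (W m t)| <= eps / 2 by near: m.
have pu : \int[P]_t \1_(W m @^-1` `]-oo, r]) t <= \int[P]_t ramp r e (W m t).
  apply: le_Rintegral => //; first by apply: iW; [exact: mr|move=> x; exact: ramp_norm_le1].
  move=> t _; rewrite indicE; case: (boolP (t \in _)) => [|_]; last exact: ramp_ge0.
  by rewrite inE/= in_itv/= => h; rewrite ramp_eq1.
have pl : \int[P]_t ramp (r - e) e (W m t) <= \int[P]_t \1_(W m @^-1` `]-oo, r]) t.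
  apply: le_Rintegral => //; first by apply: iW; [exact: mr|move=> x; exact: ramp_norm_le1].
  move=> t _; rewrite indicE; case: (boolP (t \in _)) => [_|]; first exact: ramp_le1.
  rewrite notin_setE/= in_itv/= => /negP; rewrite -ltNge => h.
  by rewrite ramp_eq0// subrK ltW.
exact: (arith _ _ _ _ _ _ _ _ hu hl pu pl up lo Nup Nlo).
Unshelve. all: end_near. Qed.

End quadratic_clt.

(** * Scaling of Lebesgue measure *)

Section scaling.
Context {R : realType}.
Local Notation mu := (@lebesgue_measure R).

(** Lebesgue measure is c times its image under the multiplication by c, by
    uniqueness, since both agree on intervals. *)
Lemma integral_scale1 (c : R) (f : R -> \bar R) : 0 < c ->
  measurable_fun setT f -> (forall x, 0 <= f x)%E ->
  (\int[mu]_a f (c * a)%R = c^-1%:E * \int[mu]_a f a)%E.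
Proof.
move=> c0 mf f0.
have mphi : measurable_fun setT (fun a : measurableTypeR R => c * a : measurableTypeR R).
  exact: measurable_funM.
pose push := (measure_function_pushforward__canonical__measure_function_Measure mu mphi).
pose nu : {measure set (measurableTypeR R) -> \bar R} := mscale (NngNum (ltW c0)) push.
have E A : measurable A -> mu A = nu A.
  apply: lebesgue_measure_unique => X [[x y] _ <-].
  transitivity (c%:E * mu `](x / c)%R, (y / c)%R]%classic)%E; last first.
    rewrite /nu /mscale/= /pushforward; congr (_ * mu _)%E.
    apply/seteqP; split => a /=; rewrite !in_itv/= ltr_pdivrMr// ler_pdivlMr//;
    by rewrite mulrC.
  rewrite !lebesgue_measure_itv/= !lte_fin ltr_pM2r ?invr_gt0//.
  case: ifP => _; last by rewrite mule0.
  by rewrite -!EFinD -EFinM; congr EFin; field; rewrite gt_eqF.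
have -> : (\int[mu]_a f a = c%:E * \int[mu]_a f (c * a)%R)%E.
  transitivity (\int[nu]_a f a)%E; first by apply: eq_measure_integral => A mA _; exact: E.
  rewrite ge0_integral_mscale//=; congr (_ * _)%E.
  by rewrite ge0_integral_pushforward.
by rewrite muleA -EFinM mulVf ?mul1e// gt_eqF.
Qed.

Lemma euclidS_tonelli n (f : euclid R n.+1 -> \bar R) :
  measurable_fun setT f -> (forall x, 0 <= f x)%E ->
  (\int[lebesgue_euclid n.+1]_x f x =
   \int[mu]_a \int[lebesgue_euclid n]_x f (cons_pair (a, x)))%E.
Proof.
move=> mf f0.
transitivity (\int[mu \x lebesgue_euclid n]_z f (cons_pair z))%E.
  pose push := (measure_function_pushforward__canonical__measure_function_Measure
     (mu \x lebesgue_euclid n)%E (@measurable_cons_pair R n)).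
  transitivity (\int[push]_x f x)%E; first by apply: eq_measure_integral.
  by rewrite ge0_integral_pushforward.
rewrite fubini_tonelli1//.
by apply: measurableT_comp (@measurable_cons_pair R n).
Qed.

Definition scalet n (c : R) (x : euclid R n) : euclid R n := [tuple c * tnth x i | i < n].

Lemma scalet_cons n (c : R) (z : measurableTypeR R * euclid R n) :
  scalet c (cons_pair z) = cons_pair (c * z.1, scalet c z.2).
Proof.
apply: eq_from_tnth => j; rewrite tnth_mktuple.
case: (unliftP ord0 j) => [k|] ->; last by rewrite !tnth_cons_pair0.
by rewrite !tnth_cons_pairS tnth_mktuple.
Qed.

Lemma measurable_scalet n (c : R) : measurable_fun setT (@scalet n c).
Proof.
apply/measurable_fun_tnthP => i.
rewrite (_ : _ \o _ = fun x => c * tnth x i).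
  by apply: measurable_funM => //; exact: measurable_coord.
by apply/funext => x /=; rewrite tnth_mktuple.
Qed.

Lemma integral_scale n (c : R) (f : euclid R n -> \bar R) : 0 < c ->
  measurable_fun setT f -> (forall x, 0 <= f x)%E ->
  (\int[lebesgue_euclid n]_x f (scalet c x) =
   (c ^- n)%:E * \int[lebesgue_euclid n]_x f x)%E.
Proof.
move=> c0; elim: n f => [|n IH] f mf f0.
  rewrite expr0 invr1 mul1e; apply: eq_integral => x _; congr f.
  by apply: eq_from_tnth => -[].
have mfs : measurable_fun setT (fun x => f (scalet c x)).
  by apply: measurableT_comp (@measurable_scalet n.+1 c).
have mf2 : measurable_fun setT (f \o (@cons_pair R n)).
  by apply: measurableT_comp (@measurable_cons_pair R n).
rewrite !euclidS_tonelli//.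
under eq_integral => a _.
  under eq_integral do rewrite scalet_cons/=.
  rewrite (IH (fun x => f (cons_pair (c * a, x))))//; last first.
    by apply: measurableT_comp (@measurable_consr R n _).
  over.
have mF : measurable_fun setT (fun a => \int[lebesgue_euclid n]_x f (cons_pair (a, x)))%E.
  by apply: (@measurable_fun_fubini_tonelli_F _ _ _ _ _ (lebesgue_euclid n) _ mf2) => z; exact: f0.
have mF2 : measurable_fun setT (fun a : R => \int[lebesgue_euclid n]_x f (cons_pair ((c * a)%R, x)))%E.
  by apply: (measurableT_comp mF); exact: measurable_funM.
have ci0 : (0 <= (c ^- n)%:E :> \bar R)%E by rewrite lee_fin invr_ge0 exprn_ge0// ltW.
have F0 (a : R) : setT a -> (0 <= \int[lebesgue_euclid n]_x f (cons_pair ((c * a)%R, x)))%E.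
  by move=> _; apply: integral_ge0.
rewrite ge0_integralZl; first last.
- exact: ci0.
- exact: F0.
- exact: mF2.
- exact: measurableT.
rewrite (integral_scale1 c0 mF); last by move=> a; apply: integral_ge0.
by rewrite muleA -EFinM exprSr invfM.
Qed.

End scaling.

(** * Radial functions *)

Section enorm_theory.
Context {R : realType} {d : nat}.
Implicit Types x : euclid R d.

Lemma dotp_ge0 x : 0 <= dotp x x.
Proof. by apply: sumr_ge0 => i _; rewrite -expr2 sqr_ge0. Qed.

Lemma enorm_ge0 x : 0 <= enorm x. Proof. exact: sqrtr_ge0. Qed.

Lemma enorm_scale (c : R) x : 0 <= c -> enorm (scalet c x) = c * enorm x.
Proof.
move=> c0; rewrite /enorm (_ : dotp _ _ = c ^+ 2 * dotp x x).
  by rewrite sqrtrM ?sqr_ge0// sqrtr_sqr ger0_norm.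
by rewrite /dotp mulr_sumr; apply: eq_bigr => i _; rewrite !tnth_mktuple; ring.
Qed.

Lemma coord_le_enorm x i : `|tnth x i| <= enorm x.
Proof.
rewrite -sqrtr_sqr /enorm ler_sqrt ?dotp_ge0// /dotp (bigD1 i)//= -expr2 lerDl.
by apply: sumr_ge0 => j _; rewrite -expr2 sqr_ge0.
Qed.

Lemma enorm_le_sum x : enorm x <= \sum_i `|tnth x i|.
Proof.
have s0 : 0 <= \sum_i `|tnth x i| by apply: sumr_ge0.
rewrite -(ger0_norm s0) -sqrtr_sqr /enorm ler_sqrt ?sqr_ge0//.
rewrite /dotp expr2 mulr_suml; apply: ler_sum => i _.
apply: (@le_trans _ _ (`|tnth x i| * `|tnth x i|)).
  by rewrite -normrM ler_norm.
by rewrite ler_wpM2l// (bigD1 i)//= lerDl sumr_ge0.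
Qed.

Lemma measurable_enorm : measurable_fun setT (@enorm R d).
Proof.
apply: (measurableT_comp (continuous_measurable_fun (@sqrt_continuous R))).
apply: measurable_sum => i; apply: measurable_funM; exact: measurable_coord.
Qed.

Lemma measurable_radial (F : R -> R) : measurable_fun setT F ->
  measurable_fun setT (fun x => F (enorm x)).
Proof. by move=> mF; apply: measurableT_comp measurable_enorm. Qed.

Lemma radial_scale (c : R) (F : R -> R) : 0 < c -> measurable_fun setT F ->
  (forall r, 0 <= F r) ->
  (\int[lebesgue_euclid d]_x (F (c * enorm x))%:E =
   (c ^- d)%:E * \int[lebesgue_euclid d]_x (F (enorm x))%:E)%E.
Proof.
move=> c0 mF F0; rewrite -(@integral_scale R d c (fun x => (F (enorm x))%:E))//.
- by apply: eq_integral => x _; rewrite enorm_scale// ltW.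
- by apply/measurable_EFinP; exact: measurable_radial.
- by move=> x; rewrite lee_fin.
Qed.

(** The ball is contained in a cube. *)
Lemma unit_ball_finite : (lebesgue_euclid d [set x : euclid R d | (enorm x <= 1)%R] < +oo)%E.
Proof.
apply: (@le_lt_trans _ _ (lebesgue_euclid d [set x | forall i, (`[-1, 1]%classic : set R) (tnth x i)])).
  apply: le_measure; rewrite ?inE.
  - rewrite (_ : [set x | _] = (@enorm R d) @^-1` `]-oo, 1]%classic).
      by rewrite -[X in measurable X]setTI; apply: measurable_enorm.
    by apply/seteqP; split => x /=; rewrite in_itv.
  - rewrite (_ : [set x | _] =
      \bigcap_(i in [set: 'I_d]) (fun x => tnth x i) @^-1` (`[-1, 1]%classic : set R)).
      apply: fin_bigcap_measurable; [exact: finite_finset|move=> i _].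
      by rewrite -[X in measurable X]setTI; apply: measurable_tnth.
    by apply/seteqP; split => x /= H i; [move=> _; exact: H|exact: (H i I)].
  - move=> x /= x1 i; rewrite in_itv/= -ler_norml.
    exact: le_trans (coord_le_enorm x i) x1.
rewrite (@lebesgue_euclid_box R d (fun=> `[-1, 1]%classic))//.
rewrite (eq_bigr (fun=> 2%:E)).
  by rewrite prodEFin ltry.
move=> i _; have h : (-1 : R) < 1 by lra.
by rewrite lebesgue_measure_itv/= lte_fin h -EFinD; congr EFin; lra.
Qed.

End enorm_theory.

(** * Integrability of radial powers *)

Section radial_integrability.
Context {R : realType}.
Variables (d : nat) (beta : R).
Hypotheses (b0 : 0 < beta) (b2 : beta < 2) (bd : beta < d%:R).

Let w (r : R) := r `^ (beta - d%:R - 2).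
Let p (r : R) := Num.min 1 (r ^+ 2) * w r.

Let w0 : w 0 = 0.
Proof.
rewrite /w powR0//; move: bd; move: (d%:R : R) => D bD.
by rewrite lt_eqF//; lra.
Qed.

Lemma powRVr (x e : R) : 0 <= x -> x^-1 `^ e = x `^ (- e).
Proof. by move=> x0; rewrite -powR_inv1// -powRrM mulN1r. Qed.

Lemma powR_exprn (x e : R) (n : nat) : 0 <= x -> (x `^ e) ^+ n = (x ^+ n) `^ e.
Proof.
by move=> x0; rewrite -powR_mulrn ?powR_ge0// -powRrM mulrC powRrM powR_mulrn.
Qed.

Lemma dyadic_small (r : R) : 0 < r -> r <= 1 ->
  exists k : nat, 2 ^- k.+1 < r <= 2 ^- k.
Proof.
move=> r0 r1.
have ex : exists n, 2 ^- n.+1 < r.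
  have [N _ h] : \forall n \near \oo, 2 ^- n < r.
    have : (2^-1 : R) ^+ n @[n --> \oo] --> 0.
      by apply: cvg_expr; rewrite ger0_norm// invf_lt1// ltr1n.
    move=> /cvgrPdist_lt/(_ _ r0); apply: filterS => n.
    by rewrite sub0r normrN ger0_norm ?exprn_ge0// exprVn.
  by exists N; apply: h => /=.
case: (ex_minnP ex) => -[|k] hk kmin; first by exists 0%N; rewrite hk expr0 invr1.
exists k.+1; rewrite hk/= leNgt; apply/negP => h.
by have := kmin k h; rewrite ltnn.
Qed.

Lemma dyadic_large (r : R) : 1 <= r -> exists k : nat, 2 ^+ k <= r <= 2 ^+ k.+1.
Proof.
move=> r1; have ex : exists n, r <= 2 ^+ n.+1.
  have r0 : 0 < r by exact: lt_le_trans r1.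
  have ri0 : 0 < r^-1 by rewrite invr_gt0.
  have ri1 : r^-1 <= 1 by rewrite invf_le1.
  have [k /andP[h1 _]] := dyadic_small ri0 ri1.
  by exists k; rewrite -lef_pV2 ?posrE ?exprn_gt0// ltW.
case: (ex_minnP ex) => -[|k] hk kmin; first by exists 0%N; rewrite expr0 r1.
exists k.+1; rewrite hk andbT leNgt; apply/negP => h.
by have := kmin k (ltW h); rewrite ltnn.
Qed.

(** Majorants of p on the shells ]2^-(k+1), 2^-k] and [2^k, 2^(k+1)]; indicators
    of whole balls, so that scaling computes their integrals. *)
Let u k (r : R) : R := 2 `^ (d%:R - beta) * (2 `^ (d%:R - beta)) ^+ k * \1_(`]-oo, 1]%classic : set R) (2 ^+ k * r).
Let v k (r : R) : R := (2 `^ (beta - d%:R - 2)) ^+ k * \1_(`]-oo, 1]%classic : set R) (2 ^- k.+1 * r).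

Let u0 k r : 0 <= u k r.
Proof. by rewrite /u !mulr_ge0 ?exprn_ge0 ?powR_ge0. Qed.
Let v0 k r : 0 <= v k r.
Proof. by rewrite /v !mulr_ge0 ?exprn_ge0 ?powR_ge0. Qed.

Lemma dyadic_bound (r : R) : 0 <= r -> exists k, p r <= u k r + v k r.
Proof.
rewrite le_eqVlt => /predU1P[<-|r0].
  by exists 0%N; rewrite /p w0 mulr0 addr_ge0.
have [r1|r1] := leP r 1.
  have [k /andP[k1 k2]] := dyadic_small r0 r1; exists k.
  apply: (@le_trans _ _ (u k r)); last by rewrite lerDl.
  have -> : p r = r `^ (beta - d%:R).
    rewrite /p min_r; last by rewrite expr_le1// ltW.
    rewrite /w -powR_mulrn ?ltW// -powRD; last by apply/implyP => _; rewrite gt_eqF.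
    by congr (_ `^ _); ring.
  rewrite /u indicE mem_set ?mulr1/=; last first.
    by rewrite in_itv/= mulrC -ler_pdivlMr ?exprn_gt0// mul1r.
  rewrite -exprS powR_exprn// -(opprB d%:R beta) -powRVr ?(ltW r0)//.
  apply: ge0_ler_powR; rewrite ?nnegrE ?invr_ge0 ?exprn_ge0 ?(ltW r0) ?subr_ge0 ?(ltW bd)//.
  by rewrite -[leRHS]invrK lef_pV2 ?posrE ?invr_gt0 ?exprn_gt0// ltW.
have [k /andP[k1 k2]] := dyadic_large (ltW r1); exists k.
apply: (@le_trans _ _ (v k r)); last by rewrite lerDr.
have -> : p r = w r.
  by rewrite /p min_l ?mul1r// expr_ge1// ltW.
rewrite /v indicE mem_set ?mulr1/=; last first.
  by rewrite in_itv/= ler_pdivrMl ?exprn_gt0// mulr1.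
have -> : beta - d%:R - 2 = - (d%:R + 2 - beta) by ring.
rewrite powR_exprn// /w (_ : beta - d%:R - 2 = - (d%:R + 2 - beta)); last by ring.
rewrite !powRN lef_pV2 ?posrE ?powR_gt0 ?exprn_gt0//.
apply: ge0_ler_powR; rewrite ?nnegrE ?exprn_ge0 ?(ltW r0)//.
by move: b2 bd; move: (d%:R : R) => D bD; lra.
Qed.

Lemma nneseries_geometric_lty (C z : R) : 0 <= C -> 0 <= z < 1 ->
  (\sum_(k <oo) (C * z ^+ k)%:E < +oo)%E.
Proof.
move=> C0 /andP[z0 z1].
apply: (@le_lt_trans _ _ (C / (1 - z))%:E); last by rewrite ltry.
apply: lime_le.
  by apply: is_cvg_nneseries => n _ _; rewrite lee_fin mulr_ge0// exprn_ge0.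
apply: nearW => n; rewrite sumEFin lee_fin.
have := @geometric_seriesE R C z; rewrite lt_eqF// => /(_ isT)/(congr1 (fun f => f n)).
rewrite /series/= => ->.
rewrite ler_pM2r ?invr_gt0 ?subr_gt0// ler_piMr// lerBlDr lerDl exprn_ge0//.
Qed.

Let I1 : R -> R := \1_(`]-oo, 1]%classic : set R).
Let V := fine (\int[lebesgue_euclid d]_x (I1 (enorm x))%:E).

Let mI1 : measurable_fun setT I1. Proof. exact: measurable_indic. Qed.
Let I10 r : 0 <= I1 r. Proof. by []. Qed.

Let VE : (\int[lebesgue_euclid d]_x (I1 (enorm x))%:E = V%:E)%E.
Proof.
rewrite fineK// ge0_fin_numE; last by apply: integral_ge0 => x _; rewrite lee_fin.
apply: le_lt_trans (@unit_ball_finite R d).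
have mb : measurable [set x : euclid R d | enorm x <= 1].
  rewrite (_ : [set x | _] = (@enorm R d) @^-1` `]-oo, 1]%classic).
    by rewrite -[X in measurable X]setTI; apply: measurable_enorm.
  by apply/seteqP; split => x /=; rewrite in_itv.
rewrite (_ : lebesgue_euclid d _ = lebesgue_euclid d ([set x : euclid R d | enorm x <= 1] `&` setT)); last by rewrite setIT.
by rewrite -integral_indic.
Qed.

Let V0 : 0 <= V. Proof. by rewrite fine_ge0//; apply: integral_ge0 => x _; rewrite lee_fin. Qed.

Let mu_ k : measurable_fun setT (u k).
Proof.
apply: measurable_funM => //; apply: (measurableT_comp mI1).
exact: measurable_funM.
Qed.

Let mv_ k : measurable_fun setT (v k).
Proof.
apply: measurable_funM => //; apply: (measurableT_comp mI1).
exact: measurable_funM.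
Qed.

Lemma integral_shell_small k : (\int[lebesgue_euclid d]_x (u k (enorm x))%:E =
  (2 `^ (d%:R - beta) * V * (2 `^ (- beta)) ^+ k)%:E)%E.
Proof.
under eq_integral do rewrite /u EFinM.
rewrite ge0_integralZl//; first last.
- by apply/measurable_EFinP; apply: (measurableT_comp mI1); apply: measurable_funM => //; exact: measurable_enorm.
rewrite (radial_scale _ mI1 I10)// VE -!EFinM; congr EFin.
rewrite -[2 `^ (- beta)](_ : 2 `^ (d%:R - beta) / 2 ^+ d = _); last first.
  rewrite -powR_mulrn// -powRB; last by apply/implyP.
  by congr (_ `^ _); ring.
by rewrite exprMn exprVn -!exprM (mulnC d); ring.
Qed.

Lemma integral_shell_large k : (\int[lebesgue_euclid d]_x (v k (enorm x))%:E =
  (2 ^+ d * V * (2 `^ (beta - 2)) ^+ k)%:E)%E.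
Proof.
under eq_integral do rewrite /v EFinM.
rewrite ge0_integralZl//; first last.
- by apply/measurable_EFinP; apply: (measurableT_comp mI1); apply: measurable_funM => //; exact: measurable_enorm.
rewrite (radial_scale _ mI1 I10)// VE -!EFinM; congr EFin.
rewrite -[2 `^ (beta - 2)](_ : 2 `^ (beta - d%:R - 2) * 2 ^+ d = _); last first.
  rewrite -powR_mulrn// -powRD; last by apply/implyP.
  by congr (_ `^ _); ring.
rewrite exprMn exprVn invrK -!exprM mulSn exprD (mulnC k); ring.
Qed.

Let mp : measurable_fun setT p.
Proof.
apply: measurable_funM; first by apply: measurable_minr => //; exact: measurable_funX.
exact: measurable_powR.
Qed.

(** Compare with a series over dyadic shells. On the shells near 0 the
    integrand behaves as r^(beta-d), at infinity as r^(beta-d-2); by scaling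
    the shell of radius 2^-k contributes 2^(-k beta) and that of radius 2^k
    contributes 2^(-k(2-beta)), up to constants. *)
Lemma radial_weight_integrable :
  (lebesgue_euclid d).-integrable setT (EFin \o (fun x => p (enorm x))).
Proof.
have p0 r : 0 <= p r by rewrite mulr_ge0 ?powR_ge0// le_min ler01 sqr_ge0.
apply/integrableP; split; first by apply/measurable_EFinP; exact: (measurable_radial mp).
under eq_integral do rewrite /= ger0_norm//.
apply: (@le_lt_trans _ _ (\int[lebesgue_euclid d]_x \sum_(k <oo) ((u k (enorm x))%:E + (v k (enorm x))%:E))%E).
  apply: ge0_le_integral => //.
  - by move=> x _; rewrite lee_fin.
  - by apply/measurable_EFinP; exact: measurable_radial.
  - apply: ge0_emeasurable_sum => k *; first by rewrite -EFinD lee_fin addr_ge0.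
    by apply: emeasurable_funD; apply/measurable_EFinP; exact: measurable_radial.
  - move=> x _; have [k hk] := dyadic_bound (enorm_ge0 x).
    have nn n : (0 <= (u n (enorm x))%:E + (v n (enorm x))%:E)%E by rewrite -EFinD lee_fin addr_ge0.
    apply: (@le_trans _ _ (\sum_(0 <= i < k.+1) ((u i (enorm x))%:E + (v i (enorm x))%:E))%E).
      rewrite big_nat_recr//=; apply: (@le_trans _ _ ((u k (enorm x))%:E + (v k (enorm x))%:E)%E).
        by rewrite -EFinD lee_fin.
      by rewrite leeDr// sume_ge0.
    by apply: nneseries_lim_ge.
rewrite integral_nneseries//; first last.
- by move=> n x _; rewrite -EFinD lee_fin addr_ge0.
- by move=> n; apply: emeasurable_funD; apply/measurable_EFinP; exact: measurable_radial.
under eq_eseriesr => k _.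
  rewrite ge0_integralD//; first last.
  + by apply/measurable_EFinP; exact: measurable_radial.
  + by move=> x _; rewrite lee_fin.
  + by apply/measurable_EFinP; exact: measurable_radial.
  + by move=> x _; rewrite lee_fin.
  rewrite integral_shell_small integral_shell_large.
  over.
rewrite nneseriesD; first last.
- by move=> k _ _; rewrite lee_fin !mulr_ge0 ?exprn_ge0 ?powR_ge0.
- by move=> k _ _; rewrite lee_fin !mulr_ge0 ?exprn_ge0 ?powR_ge0.
have lt1 (e : R) : e < 0 -> 0 <= (2 : R) `^ e < 1.
  move=> e0; rewrite powR_ge0/= -(opprK e) powRN invf_lt1 ?powR_gt0//.
  rewrite /powR ifF; last by rewrite gt_eqF.
  by rewrite expR_gt1 mulr_gt0 ?oppr_gt0// ln_gt0// ltr1n.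
rewrite lte_add_pinfty//; apply: nneseries_geometric_lty.
- by rewrite mulr_ge0 ?powR_ge0.
- by apply: lt1; rewrite oppr_lt0.
- by rewrite mulr_ge0 ?exprn_ge0.
- by apply: lt1; rewrite subr_lt0.
Qed.

End radial_integrability.

(** * Radial cosine integrals *)

Section radial_cosine.
Context {R : realType}.
Variables (d : nat) (beta : R).
Hypotheses (b0 : 0 < beta) (b2 : beta < 2) (bd : beta < d%:R).
Local Notation leb := (lebesgue_euclid d).
Local Notation w r := (r `^ (beta - d%:R - 2)).
Local Notation gam := (2 - beta).

(** Its integrand is nonnegative and, unlike the cosine transform of the power
    itself, absolutely integrable both at 0 and at infinity. *)
Definition cos_defect (xi : R) : R :=
  \int[leb]_x ((1 - cos (enorm x * xi)) * w (enorm x)).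

Lemma one_sub_cos_ge0 (y : R) : 0 <= 1 - cos y.
Proof. by rewrite subr_ge0 cos_le1. Qed.

Lemma one_sub_cos_le (y : R) : 1 - cos y <= Num.min 2 (y ^+ 2).
Proof.
rewrite le_min; apply/andP; split; first by have := cos_geN1 y; lra.
have := cos_taylor1 0 y; rewrite add0r cos0 sin0 mulr0 addr0.
by rewrite distrC; apply: le_trans; exact: ler_norm.
Qed.

Let mF (xi : R) : measurable_fun setT (fun r : R => (1 - cos (r * xi)) * w r).
Proof.
apply: measurable_funM; last exact: measurable_powR.
apply: measurable_funB => //.
apply: (measurableT_comp (continuous_measurable_fun (@continuous_cos R))).
exact: measurable_funM.
Qed.

Let F0 (xi r : R) : 0 <= (1 - cos (r * xi)) * w r.
Proof. by rewrite mulr_ge0 ?powR_ge0 ?one_sub_cos_ge0. Qed.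

Lemma integrable_cos_defect (xi : R) :
  leb.-integrable setT (EFin \o (fun x => (1 - cos (enorm x * xi)) * w (enorm x))).
Proof.
apply: (@integrable_le _ _ _ leb setT _
  (fun x => (2 + xi ^+ 2) * (Num.min 1 (enorm x ^+ 2) * w (enorm x)))) => //.
- exact: (measurable_radial (mF xi)).
- by apply: integrableRZ => //; exact: radial_weight_integrable.
move=> x _; rewrite ger0_norm// mulrA ler_wpM2r ?powR_ge0//.
have := one_sub_cos_le (enorm x * xi); rewrite le_min => /andP[h1 h2].
have x2 := sqr_ge0 xi; have e2 := sqr_ge0 (enorm x).
have [h|h] := leP 1 (enorm x ^+ 2).
  by rewrite mulr1; apply: (le_trans h1); rewrite lerDl.
apply: (le_trans h2); rewrite exprMn mulrC.
by rewrite ler_wpM2r// lerDr.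
Qed.

Lemma cos_defectE (xi : R) : (cos_defect xi)%:E =
  (\int[leb]_x ((1 - cos (enorm x * xi)) * w (enorm x))%:E)%E.
Proof. by rewrite /cos_defect /Rintegral fineK//; apply: integrable_fin_num => //; exact: integrable_cos_defect. Qed.

Lemma cos_defectN (xi : R) : cos_defect (- xi) = cos_defect xi.
Proof. by apply: eq_Rintegral => x _; rewrite mulrN cosN. Qed.

Lemma cos_defect0 : cos_defect 0 = 0.
Proof.
rewrite /cos_defect; transitivity (\int[leb]_x (0 : R)); last by rewrite Rintegral_cst ?mul0r.
by apply: eq_Rintegral => x _; rewrite mulr0 cos0 subrr mul0r.
Qed.

(** Substitute x -> xi x. *)
Lemma cos_defect_homogeneous (xi : R) : cos_defect xi = `|xi| `^ gam * cos_defect 1.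
Proof.
wlog xi0 : xi / 0 <= xi.
  move=> H; have [h|/ltW h] := leP 0 xi; first exact: H.
  by rewrite -cos_defectN H ?oppr_ge0// normrN.
rewrite ger0_norm//; move: xi0; rewrite le_eqVlt => /predU1P[<-|x0].
  by rewrite cos_defect0 powR0 ?mul0r// gt_eqF// subr_gt0.
have E := @radial_scale R d _ _ x0 (mF 1) (F0 1).
have E2 : ((xi `^ (beta - d%:R - 2))%:E * (cos_defect xi)%:E = (xi ^- d)%:E * (cos_defect 1)%:E)%E.
  rewrite [X in (_ * X = _)%E]cos_defectE [X in (_ = _ * X)%E]cos_defectE -E.
  rewrite -ge0_integralZl//; first last.
  - by rewrite lee_fin powR_ge0.
  - by move=> x _; rewrite lee_fin.
  - by apply/measurable_EFinP; exact: (measurable_radial (mF xi)).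
  apply: eq_integral => x _; rewrite -EFinM; congr EFin.
  by rewrite powRM ?enorm_ge0 ?(ltW x0)// mulr1 (mulrC xi); ring.
have E3 : xi `^ (beta - d%:R - 2) * cos_defect xi = xi ^- d * cos_defect 1.
  by apply: EFin_inj; rewrite !EFinM.
have wx0 : xi `^ (beta - d%:R - 2) != 0 by rewrite gt_eqF// powR_gt0.
apply: (mulfI wx0); rewrite E3 mulrA; congr (_ * _).
rewrite -powRD; last by rewrite (gt_eqF x0) implybT.
rewrite (_ : beta - d%:R - 2 + gam = - d%:R); last by ring.
by rewrite powRN powR_mulrn// ltW.
Qed.

Lemma cos_lt1 (y : R) : 0 < y <= 2 -> cos y < 1.
Proof.
move=> /andP[y0 y2]; have -> : y = y / 2 + y / 2 by lra.
have s0 : 0 < sin (y / 2).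
  by apply: sin_gt0_pi; have := @pi_ge2 R; lra.
have e := cos2Dsin2 (y / 2).
have : 0 < sin (y / 2) ^+ 2 by exact: exprn_gt0.
by rewrite cosD -!expr2; lra.
Qed.

(** The integrand is positive for 0 < |x| <= 2, in particular on the box where
    all coordinates lie in [1/d, 2/d], which has positive measure. *)
Lemma cos_defect1_gt0 : 0 < cos_defect 1.
Proof.
have c0 : 0 <= cos_defect 1 by apply: Rintegral_ge0.
rewrite lt_neqAle c0 andbT eq_sym; apply/eqP => E.
have d0 : (0 < d)%N by move: bd; case: d => //=; move/(lt_trans b0); rewrite ltxx.
have dR : 0 < d%:R :> R by rewrite ltr0n.
have mf := measurable_radial (d := d) (mF 1).
have /(ae_eq_integral_abs leb measurableT) : (\int[leb]_x `|((1 - cos (enorm x * 1)) * w (enorm x))%:E| = 0)%E.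
  under eq_integral do rewrite abse_EFin ger0_norm//.
  by rewrite -cos_defectE E.
move=> /(_ _)[]; first exact/measurable_EFinP.
move=> N [mN N0 hN].
pose box := [set x : euclid R d | forall i, (`[d%:R^-1, 2 / d%:R]%classic : set R) (tnth x i)].
have mbox : measurable box.
  rewrite (_ : box =
    \bigcap_(i in [set: 'I_d]) (fun x => tnth x i) @^-1` (`[d%:R^-1, 2 / d%:R]%classic : set R)).
    apply: fin_bigcap_measurable; [exact: finite_finset|move=> i _].
    by rewrite -[X in measurable X]setTI; apply: measurable_tnth.
  by apply/seteqP; split => x /= H i; [move=> _; exact: H|exact: (H i I)].
have sub : box `<=` N.
  move=> x bx; apply: hN => /= /(_ I)/eqP; apply/negP.
  rewrite eqe mulf_neq0// ?gt_eqF ?powR_gt0 ?subr_gt0//.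
    rewrite mulr1; apply: cos_lt1; apply/andP; split.
      apply: lt_le_trans (coord_le_enorm x (Ordinal d0)).
      have /= := bx (Ordinal d0); rewrite in_itv/= => /andP[h _].
      by apply: lt_le_trans (ler_norm _); apply: lt_le_trans h; rewrite invr_gt0.
    apply: (le_trans (enorm_le_sum x)).
    apply: (@le_trans _ _ (\sum_(i < d) (2 / d%:R : R))); last first.
      by rewrite sumr_const card_ord -[leLHS]mulr_natr divfK// gt_eqF.
    apply: ler_sum => i _; have /= := bx i; rewrite in_itv/= => /andP[h1 h2].
    by rewrite ger0_norm//; apply: le_trans h1; rewrite invr_ge0 ltW.
  apply: lt_le_trans (coord_le_enorm x (Ordinal d0)).
  have /= := bx (Ordinal d0); rewrite in_itv/= => /andP[h _].
  by apply: lt_le_trans (ler_norm _); apply: lt_le_trans h; rewrite invr_gt0.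
have : (leb box <= 0)%E by rewrite -N0; apply: le_measure; rewrite ?inE.
apply/negP; rewrite -ltNge (@lebesgue_euclid_box R d (fun=> `[d%:R^-1, 2 / d%:R]%classic))//.
rewrite (eq_bigr (fun=> (d%:R^-1)%:E)) => [|i _].
  by rewrite prodEFin lte_fin prodr_gt0// => i _; rewrite invr_gt0.
have h : (d%:R^-1 : R) < 2 / d%:R by rewrite ltr_pdivlMr// mulVf ?gt_eqF// ltr1n.
by rewrite lebesgue_measure_itv/= lte_fin h -EFinD; congr EFin; field; rewrite gt_eqF.
Qed.

Definition fourth_difference (f : R -> R) (x : R) : R :=
  f (x + 2) - 4 * f (x + 1) + 6 * f x - 4 * f (x - 1) + f (x - 2).

(** The coefficients 1, -4, 6, -4, 1 sum to zero, so that cosines may be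
    replaced by the integrable 1 - cos. *)
Lemma sin_half_pow4_cos (y xi : R) : sin (y / 2) ^+ 4 * cos (y * xi) =
  - 16^-1 * fourth_difference (fun z => 1 - cos (y * z)) xi.
Proof.
have hy : y = y / 2 + y / 2 by lra.
set h := y / 2 in hy *.
rewrite /fourth_difference.
have -> : y * (xi + 2) = y * xi + (h + h + (h + h)) by rewrite -hy; ring.
have -> : y * (xi - 2) = y * xi - (h + h + (h + h)) by rewrite -hy; ring.
have -> : y * (xi + 1) = y * xi + y by ring.
have -> : y * (xi - 1) = y * xi - y by ring.
rewrite !(cosD (y * xi)) !cosN !sinN.
have e1 : cos y = 1 - 2 * sin h ^+ 2.
  by rewrite hy cosD -!expr2; have := cos2Dsin2 h; lra.
have e2 : cos (h + h + (h + h)) = 1 - 8 * sin h ^+ 2 + 8 * sin h ^+ 4.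
  rewrite -hy cosD -!expr2; have := cos2Dsin2 y; rewrite e1 => e3.
  have -> : sin y ^+ 2 = 1 - (1 - 2 * sin h ^+ 2) ^+ 2 by apply/eqP; rewrite eq_sym subr_eq addrC e3.
  ring.
by rewrite e2 e1; field.
Qed.

(** By sin_half_pow4_cos and homogeneity, a fourth difference of a pure power:
    this is where the constants of the theorem and the covariance of the
    increments meet. *)
Lemma cosine_transform_g_teE (xi : R) : cosine_transform (@g_te R d beta) xi =
  - 16^-1 * cos_defect 1 * fourth_difference (fun z => `|z| `^ gam) xi.
Proof.
rewrite /cosine_transform.
transitivity (\int[leb]_x (- 16^-1 * fourth_difference (fun z => (1 - cos (enorm x * z)) * w (enorm x)) xi)).
  by apply: eq_Rintegral => x _; rewrite /g_te mulrAC sin_half_pow4_cos /fourth_difference; ring.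
have i := integrable_cos_defect.
have iz (c xi : R) := integrableRZ c measurableT (i xi).
rewrite /fourth_difference RintegralZl//; last first.
  do 2! (apply: integrableRD => //; apply: integrableRB => //).
have i1 := integrableRB measurableT (i (xi + 2)) (iz 4 (xi + 1)).
have i2 := integrableRD measurableT i1 (iz 6 xi).
have i3 := integrableRB measurableT i2 (iz 4 (xi - 1)).
rewrite RintegralD// RintegralB// RintegralD// RintegralB//.
rewrite !RintegralZl// -!/(cos_defect _) !(cos_defect_homogeneous (_ + _)) (cos_defect_homogeneous xi); ring.
Qed.

(** g_te is nonnegative. *)
Lemma Lnorm_g_te : fine (Lnorm leb 1 (EFin \o (@g_te R d beta))) =
  cosine_transform (@g_te R d beta) 0.
Proof.
rewrite Lnorm1 /cosine_transform /Rintegral; congr fine.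
apply: eq_integral => x _; rewrite mulr0 cos0 mulr1 /= ger0_norm//.
by rewrite mulr_ge0 ?powR_ge0// -[4%N]/(2 * 2)%N exprM sqr_ge0.
Qed.

(** The product-to-sum formula turns the product of the two sines into a
    difference of two terms of the form 1 - cos, each integrable by itself. *)
Lemma integral_wave_symbol (theta p q : R) : 0 < theta ->
  \int[leb]_x (wave_symbol theta p (enorm x) * wave_symbol theta q (enorm x) *
     enorm x `^ (beta - d%:R)) =
  theta `^ (- (beta / 2)) * cos_defect 1 / 2 * (`|p + q| `^ gam - `|p - q| `^ gam).
Proof.
move=> t0; set c := Num.sqrt theta.
have c0 : 0 < c by rewrite sqrtr_gt0.
have cE : theta `^ (- (beta / 2)) = c ^- 2 * c `^ gam.
  rewrite /c -powR12_sqrt ?(ltW t0)// -powR_mulrn ?powR_ge0// -!powRrM -powRN -powRD.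
    by congr (_ `^ _); field.
  by rewrite (gt_eqF t0) implybT.
have i := integrable_cos_defect.
transitivity (\int[leb]_x ((c ^- 2 / 2) * ((1 - cos (enorm x * (c * (p + q)))) * w (enorm x) -
    (1 - cos (enorm x * (c * (p - q)))) * w (enorm x)))).
  apply: eq_Rintegral => x _; rewrite /wave_symbol -/c.
  have := enorm_ge0 x; move: (enorm x) => r.
  rewrite le_eqVlt => /predU1P[<-|r0]; first by rewrite !mul0r !mulr0 sin0 cos0 !mul0r subrr; ring.
  have -> : r `^ (beta - d%:R) = w r * r ^+ 2.
    rewrite -powR_mulrn ?(ltW r0)// -powRD ?subrK//.
    by rewrite (gt_eqF r0) implybT.
  have -> : r * (c * (p + q)) = p * c * r + q * c * r by ring.
  have -> : r * (c * (p - q)) = p * c * r - q * c * r by ring.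
  rewrite cosD cosB; field.
  by rewrite !gt_eqF.
rewrite RintegralZl//; last exact: integrableRB.
rewrite RintegralB// -!/(cos_defect _) !(cos_defect_homogeneous (_ * _)) !normrM (gtr0_norm c0).
by rewrite !powRM ?(ltW c0)// cE; ring.
Qed.

End radial_cosine.

(** * Integrals of powers *)

Section power_integral.
Context {R : realType}.
Local Notation mu := (@lebesgue_measure R).

Lemma is_derive_abs_powR (a : R) (x : R) : 0 < x ->
  is_derive x 1 (fun z : R => `|z| `^ a) (a * x `^ (a - 1)).
Proof.
move=> x0; apply: (@near_eq_is_derive _ _ _ (@powR R ^~ a)).
  near=> z; rewrite ger0_norm//; near: z.
  by apply: filterS (lt_nbhsr x0) => z /ltW.
exact: is_derive1_powR.
Unshelve. all: by end_near. Qed.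

Lemma continuous_abs_powR (a : R) : 0 < a -> continuous (fun z : R => `|z| `^ a).
Proof.
move=> a0 x; have [->|x0] := eqVneq x 0; last first.
  have ax : 0 < `|x| by rewrite normr_gt0.
  have : {for `|x|, continuous (@powR R ^~ a)}.
    apply: differentiable_continuous; apply/derivable1_diffP.
    by case: (is_derive1_powR a ax).
  have cn : {for x, continuous (fun z : R => `|z|)} by exact: norm_continuous.
  by move=> h; exact: (@continuous_comp _ _ _ (fun z : R => `|z|) (@powR R ^~ a) x cn h).
rewrite /prop_for /continuous_at normr0 powR0 ?gt_eqF//.
apply/cvgrPdist_lt => e e0.
have : \forall y \near (0 : R), `|y| < e `^ a^-1.
  have h : 0 < e `^ a^-1 by exact: powR_gt0.
  have := @nbhs0_lt R R _ h; exact.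
apply: filterS => y ye; rewrite sub0r normrN ger0_norm ?powR_ge0//.
have an0 : a != 0 by rewrite gt_eqF.
rewrite -[ltRHS](powRr1 (ltW e0)) -(mulVf an0) powRrM.
by apply: gt0_ltr_powR; rewrite ?nnegrE ?powR_ge0.
Qed.

(** At the right end the base T - 2 r may vanish, so the primitive is only
    differentiated on the open interval. *)
Lemma integral_powR_affine (T m a : R) : 0 <= m -> 2 * m <= T -> 0 < a ->
  \int[mu]_(r in `[0, m]%classic) (`|T - 2 * r| `^ a) =
  (`|T| `^ (a + 1) - `|T - 2 * m| `^ (a + 1)) / (2 * (a + 1)).
Proof.
rewrite le_eqVlt => /predU1P[<-|m0] mT a0.
  by rewrite set_itv1 Rintegral_set1 mulr0 subr0 subrr mul0r.
have a10 : 0 < a + 1 by exact: addr_gt0.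
have ca (r : R) : {for r, continuous (fun r : R => T - 2 * r)}.
  apply: continuousB; first exact: cst_continuous.
  by apply: continuousM => //; exact: cst_continuous.
pose F (r : R) : R := - `|T - 2 * r| `^ (a + 1) / (2 * (a + 1)).
have cT b (r : R) : 0 < b -> {for r, continuous (fun r : R => `|T - 2 * r| `^ b)}.
  move=> b0; apply: (@continuous_comp _ _ _ (fun r : R => T - 2 * r) (fun z : R => `|z| `^ b) r (ca r)).
  exact: continuous_abs_powR.
have cF (r : R) : {for r, continuous F}.
  apply: (@continuousM _ _ (fun r : R => - `|T - 2 * r| `^ (a + 1)) (cst (2 * (a + 1))^-1) r); last exact: cst_continuous.
  by apply: (@continuousN _ _ _ (fun r : R => `|T - 2 * r| `^ (a + 1))); exact: cT.
have dF (r : R) : r < m -> is_derive r 1 F (`|T - 2 * r| `^ a).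
  move=> rm; have p0 : 0 < T - 2 * r by lra.
  have d1 : is_derive r 1 (fun r : R => T - 2 * r) (- 2).
    by apply: is_derive_eq; rewrite /GRing.scale/=; ring.
  have d2 := @is_derive1_comp R (fun z : R => `|z| `^ (a + 1)) (fun r : R => T - 2 * r) r _ _ (is_derive_abs_powR (a + 1) p0) d1.
  have d3 : is_derive r 1 (fun r : R => (- (2 * (a + 1))^-1) * `|T - 2 * r| `^ (a + 1))
     (- (2 * (a + 1))^-1 * ((a + 1) * (T - 2 * r) `^ (a + 1 - 1) * - 2)).
    apply: is_derive_eq; rewrite /GRing.scale/=; ring.
  rewrite (_ : F = (fun r : R => (- (2 * (a + 1))^-1) * `|T - 2 * r| `^ (a + 1))).
    apply: (is_derive_eq d3); rewrite addrK gtr0_norm//; field.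
    by rewrite gt_eqF.
  by apply/funext => z; rewrite /F; ring.
rewrite /Rintegral (@continuous_FTC2 R _ F 0 m m0)//.
- by rewrite /F/= mulr0 subr0; ring.
- by apply: continuous_subspaceT => r; exact: cT.
- split.
  + by move=> r; rewrite in_itv/= => /andP[_ rm]; case: (dF r rm).
  + exact: cvg_at_right_filter (cF 0).
  + exact: cvg_at_left_filter (cF m).
- move=> r; rewrite in_itv/= => /andP[_ rm]; rewrite derive1E.
  by have d := dF r rm; rewrite derive_val.
Qed.

End power_integral.

(** * The covariance of the stochastic wave *)

Section covariance.
Context {R : realType}.
Variables (d : nat) (beta theta : R).
Hypotheses (b0 : 0 < beta) (b2 : beta < 2) (bd : beta < d%:R) (th0 : 0 < theta).
Local Notation gam := (2 - beta).

(** The term 2^-1 (t + s) |t - s|^g - 2^-1 |t - s|^(g+1) is min(t,s) |t -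
    s|^g, rewritten without min so that differences in t and s can be computed
    algebraically. *)
Definition wave_kernel (t s : R) : R :=
  `|t + s| `^ (gam + 1) / (2 * (gam + 1)) +
  (2^-1 - (2 * (gam + 1))^-1) * `|t - s| `^ (gam + 1) -
  2^-1 * ((t + s) * `|t - s| `^ gam).

Definition wave_scale : R :=
  (2 * pi) ^- d * theta `^ (- (beta / 2)) * cos_defect d beta 1 / 2.

Lemma Re_scale (a : R) (z : R[i]) : complex.Re (a%:C%C * z) = a * complex.Re z.
Proof. by case: z => x y /=; rewrite mul0r subr0. Qed.

(** The spatial points coincide, so the exponential is 1 and the inner
    integral is integral_wave_symbol at p = t - r, q = s - r. As p - q does
    not depend on r, only |t + s - 2 r|^g has to be integrated in time. *)
Lemma wave_covarianceE (x : euclid R d) (t s : R) : 0 <= t -> 0 <= s ->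
  complex.Re (wave_covariance theta beta t x s x) = wave_scale * wave_kernel t s.
Proof.
move=> t0 s0; rewrite /wave_covariance Re_scale /cRintegral/=.
have gam0 : 0 < gam by rewrite subr_gt0.
have m0 : 0 <= Num.min t s by rewrite le_min t0.
have mE : 2 * Num.min t s = t + s - `|t - s|.
  have [h|h] := leP t s; first by rewrite ler0_norm; lra.
  by rewrite ger0_norm; lra.
have mT : 2 * Num.min t s <= t + s by rewrite mE lerBlDr lerDl.
pose C := theta `^ (- (beta / 2)) * cos_defect d beta 1 / 2.
transitivity (((2 * pi) ^+ d)^-1 * \int[lebesgue_measure]_(r in `[0, Num.min t s]%classic)
   (C * (`|t + s - 2 * r| `^ gam - `|t - s| `^ gam))).
  congr (_ * _); apply: eq_Rintegral => r _.
  rewrite -(_ : (t - r) + (s - r) = t + s - 2 * r); last by ring.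
  rewrite -[in RHS](_ : (t - r) - (s - r) = t - s); last by ring.
  rewrite /C -(integral_wave_symbol b0 b2 bd _ _ th0).
  apply: eq_Rintegral => xi _.
  have -> : dotp (subt x x) xi = 0.
    by rewrite /dotp big1// => i _; rewrite tnth_mktuple subrr mul0r.
  by rewrite cos0 sin0 mul1r mul0r subr0.
have ci : lebesgue_measure.-integrable `[0, Num.min t s]%classic
    (EFin \o (fun r : R => `|t + s - 2 * r| `^ gam)).
  apply: continuous_compact_integrable; first exact: segment_compact.
  apply: continuous_subspaceT => r.
  apply: (@continuous_comp _ _ _ (fun r : R => t + s - 2 * r) (fun z : R => `|z| `^ gam)); last exact: continuous_abs_powR.
  apply: continuousB; first exact: cst_continuous.
  by apply: continuousM => //; exact: cst_continuous.
have cc : lebesgue_measure.-integrable `[0, Num.min t s]%classic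
    (EFin \o (fun r : R => `|t - s| `^ gam)).
  apply: continuous_compact_integrable; first exact: segment_compact.
  by apply: continuous_subspaceT => r; exact: cst_continuous.
rewrite RintegralZl//; last exact: integrableRB.
rewrite RintegralB// integral_powR_affine// Rintegral_cst//.
rewrite mE subKr normr_id.
have -> : fine (@lebesgue_measure R `[0, Num.min t s]%classic) = (t + s - `|t - s|) / 2.
  rewrite -mE lebesgue_measure_itv/= lte_fin; case: ifPn => [h|]; first by rewrite -EFinB/=; lra.
  by rewrite -leNgt => h; have mz : Num.min t s = 0 by [apply/eqP; rewrite eq_le h m0]; rewrite mz mulr0 mul0r.
rewrite /wave_scale /wave_kernel /C.
have -> : `|t - s| `^ (gam + 1) = `|t - s| * `|t - s| `^ gam.
  rewrite powRD; last by rewrite (gt_eqF (addr_gt0 gam0 ltr01)).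
  by rewrite powRr1// mulrC.
move: (_ `^ (gam + 1)) (_ `^ gam) (cos_defect d beta 1) (theta `^ _) => p q Phi th.
have gam1 : gam + 1 != 0 by rewrite gt_eqF// addr_gt0.
have piN : (2 * pi) ^- d != 0 :> R by rewrite invr_eq0 expf_neq0// gt_eqF// mulr_gt0 ?pi_gt0.
move: (gam + 1) gam1 ((2 * pi) ^- d) piN => g g0 N N0.
by field.
Qed.

(** Homogeneity is the reason why the mesh sizes may be arbitrary. *)
Lemma wave_kernel_scale (c t s : R) : 0 < c ->
  wave_kernel (c * t) (c * s) = c `^ (gam + 1) * wave_kernel t s.
Proof.
move=> c0; rewrite /wave_kernel -mulrDr -mulrBr !normrM (gtr0_norm c0) !powRM ?(ltW c0)//.
rewrite [c `^ (gam + 1)]powRD ?powRr1 ?(ltW c0)//; last by rewrite (gt_eqF c0) implybT.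
ring.
Qed.

End covariance.

(** * Linear combinations in a Gaussian process *)

Section gaussian_combination.
Context {R : realType} {disp : measure_display} {Omega : measurableType disp}.
Variable P : probability Omega R.

Lemma mul_le_sqrD (p q : R) : p * q <= p ^+ 2 + q ^+ 2.
Proof.
rewrite -subr_ge0; have -> : p ^+ 2 + q ^+ 2 - p * q = ((p - q) ^+ 2 + p ^+ 2 + q ^+ 2) / 2 by field.
by rewrite divr_ge0// !addr_ge0 ?sqr_ge0.
Qed.

Lemma integrable_mul (X Y : Omega -> R) :
  measurable_fun setT X -> measurable_fun setT Y ->
  P.-integrable setT (EFin \o (fun w => X w ^+ 2)) ->
  P.-integrable setT (EFin \o (fun w => Y w ^+ 2)) ->
  P.-integrable setT (EFin \o (fun w => X w * Y w)).
Proof.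
move=> mX mY iX iY.
apply: (@integrable_le _ _ _ P setT _ (fun w => X w ^+ 2 + Y w ^+ 2)) => //.
- exact: measurable_funM.
- exact: integrableRD.
move=> w _; rewrite normrM -[X w ^+ 2](real_normK (num_real _)) -[Y w ^+ 2](real_normK (num_real _)).
exact: mul_le_sqrD.
Qed.

Variables (I : Type) (D : set I) (X : I -> {RV P >-> R}).
Hypothesis gX : gaussian_process D X.
Hypothesis X0 : forall i, D i -> \int[P]_w X i w = 0.

(** Families indexed by a finite type instead of an initial segment of the
    integers, as the increments are naturally indexed by pairs. *)
Lemma gaussian_combination (J : finType) (i : J -> I) (a : J -> R) :
  (forall j, D (i j)) ->
  exists m v : R, 0 <= v /\
    has_law P (fun w => \sum_j a j * X (i j) w) (gaussian_law m v).
Proof.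
move=> Di.
have [m [v [v0 h]]] := gX (i := fun k : 'I_#|J| => i (enum_val k)) (fun k => a (enum_val k)) (fun k => Di _).
exists m, v; split => //.
rewrite (_ : (fun w => _) = fun w => \sum_(k < #|J|) a (enum_val k) * X (i (enum_val k)) w)//.
apply/funext => w; rewrite -(@big_enum_val _ _ _ _ J (fun j => a j * X (i j) w)).
by apply: eq_bigl => j.
Qed.

Lemma gaussian_integrable (i : I) : D i ->
  P.-integrable setT (EFin \o X i) /\
  P.-integrable setT (EFin \o (fun w => X i w ^+ 2)).
Proof.
move=> Di; have [m [v [v0 h]]] := gaussian_combination (J := 'I_1) (fun=> 1) (fun=> Di).
have E : (fun w => \sum_(j < 1) 1 * X i w) = X i.
  by apply/funext => w; rewrite big_ord1 mul1r.
rewrite E in h; by have [i1 _ i2 _ _] := gaussian_lawP (measurable_funPT (X i)) v0 h.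
Qed.

(** The combination is Gaussian and centred, so its variance is its second
    moment, which expands into covariances. *)
Lemma gaussian_combination_cos (J : finType) (i : J -> I) (a : J -> R) :
  (forall j, D (i j)) ->
  \int[P]_w cos (\sum_j a j * X (i j) w) =
  expR (- (\sum_j \sum_k a j * a k * \int[P]_w (X (i j) w * X (i k) w)) / 2).
Proof.
move=> Di; have [m [v [v0 h]]] := gaussian_combination a Di.
have mX j : measurable_fun setT (X (i j)) by exact: measurable_funPT.
have iX j : P.-integrable setT (EFin \o (X (i j))) by have [] := gaussian_integrable (Di j).
have iXX j k : P.-integrable setT (EFin \o (fun w => X (i j) w * X (i k) w)).
  by apply: integrable_mul => //; [have [] := gaussian_integrable (Di j)|have [] := gaussian_integrable (Di k)].
have mY : measurable_fun setT (fun w => \sum_j a j * X (i j) w).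
  by apply: measurable_sum => j; exact: measurable_funM.
have [_ E1 _ E2 Ec] := gaussian_lawP mY v0 h.
have m0 : m = 0.
  rewrite -E1 Rintegral_sum// => [|j]; last exact: integrableRZ.
  by apply: big1 => j _; rewrite RintegralZl// X0// mulr0.
rewrite (Ec m0) -[v in LHS](_ : m ^+ 2 + v = v); last by rewrite m0 expr0n add0r.
rewrite -E2; congr (expR (- _ / 2)).
transitivity (\int[P]_w (\sum_j \sum_k a j * a k * (X (i j) w * X (i k) w))).
  apply: eq_Rintegral => w _; rewrite expr2 mulr_suml; apply: eq_bigr => j _.
  by rewrite mulr_sumr; apply: eq_bigr => k _; ring.
rewrite Rintegral_sum// => [|j]; last first.
  by apply: integrable_Rsum => // k; exact: integrableRZ.
apply: eq_bigr => j _; rewrite Rintegral_sum// => [|k]; last exact: integrableRZ.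
by apply: eq_bigr => k _; rewrite RintegralZl.
Qed.

End gaussian_combination.

(** * Covariance of second-order increments *)

Section increments.
Context {R : realType}.
Variables (d : nat) (beta theta : R).
Hypotheses (b0 : 0 < beta) (b2 : beta < 2) (bd : beta < d%:R) (th0 : 0 < theta).
Context {disp : measure_display} {Omega : measurableType disp}.
Variables (P : probability Omega R) (u : R -> euclid R d -> {RV P >-> R}).
Hypothesis hu : wave_solution theta beta u.
Local Notation gam := (2 - beta).

Lemma wave_solution_covariance (x : euclid R d) (t s : R) : 0 <= t -> 0 <= s ->
  \int[P]_w (u t x w * u s x w) = wave_scale d beta theta * wave_kernel beta t s.
Proof.
move=> t0 s0; rewrite -(wave_covarianceE b0 b2 bd th0 x t0 s0).
have [_ _ /(_ t x s x t0 s0) <-] := hu.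
by rewrite unlock.
Qed.

(** Covariance of the second differences, with unit spacing, of a process with
    covariance wave_kernel. *)
Definition increment_covariance (i j : R) : R :=
  fourth_difference (fun z => `|z| `^ (gam + 1)) (i + j) / (2 * (gam + 1)) +
  (2^-1 - (2 * (gam + 1))^-1) * fourth_difference (fun z => `|z| `^ (gam + 1)) (i - j) -
  2^-1 * ((i + j) * fourth_difference (fun z => `|z| `^ gam) (i - j)).

Definition second_difference (f : R -> R) (x : R) : R := f (x + 1) - 2 * f x + f (x - 1).

Lemma second_difference_add (h : R -> R) (i j : R) :
  second_difference (fun a => second_difference (fun b => h (a + b)) j) i =
  fourth_difference h (i + j).
Proof.
rewrite /second_difference /fourth_difference.
have -> : i + 1 + (j + 1) = i + j + 2 by ring.
have -> : i + 1 + j = i + j + 1 by ring.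
have -> : i + (j + 1) = i + j + 1 by ring.
have -> : i + 1 + (j - 1) = i + j by ring.
have -> : i - 1 + (j + 1) = i + j by ring.
have -> : i + (j - 1) = i + j - 1 by ring.
have -> : i - 1 + j = i + j - 1 by ring.
have -> : i - 1 + (j - 1) = i + j - 2 by ring.
ring.
Qed.

Lemma second_difference_sub (h : R -> R) (i j : R) :
  second_difference (fun a => second_difference (fun b => h (a - b)) j) i =
  fourth_difference h (i - j).
Proof.
rewrite /second_difference /fourth_difference.
have -> : i + 1 - (j + 1) = i - j by ring.
have -> : i + 1 - (j - 1) = i - j + 2 by ring.
have -> : i + 1 - j = i - j + 1 by ring.
have -> : i - (j + 1) = i - j - 1 by ring.
have -> : i - (j - 1) = i - j + 1 by ring.
have -> : i - 1 - (j + 1) = i - j - 2 by ring.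
have -> : i - 1 - (j - 1) = i - j by ring.
have -> : i - 1 - j = i - j - 1 by ring.
ring.
Qed.

(** No lower-order term appears: the shifts e of a and f of b contribute (e +
    f) h(i - j + e - f), and exchanging (e, f) with (-f, -e) shows that these
    terms cancel. *)
Lemma second_difference_add_mul_sub (h : R -> R) (i j : R) :
  second_difference (fun a => second_difference (fun b => (a + b) * h (a - b)) j) i =
  (i + j) * fourth_difference h (i - j).
Proof.
rewrite /second_difference /fourth_difference.
have -> : i + 1 - (j + 1) = i - j by ring.
have -> : i + 1 - (j - 1) = i - j + 2 by ring.
have -> : i + 1 - j = i - j + 1 by ring.
have -> : i - (j + 1) = i - j - 1 by ring.
have -> : i - (j - 1) = i - j + 1 by ring.
have -> : i - 1 - (j + 1) = i - j - 2 by ring.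
have -> : i - 1 - (j - 1) = i - j by ring.
have -> : i - 1 - j = i - j - 1 by ring.
ring.
Qed.

Lemma second_difference_wave_kernel (i j : R) :
  second_difference (fun a => second_difference (wave_kernel beta a) j) i =
  increment_covariance i j.
Proof.
have bilinear (p q r : R -> R -> R) (c1 c2 c3 : R) :
    second_difference (fun a => second_difference (fun b => p a b / c1 + c2 * q a b - c3 * r a b) j) i =
    second_difference (fun a => second_difference (p a) j) i / c1 +
    c2 * second_difference (fun a => second_difference (q a) j) i -
    c3 * second_difference (fun a => second_difference (r a) j) i.
  by rewrite /second_difference; ring.
rewrite /increment_covariance -second_difference_add -second_difference_sub.
rewrite -second_difference_add_mul_sub -bilinear; exact: erefl.
Qed.

Let b (e : 'I_3) : R := if e == 1 :> nat then - 2 else 1.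

(** Each increment is a combination of three values of u, so a combination of
    increments is one of values of u indexed by pairs in I_m x I_3. *)
Lemma increment_cos (x : euclid R d) (delta : R) (m : nat) (z : 'I_m -> R) : 0 < delta ->
  \int[P]_w cos (\sum_i z i * increment_te u delta x i.+1 w) =
  expR (- (\sum_i \sum_j z i * (wave_scale d beta theta * delta `^ (gam + 1) *
      increment_covariance i.+1%:R (j : 'I_m).+1%:R) * z j) / 2).
Proof.
move=> d0; have [gX X0 _] := hu.
pose D := [set p : R * euclid R d | 0 <= p.1].
pose T (p : 'I_m * 'I_3) : R * euclid R d := (delta * (p.1 + p.2)%:R, x).
have T0 p : D (T p) by rewrite /D/= mulr_ge0// ltW.
have Z p : D p -> \int[P]_w u p.1 p.2 w = 0.
  by move=> Dp; have := X0 p.1 p.2 Dp; rewrite unlock /Rintegral => ->.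
have := gaussian_combination_cos gX Z (fun p : 'I_m * 'I_3 => z p.1 * b p.2) T0.
have -> : (fun w => cos (\sum_(p : 'I_m * 'I_3) z p.1 * b p.2 * u (T p).1 (T p).2 w)) =
    (fun w => cos (\sum_i z i * increment_te u delta x i.+1 w)).
  apply/funext => w; congr cos.
  rewrite -(pair_bigA _ (fun i e => z i * b e * u (delta * (i + e)%:R) x w))/=.
  apply: eq_bigr => i _.
  rewrite !big_ord_recl big_ord0 /b/= /increment_te/= addn0 addn1 addn2; ring.
move=> ->; congr (expR (- _ / 2)).
rewrite -(pair_bigA _ (fun i e => \sum_(q : 'I_m * 'I_3) z i * b e * (z q.1 * b q.2) *
  \int[P]_w (u (delta * (i + e)%:R) x w * u (delta * (q.1 + q.2)%:R) x w)))/=.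
apply: eq_bigr => i _.
under eq_bigr => e _ do rewrite
  -(pair_bigA _ (fun j f => z i * b e * (z j * b f) *
  \int[P]_w (u (delta * (i + e)%:R) x w * u (delta * (j + f)%:R) x w)))/=.
rewrite exchange_big/=; apply: eq_bigr => j _.
have E (e f : 'I_3) : \int[P]_w (u (delta * (i + e)%:R) x w * u (delta * (j + f)%:R) x w) =
  wave_scale d beta theta * delta `^ (gam + 1) * wave_kernel beta (i + e)%:R (j + f)%:R.
  rewrite wave_solution_covariance ?mulr_ge0 ?(ltW d0)//.
  by rewrite wave_kernel_scale// mulrA.
under eq_bigr => e _ do under eq_bigr => f _ do rewrite E.
rewrite -second_difference_wave_kernel /second_difference.
rewrite !big_ord_recl !big_ord0 /b/= /bump/= !addn0 !addn1 !addn2.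
have s1 (k : nat) : k.+1%:R + 1 = k.+2%:R :> R by rewrite -[in RHS]natr1.
have s2 (k : nat) : k.+1%:R - 1 = k%:R :> R by rewrite -natr1 addrK.
rewrite !s1 !s2; ring.
Qed.

End increments.

(** * Sums over matrices close to min(i,j) times a Toeplitz matrix *)

Section sums.
Context {R : realType}.

(** The bound 3 alone would not be inductive. *)
Lemma sum_inv_sqr_le (n : nat) : \sum_(k < n) ((k.+1%:R : R) ^- 2) <= 3 - 2 / n.+1%:R.
Proof.
elim: n => [|n IH]; first by rewrite big_ord0 divr1; lra.
rewrite big_ord_recr/=; apply: (le_trans (lerD IH (lexx _))).
have n0 : 0 < n.+1%:R :> R by rewrite ltr0n.
have n1 : 0 <= n%:R :> R by [].
rewrite -[n.+2%:R]natr1 -subr_ge0 -[n.+1%:R]natr1 in n0 *.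
move: (n%:R) n0 n1 => x x0 x1.
have -> : 3 - 2 / (x + 1 + 1) - (3 - 2 / (x + 1) + (x + 1) ^- 2) =
  x / ((x + 1) ^+ 2 * (x + 1 + 1)) by field; rewrite !gt_eqF; lra.
by rewrite divr_ge0// mulr_ge0 ?sqr_ge0//; lra.
Qed.

Lemma sum_decay (rho : nat -> R) (K : R) (n : nat) : 0 <= K ->
  (forall k, `|rho k| <= K * k.+1%:R ^- 2) -> \sum_(k < n) `|rho k| <= 3 * K.
Proof.
move=> K0 h; apply: (@le_trans _ _ (\sum_(k < n) K * (k.+1%:R ^- 2))).
  by apply: ler_sum.
rewrite -mulr_sumr mulrC ler_wpM2r//; apply: (le_trans (sum_inv_sqr_le n)).
by rewrite gerBl divr_ge0.
Qed.

Lemma sum_mul_sqr_decay (rho : nat -> R) (K : R) (n : nat) : 0 <= K ->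
  (forall k, `|rho k| <= K * k.+1%:R ^- 2) ->
  \sum_(j < n) j.+1%:R * rho j.+1 ^+ 2 <= 3 * K ^+ 2.
Proof.
move=> K0 rhoK.
apply: (@le_trans _ _ (\sum_(j < n) K ^+ 2 * j.+1%:R ^- 2)).
  apply: ler_sum => j _; have n0 : 0 < j.+1%:R :> R by rewrite ltr0n.
  apply: (@le_trans _ _ (j.+1%:R * (K * j.+1%:R ^- 2) ^+ 2)).
    rewrite ler_wpM2l// -(real_normK (num_real _)) lerXn2r ?nnegrE ?mulr_ge0//.
    apply: (le_trans (rhoK _)); rewrite ler_wpM2l// lef_pV2 ?posrE ?exprn_gt0// ?ltr0n//.
    by rewrite lerXn2r ?nnegrE// ler_nat.
  rewrite exprMn mulrCA ler_wpM2l ?sqr_ge0//.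
  have n1 : 1 <= j.+1%:R :> R by rewrite ler1n.
  move: (j.+1%:R : R) n0 n1 => x x0 x1.
  have -> : x * x ^- 2 ^+ 2 = x^-1 * x ^- 2 by field; rewrite gt_eqF.
  by rewrite ler_piMl ?invr_ge0 ?exprn_ge0 ?invf_le1// ltW.
rewrite -mulr_sumr mulrC ler_wpM2r ?sqr_ge0//; apply: (le_trans (sum_inv_sqr_le n)).
by rewrite gerBl divr_ge0.
Qed.

Definition natdist (i j : nat) : nat := (i - j + (j - i))%N.

Lemma natdistC i j : natdist i j = natdist j i. Proof. by rewrite /natdist addnC. Qed.

(** Every distance to i is attained at most twice. *)
Lemma sum_natdist_le (g : nat -> R) (i m : nat) : (forall k, 0 <= g k) ->
  \sum_(j < m) g (natdist i j) <= \sum_(k < i.+1) g k + \sum_(k < m) g k.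
Proof.
move=> g0; elim: i m => [|i IH] [|m].
- by rewrite big_ord0 addr_ge0// sumr_ge0.
- rewrite [leLHS](_ : _ = \sum_(k < m.+1) g k); last by apply: eq_bigr => j _; rewrite /natdist sub0n subn0.
  by rewrite lerDr sumr_ge0.
- by rewrite big_ord0 addr_ge0// sumr_ge0.
rewrite big_ord_recl/= /bump/=.
rewrite (eq_bigr (fun j : 'I_m => g (natdist i j))) => [|j _]; last by rewrite /natdist !add1n !subSS.
rewrite [in leRHS]big_ord_recr/= [X in _ <= _ + X]big_ord_recr/=.
have -> : natdist i.+1 0 = i.+1 by rewrite /natdist subn0 sub0n addn0.
have := IH m; have := g0 m; have := g0 i.+1.
move: (\sum_(j < m) g (natdist i j)) (g i.+1) (\sum_(k < i.+1) g k) (\sum_(k < m) g k) (g m).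
by move=> x1 x2 x3 x4 x5; lra.
Qed.

Section weighted_sum.
Variables (f : nat -> R) (M : R).
Hypothesis f0 : forall n, 0 <= f n.
Hypothesis fM : forall n, \sum_(j < n) j.+1%:R * f j.+1 <= M.

(** A partial sum over |n| <= m of f(|n|). *)
Definition two_sided_sum (m : nat) : R := f 0 + 2 * \sum_(j < m) f j.+1.

Variable L : R.
Hypothesis fL : two_sided_sum m @[m --> \oo] --> L.

Let M0 : 0 <= M. Proof. by have := fM 0; rewrite big_ord0. Qed.

Let sum_tail (m n : nat) : \sum_(j < m + n) f j.+1 - \sum_(j < m) f j.+1 <= M / m.+1%:R.
Proof.
rewrite big_split_ord/= addrAC subrr add0r ler_pdivlMr ?ltr0n//.
apply: le_trans (fM (m + n)); rewrite big_split_ord/=.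
apply: (@le_trans _ _ (\sum_(i < n) (m + i).+1%:R * f (m + i).+1)); last first.
  by rewrite lerDr sumr_ge0// => j _; rewrite mulr_ge0.
rewrite mulr_suml; apply: ler_sum => j _; rewrite mulrC ler_wpM2r// ler_nat ltnS.
exact: leq_addr.
Qed.

(** In the tail j f(j) dominates m f(j). *)
Lemma two_sided_sum_tail (m : nat) : 0 <= L - two_sided_sum m <= 2 * M / m.+1%:R.
Proof.
have mono n : two_sided_sum m <= two_sided_sum (m + n).
  by rewrite /two_sided_sum big_split_ord/= lerD2l ler_pM2l// lerDl sumr_ge0.
have tail n : two_sided_sum (m + n) <= two_sided_sum m + 2 * M / m.+1%:R.
  have := sum_tail m n; rewrite /two_sided_sum.
  rewrite -mulrA; move: (M / _) => q.
  by move: (\sum_(j < m + n) _) (\sum_(j < m) _) => x y; lra.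
have cv : two_sided_sum (m + n)%N @[n --> \oo] --> L.
  have := fL; rewrite -(cvg_shiftn m); apply: cvg_trans.
  by under eq_cvg do rewrite addnC.
apply/andP; split.
  by rewrite subr_ge0; apply: (cvgr_to_ge cv); exact: nearW.
by rewrite lerBlDl; apply: (cvgr_to_le cv); exact: nearW.
Qed.

Let G (i j : nat) : R := (minn i j).+1%:R ^+ 2 * f (natdist i j).
Let T (m : nat) : R := \sum_(i < m) \sum_(j < m) G i j.

Let T_rec (m : nat) :
  T m.+1 = T m + 2 * \sum_(j < m) (m - j)%:R ^+ 2 * f j.+1 + m.+1%:R ^+ 2 * f 0.
Proof.
rewrite /T big_ord_recr/= [X in _ + X]big_ord_recr/=.
under eq_bigr do rewrite big_ord_recr/=.
rewrite big_split/=.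
have GC i j : G i j = G j i by rewrite /G minnC natdistC.
rewrite [X in _ + X + _](eq_bigr (fun i : 'I_m => G m i)) => [|i _]; last exact: GC.
have -> : \sum_(i < m) G m i = \sum_(j < m) (m - j)%:R ^+ 2 * f j.+1.
  rewrite (reindex_inj rev_ord_inj)/=; apply: eq_bigr => j _.
  rewrite /G /natdist (minn_idPr _); last by rewrite leq_subr.
  have jm := ltn_ord j; rewrite subnSK//.
  rewrite subKn// (_ : (m - j.+1 - m)%N = 0%N) ?addn0//.
  by apply/eqP; rewrite subn_eq0 leq_subr.
have -> : G m m = m.+1%:R ^+ 2 * f 0 by rewrite /G /natdist minnn subnn.
ring.
Qed.

(** Passing from m to m + 1 adds the last row and column, that is the sum over
    |n| <= m of (m + 1 - |n|)^2 f(|n|); this is (m + 1)^2 L up to O(m),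
    because the sum of |n| f(|n|) is finite. Summation gives L m^3 / 3. *)
Lemma weighted_sum_asymptotics : exists2 C, 0 <= C &
  forall m, `|T m - L * m%:R ^+ 3 / 3| <= C * m%:R ^+ 2.
Proof.
have L0 : 0 <= L.
  have /andP[h _] := two_sided_sum_tail 0; apply: le_trans (_ : two_sided_sum 0 <= _); last by rewrite -subr_ge0.
  by rewrite /two_sided_sum big_ord0 mulr0 addr0.
(* the increment over one step is at most C (2 m + 1) *)
exists (6 * M + L) => [|m]; first by rewrite addr_ge0 ?mulr_ge0.
elim: m => [|m IH]; first by rewrite /T big_ord0 !expr0n/= !mulr0 mul0r subr0 normr0.
rewrite T_rec; set D := \sum_(j < m) (m - j)%:R ^+ 2 * f j.+1.
have n0 : 0 <= m%:R :> R by [].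
pose x : R := m%:R; rewrite -[m.+1%:R]natr1 -/x in n0 IH *.
have d1 : (x + 1) ^+ 2 * \sum_(j < m) f j.+1 - 2 * (x + 1) * M <= D.
  apply: (@le_trans _ _ (\sum_(j < m) ((x + 1) ^+ 2 * f j.+1 - 2 * (x + 1) * (j.+1%:R * f j.+1)))).
    rewrite sumrB -!mulr_sumr lerD2l lerN2 ler_wpM2l//; lra.
  apply: ler_sum => j _; rewrite mulrA -mulrBl ler_wpM2r// natrB; last exact: ltnW.
  rewrite -[j.+1%:R]natr1 -/x; move: (j%:R : R) => y.
  rewrite -subr_ge0; have -> : (x - y) ^+ 2 - ((x + 1) ^+ 2 - 2 * (x + 1) * (y + 1)) = (y + 1) ^+ 2 by ring.
  exact: sqr_ge0.
have d2 : D <= (x + 1) ^+ 2 * \sum_(j < m) f j.+1.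
  rewrite mulr_sumr; apply: ler_sum => j _; rewrite ler_wpM2r//.
  rewrite lerXn2r ?nnegrE ?addr_ge0//; rewrite natrB; last exact: ltnW.
  by rewrite -/x; have : 0 <= (j%:R : R) by []; lra.
have := two_sided_sum_tail m; rewrite /two_sided_sum -[m.+1%:R]natr1 -/x.
move: (\sum_(j < m) f j.+1) (f 0) d1 d2 => U F d1 d2 /andP[t1 t2].
have x10 : 0 < x + 1 by lra.
have t3 : (x + 1) ^+ 2 * (L - (F + 2 * U)) <= 2 * M * (x + 1).
  rewrite -ler_pdivlMl ?exprn_gt0//; apply: (le_trans t2).
  by rewrite le_eqVlt; apply/orP; left; apply/eqP; field; rewrite gt_eqF.
have t4 : 0 <= (x + 1) ^+ 2 * (L - (F + 2 * U)) by rewrite mulr_ge0 ?sqr_ge0.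
move: IH; rewrite !ler_norml => /andP[h1 h2].
have e3 : (x + 1) ^+ 3 = x ^+ 3 + 3 * (x + 1) ^+ 2 - 3 * x - 2 by ring.
have e2 : (x + 1) ^+ 2 = x ^+ 2 + 2 * x + 1 by ring.
have Lx : 0 <= L * x by rewrite mulr_ge0.
have Mx : 0 <= M * x by rewrite mulr_ge0.
have -> : L * (x + 1) ^+ 3 / 3 = L * x ^+ 3 / 3 + L * (x + 1) ^+ 2 - L * x - L * (2 / 3).
  by rewrite e3; field.
move: h1 h2 d1 d2 t3 t4; rewrite e2 => h1 h2 d1 d2 t3 t4.
move: (L * x ^+ 3 / 3) (x ^+ 2) (T m) h1 h2 d1 d2 t3 t4 => x3 x2 Tm h1 h2 d1 d2 t3 t4.
by apply/andP; split; lra.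
Qed.

End weighted_sum.

Section perturbed_toeplitz.
Variables (rho : nat -> R) (r : nat -> nat -> R) (K B : R).
Hypotheses (K0 : 0 <= K) (B0 : 0 <= B).
Hypothesis rhoK : forall n, `|rho n| <= K * n.+1%:R ^- 2.
Hypothesis rB : forall i j, `|r i j| <= B.

(** Indices start at 0, whereas the increments are numbered from 1; hence the
    successor. *)
Definition toeplitz_min (i j : nat) : R := (minn i j).+1%:R * rho (natdist i j) + r i j.
Let s := toeplitz_min.

Lemma sum_rho_natdist (i m : nat) : \sum_(j < m) `|rho (natdist i j)| <= 6 * K.
Proof.
apply: (le_trans (sum_natdist_le i m (fun k => normr_ge0 (rho k)))).
by have := sum_decay i.+1 K0 rhoK; have := sum_decay m K0 rhoK; lra.
Qed.

Let min_le (m : nat) (i j : 'I_m) : (minn i j).+1%:R <= m%:R :> R.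
Proof. by rewrite ler_nat; apply: leq_ltn_trans (ltn_ord i); exact: geq_minl. Qed.

Lemma toeplitz_min_le (m : nat) (i j : 'I_m) : `|s i j| <= m%:R * `|rho (natdist i j)| + B.
Proof.
rewrite /s /toeplitz_min; apply: (le_trans (ler_normD _ _)).
by rewrite normrM lerD// ler_wpM2r// ger0_norm.
Qed.


Lemma toeplitz_row_le (m : nat) (i : 'I_m) : \sum_(j < m) `|s i j| <= m%:R * (6 * K + B).
Proof.
apply: (@le_trans _ _ (\sum_(j < m) (m%:R * `|rho (natdist i j)| + B))).
  by apply: ler_sum => j _; exact: toeplitz_min_le.
rewrite big_split/= -mulr_sumr mulrDr lerD ?ler_wpM2l ?sum_rho_natdist//.
by rewrite sumr_const card_ord mulr_natl.
Qed.

Lemma toeplitz_minC (i j : nat) : (forall i j, r i j = r j i) -> s i j = s j i.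
Proof. by move=> rC; rewrite /s /toeplitz_min minnC natdistC rC. Qed.

(** Bound one factor of each squared entry of S^2 by the maximum O(m^2) and
    sum the other one over all entries, O(m^3), both by the bound on row
    sums. *)
Lemma sum_sqr_mul_le (m : nat) (S : 'I_m -> 'I_m -> R) (C : R) : 0 <= C ->
  (forall i j, S i j = S j i) ->
  (forall i, \sum_j `|S i j| <= m%:R * C) ->
  \sum_i \sum_j (\sum_k S i k * S k j) ^+ 2 <= C ^+ 4 * m%:R ^+ 5.
Proof.
move=> C0 SC row.
have entry i j : `|S i j| <= m%:R * C.
  by apply: le_trans (row i); rewrite (bigD1 j)//= lerDl sumr_ge0.
have mC0 : 0 <= m%:R * C by rewrite mulr_ge0.
have abs i j : `|\sum_k S i k * S k j| <= \sum_k `|S i k| * `|S k j|.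
  by apply: (le_trans (ler_norm_sum _ _ _)); apply: ler_sum => k _; rewrite normrM.
have max i j : `|\sum_k S i k * S k j| <= (m%:R * C) ^+ 2.
  apply: (le_trans (abs i j)); rewrite expr2.
  apply: (@le_trans _ _ (\sum_k `|S i k| * (m%:R * C))).
    by apply: ler_sum => k _; rewrite ler_wpM2l.
  by rewrite -mulr_suml ler_wpM2r.
have tot : \sum_i \sum_j `|\sum_k S i k * S k j| <= m%:R * (m%:R * C) ^+ 2.
  apply: (@le_trans _ _ (\sum_(i < m) (m%:R * C) ^+ 2)); last first.
    by rewrite sumr_const card_ord -[leLHS]mulr_natl.
  apply: ler_sum => i _; apply: (@le_trans _ _ (\sum_j \sum_k `|S i k| * `|S k j|)).
    by apply: ler_sum => j _; exact: abs.
  rewrite exchange_big/= expr2.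
  apply: (@le_trans _ _ (\sum_k `|S i k| * (m%:R * C))); last by rewrite -mulr_suml ler_wpM2r.
  by apply: ler_sum => k _; rewrite -mulr_sumr ler_wpM2l.
apply: (@le_trans _ _ (\sum_i \sum_j (m%:R * C) ^+ 2 * `|\sum_k S i k * S k j|)).
  apply: ler_sum => i _; apply: ler_sum => j _.
  by rewrite -(real_normK (num_real _)) expr2 ler_wpM2r.
under eq_bigr do rewrite -mulr_sumr.
rewrite -mulr_sumr; apply: (@le_trans _ _ ((m%:R * C) ^+ 2 * (m%:R * (m%:R * C) ^+ 2))).
  by rewrite ler_wpM2l// sqr_ge0.
by rewrite le_eqVlt; apply/orP; left; apply/eqP; ring.
Qed.

Variable L : R.
Hypothesis rhoL : two_sided_sum (fun n => rho n ^+ 2) m @[m --> \oo] --> L.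

(** The cross terms are O(m^2) because each row sum of |rho| is bounded. *)
Lemma toeplitz_sqr_asymptotics : exists2 C, 0 <= C & forall m,
  `|\sum_(i < m) \sum_(j < m) s i j ^+ 2 - L * m%:R ^+ 3 / 3| <= C * m%:R ^+ 2.
Proof.
have f0 n : 0 <= rho n ^+ 2 by exact: sqr_ge0.
have fM n := sum_mul_sqr_decay n K0 rhoK.
have [C C0 hC] := weighted_sum_asymptotics f0 fM rhoL.
exists (C + (2 * B * (6 * K) + B ^+ 2)) => [|m].
  by rewrite !addr_ge0 ?mulr_ge0 ?sqr_ge0.
rewrite mulrDl; apply: le_trans (lerD (hC m) (lexx _)).
rewrite -lerBlDl; apply: (le_trans (lerB_dist _ _)).
rewrite opprB addrA subrK -sumrB; under eq_bigr do rewrite -sumrB.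
apply: (le_trans (ler_norm_sum _ _ _)).
apply: (@le_trans _ _ (\sum_(i < m) (2 * B * m%:R * (6 * K) + m%:R * B ^+ 2))); last first.
  by rewrite sumr_const card_ord -[leLHS]mulr_natl le_eqVlt; apply/orP; left; apply/eqP; ring.
apply: ler_sum => i _; apply: (le_trans (ler_norm_sum _ _ _)).
apply: (@le_trans _ _ (\sum_(j < m) (2 * B * m%:R * `|rho (natdist i j)| + B ^+ 2))).
  apply: ler_sum => j _; rewrite /s /toeplitz_min.
  have q0 := min_le i j; have := rB i j.
  have p0 : 0 <= (minn i j).+1%:R :> R by [].
  move: (r i j) ((minn i j).+1%:R : R) p0 q0 (rho _) => rr q p0 q0 rh rb.
  rewrite (_ : _ - _ = 2 * rr * q * rh + rr ^+ 2); last by ring.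
  apply: (le_trans (ler_normD _ _)); rewrite lerD//.
    rewrite !normrM ler_wpM2r// (ger0_norm p0) ler_pM// ?mulr_ge0//.
    by rewrite ger0_norm// ler_wpM2l.
  by rewrite normrX lerXn2r ?nnegrE.
rewrite big_split/= -mulr_sumr lerD//; last by rewrite sumr_const card_ord mulr_natl.
by rewrite ler_wpM2l ?mulr_ge0 ?sum_rho_natdist.
Qed.

Lemma toeplitz_trace_asymptotics : exists2 C, 0 <= C & forall m,
  `|\sum_(i < m) s i i - rho 0 / 2 * m%:R ^+ 2| <= C * m%:R.
Proof.
exists (`|rho 0| + B) => [|m]; first by rewrite addr_ge0.
elim: m => [|m IH]; first by rewrite big_ord0 expr0n/= !mulr0 subr0 normr0.
rewrite big_ord_recr/= -[m.+1%:R]natr1.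
have -> : s m m = (m%:R + 1) * rho 0 + r m m.
  by rewrite /s /toeplitz_min minnn /natdist subnn -natr1.
rewrite (_ : _ - _ = \sum_(i < m) s i i - rho 0 / 2 * m%:R ^+ 2 + (rho 0 / 2 + r m m)); last by field.
apply: (le_trans (ler_normD _ _)); rewrite mulrDr mulr1 lerD//.
apply: (le_trans (ler_normD _ _)); rewrite lerD// normrM ler_piMr// ger0_norm//; lra.
Qed.

End perturbed_toeplitz.
End sums.

(** * Decay of fourth differences of powers *)

Section fourth_difference_decay.
Context {R : realType}.

Definition forward_difference (f : R -> R) (x : R) : R := f (x + 1) - f x.

Lemma is_derive_forward_difference (f df : R -> R) (x : R) :
  (forall y, x <= y -> is_derive y 1 f (df y)) ->
  forall y, x <= y -> is_derive y 1 (forward_difference f) (forward_difference df y).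
Proof.
move=> fdf y xy.
have d1 : is_derive y 1 (fun z : R => z + 1) (1 : R).
  by apply: is_derive_eq; rewrite addr0.
have x1 : x <= y + 1 by apply: (le_trans xy); rewrite lerDl.
have d2 := @is_derive1_comp R f (fun z : R => z + 1) y _ _ (fdf _ x1) d1.
rewrite mulr1 in d2.
exact: is_deriveB d2 (fdf _ xy).
Qed.

(** Mean value theorem; iterating it transfers a bound from the fourth
    derivative to the fourth difference. *)
Lemma forward_difference_le (f df : R -> R) (x B : R) :
  (forall y, x <= y -> is_derive y 1 f (df y)) ->
  (forall y, x <= y -> `|df y| <= B) ->
  forall y, x <= y -> `|forward_difference f y| <= B.
Proof.
move=> fdf dfB y xy.
have y1 : y < y + 1 by rewrite ltrDl.
have [z| |c] := @MVT R f df y (y + 1) y1.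
- by rewrite in_itv/= => /andP[yz _]; apply: fdf; exact: le_trans (ltW yz).
- apply: derivable_within_continuous => z; rewrite in_itv/= => /andP[yz _].
  by case: (fdf z (le_trans xy yz)).
rewrite in_itv/= => /andP[yc _]; rewrite /forward_difference => ->.
by rewrite addrAC subrr add0r mulr1; apply: dfB; exact: le_trans (ltW yc).
Qed.

(** A closed form, so that the four derivatives needed are instances of a
    single lemma. *)
Definition powR_deriv (a : R) (k : nat) (y : R) : R :=
  (\prod_(l < k) (a - l%:R)) * y `^ (a - k%:R).

Lemma is_derive_powR_deriv (a : R) (k : nat) (y : R) : 0 < y ->
  is_derive y 1 (powR_deriv a k) (powR_deriv a k.+1 y).
Proof.
move=> y0; rewrite /powR_deriv big_ord_recr/=.
have d := is_derive1_powR (a - k%:R) y0.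
have d2 : is_derive y 1 (fun y => \prod_(l < k) (a - l%:R) * y `^ (a - k%:R))
    (\prod_(l < k) (a - l%:R) * ((a - k%:R) * y `^ (a - k%:R - 1))).
  by apply: is_derive_eq.
by apply: (is_derive_eq d2); rewrite mulrA -[k.+1%:R]natr1 opprD addrA.
Qed.

Lemma fourth_differenceE (f : R -> R) (x : R) :
  iter 4 forward_difference f x = fourth_difference f (x + 2).
Proof.
rewrite /fourth_difference /= /forward_difference.
have -> : x + 1 + 1 + 1 + 1 = x + 2 + 2 by ring.
have -> : x + 1 + 1 + 1 = x + 2 + 1 by ring.
have -> : x + 1 + 1 = x + 2 by ring.
have -> : x + 2 - 1 = x + 1 by ring.
have -> : x + 2 - 2 = x by ring.
ring.
Qed.

(** The centred fourth difference at x is the fourth forward difference at x -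
    2, which lies in the domain x - 2 >= 1 where the power is smooth. *)
Lemma fourth_difference_powR_le (a x : R) : a <= 4 -> 3 <= x ->
  `|fourth_difference (fun z => `|z| `^ a) x| <=
  `|\prod_(l < 4) (a - l%:R)| * (x - 2) `^ (a - 4).
Proof.
move=> a4 x3; pose C := `|\prod_(l < 4) (a - l%:R)|; pose y := x - 2; rewrite -/C -/y.
have y1 : 1 <= y by rewrite /y; lra.
have y0 : 0 < y by exact: lt_le_trans y1.
have E : fourth_difference (fun z => `|z| `^ a) x = iter 4 forward_difference (powR_deriv a 0) y.
  rewrite fourth_differenceE subrK /fourth_difference /powR_deriv big_ord0 !mul1r subr0.
  by rewrite !ger0_norm//; move: y1; rewrite /y; lra.
have der j k : forall z, y <= z ->
    is_derive z 1 (iter j forward_difference (powR_deriv a k)) (iter j forward_difference (powR_deriv a k.+1) z).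
  elim: j k => [|j IH] k z yz; last exact: is_derive_forward_difference.
  by apply: is_derive_powR_deriv; exact: lt_le_trans yz.
rewrite E.
have bd0 z : y <= z -> `|powR_deriv a 4 z| <= C * y `^ (a - 4).
  move=> yz; rewrite /powR_deriv normrM (ger0_norm (powR_ge0 _ _)) ler_wpM2l//.
  rewrite -(opprB 4 a) !powRN lef_pV2 ?posrE ?powR_gt0//; last exact: lt_le_trans yz.
  have z0 : 0 <= z by exact: le_trans (ltW y0) yz.
  have a40 : 0 <= 4 - a by rewrite subr_ge0.
  by apply: (ge0_ler_powR a40); rewrite ?nnegrE// ltW.
have bd1 := forward_difference_le (der 0%N 3%N) bd0.
have bd2 := forward_difference_le (der 1%N 2%N) bd1.
have bd3 := forward_difference_le (der 2%N 1%N) bd2.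
exact: (forward_difference_le (der 3%N 0%N) bd3 (lexx y)).
Qed.

Lemma fourth_difference_even (a x : R) :
  fourth_difference (fun z => `|z| `^ a) (- x) = fourth_difference (fun z => `|z| `^ a) x.
Proof.
rewrite /fourth_difference normrN.
have -> : `|- x + 2| = `|x - 2| by rewrite -normrN; congr `|_|; ring.
have -> : `|- x + 1| = `|x - 1| by rewrite -normrN; congr `|_|; ring.
have -> : `|- x - 1| = `|x + 1| by rewrite -normrN; congr `|_|; ring.
have -> : `|- x - 2| = `|x + 2| by rewrite -normrN; congr `|_|; ring.
ring.
Qed.

Local Notation D4 a n := (fourth_difference (fun z => `|z| `^ a) n%:R).

(** The mean value bound is only available from n = 3 on; finitely many values
    are absorbed in the constant. *)
Lemma bound_from_three (g h : nat -> R) (C : R) : 0 <= C -> (forall n, 0 < h n) ->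
  (forall n, (3 <= n)%N -> `|g n| <= C * h n) ->
  exists2 K, 0 <= K & forall n, `|g n| <= K * h n.
Proof.
move=> C0 h0 gC; have q0 n : 0 <= `|g n| / h n by rewrite divr_ge0// ltW.
exists (C + \sum_(k < 3) `|g k| / h k) => [|n]; first by rewrite addr_ge0// sumr_ge0.
have [n3|n3] := leqP 3 n.
  by apply: (le_trans (gC n n3)); rewrite ler_wpM2r ?(ltW (h0 n))// lerDl sumr_ge0.
rewrite -ler_pdivrMr// (bigD1 (Ordinal n3))//= addrCA lerDl addr_ge0// sumr_ge0//.
Qed.

Lemma fourth_difference_decay (a : R) : a <= 2 ->
  exists2 K, 0 <= K & forall n, `|- D4 a n| <= K * n.+1%:R ^- 2.
Proof.
move=> a2; pose C := `|\prod_(l < 4) (a - l%:R)|.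
have n1 n : 0 < n.+1%:R ^- 2 :> R by rewrite invr_gt0 exprn_gt0// ltr0n.
apply: (@bound_from_three (fun n => - D4 a n) (fun n => n.+1%:R ^- 2) (C * 16)) => // [|n n3].
  by rewrite mulr_ge0// normr_ge0.
have x3 : 3 <= n%:R :> R by rewrite ler_nat.
rewrite normrN -mulrA; have a4 : a <= 4 by lra.
apply: (le_trans (fourth_difference_powR_le a4 x3)).
rewrite ler_wpM2l// -[n.+1%:R]natr1; move: (n%:R : R) x3 => x x3.
apply: (@le_trans _ _ ((x - 2) `^ (- 2))).
  by apply: ler_powR; lra.
rewrite powRN powR_mulrn; last by lra.
have p2 : 0 < (x - 2) ^+ 2 by apply: exprn_gt0; lra.
have p1 : 0 < (x + 1) ^+ 2 by apply: exprn_gt0; lra.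
rewrite ler_pdivlMr// ler_pdivrMl// -subr_ge0.
have -> : (x - 2) ^+ 2 * 16 - (x + 1) ^+ 2 = (x - 3) * (15 * x - 21) by ring.
by rewrite mulr_ge0//; lra.
Qed.

Lemma fourth_difference_bounded (a : R) : a <= 3 ->
  exists2 K, 0 <= K & forall n, `|D4 a n| <= K.
Proof.
move=> a2; pose C := `|\prod_(l < 4) (a - l%:R)|.
have [| |n n3|K K0 h] := @bound_from_three (fun n => D4 a n) (fun=> 1) C.
- exact: normr_ge0.
- by [].
  have x3 : 3 <= n%:R :> R by rewrite ler_nat.
  have a4 : a <= 4 by lra.
  apply: (le_trans (fourth_difference_powR_le a4 x3)).
  have e : (n%:R - 2) `^ (a - 4) <= (n%:R - 2) `^ 0 by apply: ler_powR; lra.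
  by rewrite powRr0 in e; rewrite ler_wpM2l.
by exists K => // n; have := h n; rewrite mulr1.
Qed.

End fourth_difference_decay.

(** * Two-sided series and rates of convergence *)

Section two_sided_series.
Context {R : realType}.

Lemma nneseries_of_cvg (g : nat -> R) (l : R) :
  \sum_(k < n) g k @[n --> \oo] --> l -> (\sum_(k <oo) (g k)%:E)%E = l%:E.
Proof.
move=> gl; apply: cvg_lim => //.
rewrite (_ : (fun n => _) = (fun n => (\sum_(k < n) g k)%:E)).
  by apply: cvg_EFin; [exact: nearW|exact: gl].
by apply/funext => n; rewrite sumEFin big_mkord.
Qed.

(** Split Z into nonnegative and negative integers; the latter are enumerated
    by -(n + 1), which accounts for the successor. *)
Lemma esum_int (f : nat -> R) (L : R) : (forall n, 0 <= f n) ->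
  two_sided_sum f m @[m --> \oo] --> L ->
  (\esum_(j in [set: int]) (f `|j|%N)%:E)%E = L%:E.
Proof.
move=> f0 fL; pose S := (L - f 0) / 2.
have cS : \sum_(k < n) f k.+1 @[n --> \oo] --> S.
  rewrite (_ : (fun n => _) = fun n => (two_sided_sum f n - f 0) / 2).
    by apply: cvgMl; apply: cvgB => //; exact: cvg_cst.
  by apply/funext => n; rewrite /two_sided_sum addrAC subrr add0r mulrC mulKf.
have c0 : \sum_(k < n) f k @[n --> \oo] --> f 0 + S.
  rewrite -cvg_shiftS (_ : [sequence _]_n = fun n => f 0 + \sum_(k < n) f k.+1).
    by apply: cvgD => //; exact: cvg_cst.
  by apply/funext => n /=; rewrite big_ord_recl.
rewrite (esumID (Posz @` setT)); last by move=> j _; rewrite lee_fin.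
rewrite !setTI (_ : ~` (Posz @` setT) = Negz @` setT); last first.
  apply/seteqP; split => -[n|n]/=.
  - by case; exists n.
  - by move=> _; exists n.
  - by case.
  - by move=> _ [].
rewrite !esum_image; [|by move=> i j _ _ [] ->..].
rewrite -(@nneseries_esumT _ (fun n => (f n)%:E)); last by move=> n; rewrite lee_fin.
rewrite -(@nneseries_esumT _ (fun n => (f n.+1)%:E)); last by move=> n; rewrite lee_fin.
rewrite (nneseries_of_cvg c0) (nneseries_of_cvg cS) -EFinD; congr EFin.
by rewrite /S; field.
Qed.

Lemma cvg_of_rate (x y : nat -> R) (l : R) :
  (forall m, (0 < m)%N -> `|x m - l| <= y m) ->
  y m @[m --> \oo] --> 0 -> x m @[m --> \oo] --> l.
Proof.
move=> xy y0; apply/cvgrPdist_le => e e0.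
near=> m; rewrite distrC; apply: (le_trans (xy m _)).
  by near: m; exists 1%N.
apply: (le_trans (ler_norm _)); near: m.
by move/cvgrPdist_le : y0 => /(_ _ e0); apply: filterS => m; rewrite sub0r normrN.
Unshelve. all: by end_near. Qed.

Lemma cvg_inv_nat : (m%:R : R)^-1 @[m --> \oo] --> (0 : R).
Proof.
apply: (@cvg_of_rate _ (fun m => 2 * m.+1%:R^-1)) => [m m0|].
  have m1 : 1 <= m%:R :> R by rewrite ler1n.
  rewrite subr0 ger0_norm ?invr_ge0// -[m.+1%:R]natr1; move: (m%:R : R) m1 => x x1.
  by rewrite ler_pdivlMr ?ler_pdivrMl; lra.
rewrite -[X in _ --> X](mulr0 (2 : R)); apply: cvgMr; exact: cvg_harmonic.
Qed.

Lemma cvg_inv_sqrt_nat : (Num.sqrt m%:R : R)^-1 @[m --> \oo] --> (0 : R).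
Proof.
rewrite (_ : (fun m => _) = fun m => Num.sqrt ((m%:R : R)^-1)).
  rewrite -[X in _ --> X](@sqrtr0 R); apply: (@cvg_comp _ _ _ _ Num.sqrt _ _ _ cvg_inv_nat).
  exact: sqrt_continuous.
by apply/funext => m; rewrite sqrtrV.
Qed.

End two_sided_series.

(** * The limit theorem *)

Section limit_theorem.
Context {R : realType}.
Variables (d : nat) (beta theta : R).
Hypotheses (b0 : 0 < beta) (b2 : beta < 2) (bd : beta < d%:R) (th0 : 0 < theta).
Local Notation gam := (2 - beta).
Local Notation D4 a := (fourth_difference (fun z : R => `|z| `^ a)).
Local Notation W := (wave_scale d beta theta).

(** The dependence of the leading term of the covariance on |i - j|; a
    multiple of the cosine transform of g_te at the integers. *)
Definition increment_decay (n : nat) : R := - D4 gam n%:R.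
Local Notation rho := increment_decay.

Definition increment_remainder (i j : nat) : R :=
  D4 (gam + 1) (i.+1%:R + j.+1%:R) / (2 * (gam + 1)) +
  (2^-1 - (2 * (gam + 1))^-1) * D4 (gam + 1) (natdist i j)%:R +
  2^-1 * ((natdist i j)%:R * rho (natdist i j)).
Local Notation r := increment_remainder.

(** Write i + j = 2 min(i,j) + |i - j|: the part with min(i,j) is the leading
    term, and |i - j| rho(|i - j|) is bounded. *)
Lemma increment_covarianceE (i j : nat) :
  increment_covariance beta i.+1%:R j.+1%:R = toeplitz_min rho r i j.
Proof.
rewrite /increment_covariance /toeplitz_min /r.
have main (n k : nat) (x : R) : D4 gam x = - rho n -> D4 (gam + 1) x = D4 (gam + 1) n%:R ->
    i.+1%:R + j.+1%:R = 2 * k.+1%:R + n%:R :> R ->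
    D4 (gam + 1) (i.+1%:R + j.+1%:R) / (2 * (gam + 1)) +
    (2^-1 - (2 * (gam + 1))^-1) * D4 (gam + 1) x -
    2^-1 * ((i.+1%:R + j.+1%:R) * D4 gam x) =
    k.+1%:R * rho n + (D4 (gam + 1) (i.+1%:R + j.+1%:R) / (2 * (gam + 1)) +
      (2^-1 - (2 * (gam + 1))^-1) * D4 (gam + 1) n%:R +
      2^-1 * (n%:R * rho n)).
  move=> -> ->; set A := D4 _ (_ + _); set A' := D4 _ _; move: A A' => A A' ->.
  move: (rho n) => q; move: ((2 * (gam + 1))^-1) => g.
  move: (k.+1%:R : R) (n%:R : R) => x1 x2; by field.
have [ij|/ltnW ji] := leqP i j.
  have dE : natdist i j = (j - i)%N.
    by rewrite /natdist (eqP (_ : (i - j)%N == 0%N)) ?add0n// subn_eq0.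
  have xE : i.+1%:R - j.+1%:R = - (j - i)%:R :> R.
    by rewrite natrB// -[i.+1%:R]natr1 -[j.+1%:R]natr1; ring.
  rewrite dE xE; apply: main; rewrite ?fourth_difference_even ?/rho ?opprK//.
  by rewrite natrB// -[i.+1%:R]natr1 -[j.+1%:R]natr1; ring.
have dE : natdist i j = (i - j)%N.
  by rewrite /natdist (eqP (_ : (j - i)%N == 0%N)) ?addn0// subn_eq0.
have xE : i.+1%:R - j.+1%:R = (i - j)%:R :> R.
  by rewrite natrB// -[i.+1%:R]natr1 -[j.+1%:R]natr1; ring.
rewrite dE xE; apply: main; rewrite ?/rho ?opprK//.
by rewrite natrB// -[i.+1%:R]natr1 -[j.+1%:R]natr1; ring.
Qed.

Lemma increment_remainderC (i j : nat) : r i j = r j i.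
Proof. by rewrite /r natdistC (addrC i.+1%:R). Qed.

Lemma increment_decay_le : exists2 K, 0 <= K & forall n, `|rho n| <= K * n.+1%:R ^- 2.
Proof. by apply: fourth_difference_decay; rewrite gerBl ltW. Qed.

Lemma increment_remainder_le : exists2 B, 0 <= B & forall i j, `|r i j| <= B.
Proof.
have [K K0 hK] := increment_decay_le.
have g3 : gam + 1 <= 3.
  by have -> : gam + 1 = 3 - beta by [ring]; rewrite gerBl ltW.
have [C C0 hC] := fourth_difference_bounded g3.
pose c1 := `|(2 * (gam + 1))^-1|; pose c2 := `|2^-1 - (2 * (gam + 1))^-1|.
have [c10 c20] : 0 <= c1 /\ 0 <= c2 by split; exact: normr_ge0.
exists (C * c1 + c2 * C + K) => [|i j]; first by rewrite !addr_ge0 ?mulr_ge0.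
apply: (le_trans (ler_normD _ _)); apply: lerD; last first.
  rewrite !normrM; set n := natdist i j; rewrite (ger0_norm (ler0n R n)) ger0_norm ?invr_ge0//.
  apply: (@le_trans _ _ (1 * (n%:R * (K * n.+1%:R ^- 2)))).
    rewrite ler_pM ?mulr_ge0 ?invr_ge0//; first by rewrite invf_le1// ler1n.
    by rewrite ler_wpM2l.
  rewrite mul1r mulrCA ler_piMr// ler_pdivrMr ?exprn_gt0 ?ltr0n// mul1r.
  by rewrite -natrX ler_nat expnS expn1 -[leqLHS]muln1 leq_mul.
apply: (le_trans (ler_normD _ _)); apply: lerD; rewrite normrM.
  by apply: ler_wpM2r c10 _ _ _; rewrite -natrD.
exact: ler_wpM2l c20 _ _ (hC _).
Qed.

Lemma cosine_transform_increment_decay (j : int) :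
  cosine_transform (@g_te R d beta) j%:~R = 16^-1 * cos_defect d beta 1 * rho `|j|%N.
Proof.
rewrite cosine_transform_g_teE// /rho mulrN -!mulNr; congr (_ * _).
case: j => n; first by [].
by rewrite NegzE rmorphN/= fourth_difference_even.
Qed.

Definition decay_square_sum : R := lim (two_sided_sum (fun n => rho n ^+ 2) m @[m --> \oo]).
Local Notation L := decay_square_sum.

Lemma two_sided_sum_cvg : two_sided_sum (fun n => rho n ^+ 2) m @[m --> \oo] --> L.
Proof.
have [K K0 hK] := increment_decay_le.
apply: nondecreasing_is_cvgn.
  apply/nondecreasing_seqP => m; rewrite /two_sided_sum big_ord_recr/= lerD2l ler_pM2l//.
  by rewrite lerDl sqr_ge0.
exists (rho 0 ^+ 2 + 2 * (3 * K ^+ 2)) => _ [m _ <-].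
rewrite /two_sided_sum lerD2l ler_pM2l//.
apply: le_trans (sum_mul_sqr_decay m K0 hK); apply: ler_sum => j _.
by rewrite ler_peMl ?sqr_ge0// ler1n.
Qed.

(** rho(0) = 8 - 2^(3-beta) is positive, because beta > 0. Hence the limit law
    is not degenerate. *)
Lemma decay_square_sum_gt0 : 0 < L.
Proof.
have r0 : 0 < rho 0 ^+ 2.
  rewrite exprn_even_gt0//=; apply/negP => /eqP.
  rewrite /rho /fourth_difference !add0r !normrN normr0 normr1 powR1 powR0 ?gt_eqF ?subr_gt0//.
  rewrite ger0_norm// => E.
  have : (2 : R) `^ gam < 4.
    have -> : 4 = (2 : R) `^ 2 by rewrite powR_mulrn// -natrX.
    rewrite /powR gt_eqF// ltr_expR ltr_pM2r ?ln_gt0 ?ltr1n//.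
    by rewrite gtrBl.
  by move: E; move: (_ `^ _) => e E; lra.
apply: (lt_le_trans r0); apply: (cvgr_to_ge two_sided_sum_cvg); apply: nearW => m.
by rewrite /two_sided_sum lerDl mulr_ge0// sumr_ge0// => j _; exact: sqr_ge0.
Qed.

Lemma wave_scale_gt0 : 0 < W.
Proof.
by rewrite /wave_scale !mulr_gt0 ?invr_gt0 ?exprn_gt0 ?mulr_gt0 ?pi_gt0 ?powR_gt0 ?cos_defect1_gt0.
Qed.

Lemma C_teE_decay : C_teE d beta / theta `^ (beta / 2) = W * (rho 0 / 2).
Proof.
have e0 : cosine_transform (@g_te R d beta) 0 = 16^-1 * cos_defect d beta 1 * rho 0.
  exact: (cosine_transform_increment_decay 0).
rewrite /C_teE Lnorm_g_te e0 /wave_scale powRN.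
move: (cos_defect d beta 1) (rho _) (_ `^ _)^-1 (_ ^+ d)^-1 => Phi q t p.
by field.
Qed.

Lemma C_teV_decay : C_teV d beta / theta `^ beta = 2 * W ^+ 2 * (L / 3).
Proof.
rewrite /C_teV; pose c := (16^-1 * cos_defect d beta 1) ^+ 2.
rewrite (eq_esum (b := fun j : int => (c * rho `|j|%N ^+ 2)%:E)); last first.
  by move=> j _; rewrite cosine_transform_increment_decay exprMn.
rewrite (@esum_int _ (fun n => c * rho n ^+ 2) (c * L)); first last.
- rewrite (_ : two_sided_sum _ = fun m => c * two_sided_sum (fun n => rho n ^+ 2) m).
    by apply: cvgMr; exact: two_sided_sum_cvg.
  by apply/funext => m; rewrite /two_sided_sum -mulr_sumr; ring.
- by move=> n; rewrite mulr_ge0 ?sqr_ge0.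
rewrite /wave_scale /c/= mulnC exprM powRN.
have -> : theta `^ beta = (theta `^ (beta / 2)) ^+ 2.
  rewrite -powR_mulrn ?powR_ge0// -powRrM; congr (_ `^ _); by field.
have t0 : theta `^ (beta / 2) != 0 by rewrite gt_eqF ?powR_gt0.
have p0 : (2 * pi) ^+ d != 0 :> R by rewrite expf_neq0// gt_eqF// mulr_gt0 ?pi_gt0.
move: (cos_defect d beta 1) L (_ `^ _) t0 (_ ^+ d) p0 => Phi l t t0 p p0.
by field; rewrite t0.
Qed.

Context {disp : measure_display} {Omega : measurableType disp}.
Variables (P : probability Omega R) (u : R -> euclid R d -> {RV P >-> R}).
Hypothesis hu : wave_solution theta beta u.
Variables (x : euclid R d) (delta : nat -> R).
Hypothesis delta0 : forall m, 0 < delta m.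

Let s := toeplitz_min rho r.
Let S m (i j : 'I_m) : R := W * delta m `^ (gam + 1) * s i j.
Let c (m : nat) : R := Num.sqrt m%:R * (delta m `^ (beta - 3) / m%:R ^+ 2).
Let a (m : nat) : R := Num.sqrt m%:R * (C_teE d beta / theta `^ (beta / 2)).

Let mesh_scale m : delta m `^ (beta - 3) * delta m `^ (gam + 1) = 1.
Proof.
rewrite -powRD; last by rewrite (gt_eqF (delta0 m)) implybT.
by rewrite (_ : beta - 3 + (gam + 1) = 0) ?powRr0//; ring.
Qed.

Let cS (m : nat) : (0 < m)%N -> (c m * (W * delta m `^ (gam + 1))) = W * Num.sqrt m%:R / m%:R ^+ 2.
Proof.
move=> m0; rewrite /c; have := mesh_scale m; move: (_ `^ (beta - 3)) (_ `^ (gam + 1)) => p q pq.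
rewrite -[RHS]mulr1 -pq; ring.
Qed.

Let sC i j : s i j = s j i.
Proof. by apply: toeplitz_minC; exact: increment_remainderC. Qed.

Let c_gt0 m : (0 < m)%N -> 0 < c m.
Proof.
by move=> m0; rewrite /c mulr_gt0 ?sqrtr_gt0 ?ltr0n// divr_gt0 ?powR_gt0 ?exprn_gt0 ?ltr0n.
Qed.

Let variance_cvg : 2 * c m ^+ 2 * (\sum_(i < m) \sum_j S i j ^+ 2) @[m --> \oo] -->
  2 * W ^+ 2 * (L / 3).
Proof.
have [K K0 hK] := increment_decay_le; have [B B0 hB] := increment_remainder_le.
have [C C0 hC] := toeplitz_sqr_asymptotics K0 B0 hK hB two_sided_sum_cvg.
apply: (@cvg_of_rate _ _ (fun m => 2 * W ^+ 2 * C * m%:R^-1)) => [m m0|]; last first.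
  by rewrite -[X in _ --> X](mulr0 (2 * W ^+ 2 * C)); apply: cvgMr; exact: cvg_inv_nat.
have mR : 0 < m%:R :> R by rewrite ltr0n.
have -> : \sum_(i < m) \sum_j S i j ^+ 2 = (W * delta m `^ (gam + 1)) ^+ 2 * \sum_(i < m) \sum_(j < m) s i j ^+ 2.
  rewrite mulr_sumr; apply: eq_bigr => i _; rewrite mulr_sumr; apply: eq_bigr => j _.
  by rewrite exprMn.
rewrite -mulrA (mulrA (c m ^+ 2)) -exprMn cS//.
have := hC m; rewrite -/s; move: (\sum_(i < m) _) => Q hQ.
have -> : 2 * ((W * Num.sqrt m%:R / m%:R ^+ 2) ^+ 2 * Q) - 2 * W ^+ 2 * (L / 3) =
    2 * W ^+ 2 * m%:R ^- 3 * (Q - L * m%:R ^+ 3 / 3).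
  have : Num.sqrt m%:R ^+ 2 = m%:R :> R by rewrite sqr_sqrtr// ler0n.
  move: (Num.sqrt m%:R) mR => q + qm; rewrite -qm => mR {hQ}.
  by field; move: mR; rewrite exprn_even_gt0//= => ->.
have w0 : 0 <= 2 * W ^+ 2 * m%:R ^- 3 :> R by rewrite mulr_ge0 ?invr_ge0 ?exprn_ge0// mulr_ge0// sqr_ge0.
rewrite normrM (ger0_norm w0); apply: (le_trans (ler_wpM2l w0 hQ)).
by rewrite le_eqVlt; apply/orP; left; apply/eqP; field; rewrite gt_eqF.
Qed.

Let fourth_cvg : c m ^+ 4 * (\sum_(i < m) \sum_j sqmx (S (m:=m)) i j ^+ 2) @[m --> \oo] --> 0.
Proof.
have [K K0 hK] := increment_decay_le; have [B B0 hB] := increment_remainder_le.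
have C0 : 0 <= 6 * K + B by rewrite addr_ge0 ?mulr_ge0.
apply: (@cvg_of_rate _ _ (fun m => W ^+ 4 * (6 * K + B) ^+ 4 * m%:R^-1)) => [m m0|]; last first.
  by rewrite -[X in _ --> X](mulr0 (W ^+ 4 * (6 * K + B) ^+ 4)); apply: cvgMr; exact: cvg_inv_nat.
have mR : 0 < m%:R :> R by rewrite ltr0n.
have -> : \sum_(i < m) \sum_j sqmx (S (m:=m)) i j ^+ 2 =
    (W * delta m `^ (gam + 1)) ^+ 4 * \sum_(i < m) \sum_(j < m) (\sum_(k < m) s i k * s k j) ^+ 2.
  rewrite mulr_sumr; apply: eq_bigr => i _; rewrite mulr_sumr; apply: eq_bigr => j _.
  rewrite -[4%N]/(2 * 2)%N exprM -exprMn mulr_sumr; congr (_ ^+ 2).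
  by apply: eq_bigr => k _; rewrite /S (sC k i) expr2; ring.
rewrite mulrA -exprMn cS// subr0.
have := sum_sqr_mul_le C0 (fun i j => sC i j) (@toeplitz_row_le _ _ _ _ _ K0 hK hB m).
set Q := \sum_(i < m) _ => hQ.
have Q0 : 0 <= Q by apply: sumr_ge0 => i _; apply: sumr_ge0 => j _; exact: sqr_ge0.
rewrite ger0_norm; last first.
  by rewrite mulr_ge0// -[4%N]/(2 * 2)%N exprM sqr_ge0.
have -> : (W * Num.sqrt m%:R / m%:R ^+ 2) ^+ 4 = W ^+ 4 * m%:R ^- 6.
  have : Num.sqrt m%:R ^+ 2 = m%:R :> R by rewrite sqr_sqrtr// ler0n.
  move: (Num.sqrt m%:R) mR => q + qm; rewrite -qm => mR.
  by field; move: mR; rewrite exprn_even_gt0//= => ->.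
have w0 : 0 <= W ^+ 4 * m%:R ^- 6 :> R.
  by rewrite mulr_ge0 ?invr_ge0 ?exprn_ge0// ltW// wave_scale_gt0.
apply: (le_trans (ler_wpM2l w0 hQ)).
by rewrite le_eqVlt; apply/orP; left; apply/eqP; field; rewrite gt_eqF.
Qed.

Let trace_cvg : c m * (\sum_(i < m) S i i) - a m @[m --> \oo] --> 0.
Proof.
have [K K0 hK] := increment_decay_le; have [B B0 hB] := increment_remainder_le.
have [C C0 hC] := toeplitz_trace_asymptotics rho B0 hB.
apply: (@cvg_of_rate _ _ (fun m => W * C * (Num.sqrt m%:R)^-1)) => [m m0|]; last first.
  by rewrite -[X in _ --> X](mulr0 (W * C)); apply: cvgMr; exact: cvg_inv_sqrt_nat.
have mR : 0 < m%:R :> R by rewrite ltr0n.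
rewrite subr0 /S -mulr_sumr mulrA cS// /a C_teE_decay.
have := hC m; rewrite -/s; set Q := \sum_(i < m) _ => hQ.
have sq : Num.sqrt m%:R ^+ 2 = m%:R :> R by rewrite sqr_sqrtr// ler0n.
have q0 : 0 < Num.sqrt m%:R :> R by rewrite sqrtr_gt0.
have -> : W * Num.sqrt m%:R / m%:R ^+ 2 * Q - Num.sqrt m%:R * (W * (rho 0 / 2)) =
    W * Num.sqrt m%:R / m%:R ^+ 2 * (Q - rho 0 / 2 * m%:R ^+ 2).
  by field; rewrite gt_eqF.
have w0 : 0 <= W * Num.sqrt m%:R / m%:R ^+ 2 :> R.
  by rewrite mulr_ge0 ?invr_ge0 ?exprn_ge0// mulr_ge0 ?(ltW wave_scale_gt0)// ltW.
rewrite normrM (ger0_norm w0); apply: (le_trans (ler_wpM2l w0 hQ)).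
rewrite le_eqVlt; apply/orP; left; apply/eqP.
move: (Num.sqrt m%:R) q0 sq => q q0 <-; by field; rewrite gt_eqF.
Qed.

Lemma temporal_variation_clt : cvg_in_law P
  (fun m w => Num.sqrt m%:R *
     (delta m `^ (beta - 3) / m%:R ^+ 2 * V_te u (delta m) x m w -
      C_teE d beta / theta `^ (beta / 2)))
  (gaussian_law 0 (C_teV d beta / theta `^ beta)).
Proof.
have VE m : (fun w => Num.sqrt m%:R *
     (delta m `^ (beta - 3) / m%:R ^+ 2 * V_te u (delta m) x m w -
      C_teE d beta / theta `^ (beta / 2))) =
    (fun w => c m * (\sum_(i < m) increment_te u (delta m) x i.+1 w ^+ 2) - a m).
  by apply/funext => w; rewrite /V_te big_add1/= big_mkord /c /a; ring.
have mX m (i : 'I_m) : measurable_fun setT (increment_te u (delta m) x i.+1).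
  apply: measurable_funB; last exact: measurable_funM.
  by apply: measurable_funD; exact: measurable_funPT.
split=> [m|z _].
  by rewrite VE; exact: (measurable_W c a mX).
have v0 : 0 < C_teV d beta / theta `^ beta.
  rewrite C_teV_decay; apply: mulr_gt0; last by rewrite divr_gt0 ?decay_square_sum_gt0.
  by apply: mulr_gt0 => //; apply: exprn_gt0; exact: wave_scale_gt0.
have s0 : 0 < Num.sqrt (C_teV d beta / theta `^ beta) by rewrite sqrtr_gt0.
rewrite /gaussian_law gt_eqF//.
under eq_cvg do rewrite VE.
apply: (quadratic_clt (S := S) mX _ _ s0 c_gt0).
- by move=> m i j; rewrite /S sC.
- move=> m y; rewrite (increment_cos b0 b2 bd th0 hu x y (delta0 m)).
  congr (expR (- _ / 2)); apply: eq_bigr => i _; apply: eq_bigr => j _.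
  by rewrite increment_covarianceE.
- by rewrite sqr_sqrtr ?(ltW v0)// C_teV_decay; exact: variance_cvg.
- exact: fourth_cvg.
- exact: trace_cvg.
Qed.

End limit_theorem.

Theorem theorem4p8 (R : realType) (d : nat) (beta theta : R)
    (hbeta : 0 < beta < Num.min 2 d%:R) (htheta : 0 < theta)
    (disp : measure_display) (Omega : measurableType disp)
    (P : probability Omega R) (u : R -> euclid R d -> {RV P >-> R})
    (hu : wave_solution theta beta u)
    (x : euclid R d) (delta : nat -> R) (hdelta : forall m, 0 < delta m) :
  cvg_in_law P
    (fun m w => Num.sqrt m%:R *
       (delta m `^ (beta - 3) / m%:R ^+ 2 * V_te u (delta m) x m w -
        C_teE d beta / theta `^ (beta / 2)))
    (gaussian_law 0 (C_teV d beta / theta `^ beta)).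
Proof.
move: hbeta; rewrite lt_min => /andP[b0 /andP[b2 bd]].
exact: temporal_variation_clt.
Qed.
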